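(* Suppose $m,n$ are positive integers, $m\leq n$, $U$ is an open subset of $\mathbf{R}^n$, $V$ is an $m$ dimensional varifold in $U$, $\|\delta V\|$ is a Radon measure, $\Theta^m(\|V\|,x)\geq1$ for $\|V\|$ almost all $x$; if $m>1$, suppose additionally that $\mathbf{h}(V,\cdot)\in\mathbf{L}_m^{\mathrm{loc}}(\|V\|,\mathbf{R}^n)$ and $\delta V(\theta)=-\int\mathbf{h}(V,x)\bullet\theta(x)\,d\|V\|x$ for $\theta\in\mathscr{D}(U,\mathbf{R}^n)$. Suppose $\Phi$ is the family of all connected components of $\operatorname{spt}\|V\|$. Then the following four statements hold. (1) If $C\in\Phi$, then $C=\bigcup\{\operatorname{spt}\|W\|:W\in\Xi,\ C\cap\operatorname{spt}\|W\|\neq\varnothing\}$ whenever $\Xi$ is a decomposition of $V$. (2) $\operatorname{card}(\Phi\cap\{C:C\cap K\neq\varnothing\})<\infty$ whenever $K$ is a compact subset of $U$. (3) If $C\in\Phi$, then $C$ is open relative to $\operatorname{spt}\|V\|$. (4) If $C\in\Phi$, then $\operatorname{spt}(\|V\|\llcorner C)=C$ and $V\partial C=0$.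
   Context: Measures are outer measures; $(\mu\llcorner A)(B)=\mu(A\cap B)$. $\mathbf{B}(x,r)$ is the closed ball; $\boldsymbol{\alpha}(m)$ is the Lebesgue measure of the unit ball in $\mathbf{R}^m$; $\Theta^m(\mu,x)=\lim_{r\to0+}\mu(\mathbf{B}(x,r))/(\boldsymbol{\alpha}(m)r^m)$. Supports are relative to $U$. $\mathbf{G}(n,m)$ is the set of $m$ dimensional subspaces of $\mathbf{R}^n$; $P_\natural$ is the orthogonal projection onto $P$; $\sigma\bullet\tau=\operatorname{trace}(\sigma^\ast\circ\tau)$. $\mathscr{D}(U,\mathbf{R}^n)$: smooth compactly supported functions; $\mathscr{K}(X)$: continuous real valued functions with compact support. $\mathbf{L}_m^{\mathrm{loc}}$: $m$ integrable on compact subsets. An $m$ dimensional varifold in $U$ is a Radon measure $V$ over $U\times\mathbf{G}(n,m)$; $\mathbf{V}_m(U)$ is the set of these; $\|V\|(A)=V(A\times\mathbf{G}(n,m))$; $\delta V(\theta)=\int P_\natural\bullet D\theta(x)\,dV(x,P)$. For linear $S:\mathscr{D}(U,\mathbf{R}^n)\to\mathbf{R}$, $\|S\|$ is the largest Borel regular measure over $U$ with $\|S\|(G)=\sup\{S(\theta):\operatorname{spt}\theta\subset G,|\theta|\leq1\}$ for open $G$. If $\|S\|$ is Radon, $S$ also denotes its continuous extension to $\mathbf{L}_1(\|S\|,\mathbf{R}^n)$ and $(S\llcorner A)(\theta)=S(\theta_A)$, $\theta_A=\theta$ on $A$, $\theta_A=0$ elsewhere. $\mathbf{h}(V,x)\in\mathbf{R}^n$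 is characterised by $\mathbf{h}(V,x)\bullet u=-\lim_{r\to0+}(\delta V)(b_{x,r}u)/\|V\|(\mathbf{B}(x,r))$ for $u\in\mathbf{R}^n$, $b_{x,r}$ the characteristic function of $\mathbf{B}(x,r)$. $V\partial E=(\delta V)\llcorner E-\delta(V\llcorner(E\times\mathbf{G}(n,m)))$ for $\|V\|+\|\delta V\|$ measurable $E$. $V$ (with $\|\delta V\|$ Radon) is indecomposable if there is no $\|V\|+\|\delta V\|$ measurable $E$ with $\|V\|(E)>0$, $\|V\|(U\setminus E)>0$, $V\partial E=0$. $W$ is a component of $V$ iff $0\neq W\in\mathbf{V}_m(U)$ is indecomposable and $W=V\llcorner(E\times\mathbf{G}(n,m))$ for some $\|V\|+\|\delta V\|$ measurable $E$ with $V\partial E=0$. $\Xi\subset\mathbf{V}_m(U)$ is a decomposition of $V$ iff: each member of $\Xi$ is a component of $V$; whenever $W,X\in\Xi$ are distinct there are disjoint $\|V\|+\|\delta V\|$ measurable sets $E,F$ with $V\partial E=0=V\partial F$, $W=V\llcorner(E\times\mathbf{G}(n,m))$, $X=V\llcorner(F\times\mathbf{G}(n,m))$; and $V(k)=\sum_{W\in\Xi}W(k)$ for $k\in\mathscr{K}(U\times\mathbf{G}(n,m))$. *)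

(* Defs.v *)
From HB Require Import structures.
From mathcomp Require Import all_boot all_order all_algebra.
From mathcomp Require Import all_classical all_reals all_analysis.

Set Implicit Arguments.
Unset Strict Implicit.
Unset Printing Implicit Defensive.

Import Order.TTheory GRing.Theory Num.Theory.
Import numFieldNormedType.Exports.

Local Open Scope classical_set_scope.
Local Open Scope ring_scope.

(* Conventions.
   - A measure over a set X is an outer measure on an ambient type T with
     X : set T, vanishing on the complement of X; such outer measures are in
     bijection with the outer measures on X, and the subsets of X measurable for
     one are those measurable for the other.
   - R^n is 'rV[R]_n; linear maps act on row vectors from the right.  The
     library norm on 'rV[R]_n is the max norm, which yields the usual topology
     and derivative but not the Euclidean length, hence enorm below.            *)

HB.instance Definition _ (R : numFieldType) (T : Type) :=
  gen_eqMixin {outer_measure set T -> \bar R}.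
HB.instance Definition _ (R : numFieldType) (T : Type) :=
  gen_choiceMixin {outer_measure set T -> \bar R}.

Section constructions.
Context {R : realType}.
Local Open Scope ereal_scope.

Definition ozero (T : Type) (A : set T) : \bar R := 0.

Section ozero.
Variable T : Type.
Let z0 : @ozero T set0 = 0. Proof. by []. Qed.
Let zge A : 0 <= @ozero T A. Proof. by []. Qed.
Let zle : {homo @ozero T : A B / A `<=` B >-> A <= B}. Proof. by []. Qed.
Let zsub : sigma_subadditive (@ozero T).
Proof. by move=> F; apply: nneseries_ge0. Qed.
HB.instance Definition _ := isOuterMeasure.Build R T (@ozero T) z0 zge zle zsub.
End ozero.

Definition orestr (T : Type) (mu : {outer_measure set T -> \bar R}) (X A : set T)
  : \bar R := mu (X `&` A).

Section orestr.
Variables (T : Type) (mu : {outer_measure set T -> \bar R}) (X : set T).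
Let r0 : orestr mu X set0 = 0.
Proof. by rewrite /orestr setI0 outer_measure0. Qed.
Let rge A : 0 <= orestr mu X A. Proof. exact: outer_measure_ge0. Qed.
Let rle : {homo orestr mu X : A B / A `<=` B >-> A <= B}.
Proof. by move=> A B AB; apply: le_outer_measure; exact: setIS. Qed.
Let rsub : sigma_subadditive (orestr mu X).
Proof.
by move=> F; rewrite /orestr setI_bigcupr; exact: outer_measure_sigma_subadditive.
Qed.
HB.instance Definition _ :=
  isOuterMeasure.Build R T (orestr mu X) r0 rge rle rsub.
End orestr.

Definition ocyl (S T : Type) (mu : {outer_measure set (S * T)%type -> \bar R})
  (G : set T) (A : set S) : \bar R := mu (A `*` G).

Section ocyl.
Variables (S T : Type) (mu : {outer_measure set (S * T)%type -> \bar R}).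
Variable G : set T.
Let c0 : ocyl mu G set0 = 0.
Proof. by rewrite /ocyl set0X outer_measure0. Qed.
Let cge A : 0 <= ocyl mu G A. Proof. exact: outer_measure_ge0. Qed.
Let cle : {homo ocyl mu G : A B / A `<=` B >-> A <= B}.
Proof. by move=> A B AB; apply: le_outer_measure => -[x y] [/= /AB]. Qed.
Let csub : sigma_subadditive (ocyl mu G).
Proof.
move=> F; rewrite /ocyl.
have -> : (\bigcup_n F n) `*` G = \bigcup_n (F n `*` G).
  apply/seteqP; split=> -[x y] /=.
    by move=> [[k _ Fx] Gy]; exists k.
  by move=> [k _ [/= Fx Gy]]; split => //; exists k.
exact: outer_measure_sigma_subadditive.
Qed.
HB.instance Definition _ :=
  isOuterMeasure.Build R S (ocyl mu G) c0 cge cle csub.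
End ocyl.

End constructions.

Section outer_measures.
Context {R : realType}.

(* integral with respect to the restriction of the outer measure mu to the
   sigma-algebra of its Caratheodory measurable sets *)
Definition oint (T : pointedType) (mu : {outer_measure set T -> \bar R})
    (D : set T) (f : T -> \bar R) : \bar R :=
  @integral _ (caratheodory_type mu) R mu D f.

Definition ointR (T : pointedType) (mu : {outer_measure set T -> \bar R})
  (f : T -> R) : R := fine (oint mu setT (EFin \o f)).

Definition omeasurable (T : Type) (Y : topologicalType)
    (mu : {outer_measure set T -> \bar R}) (f : T -> Y) : Prop :=
  forall O : set Y, open O -> mu.-caratheodory (f @^-1` O).

Section topological.
Variable T : topologicalType.
Implicit Types (X A G : set T) (mu : {outer_measure set T -> \bar R}).

Definition relopen X G : Prop := exists2 O : set T, open O & G = X `&` O.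

Definition borel (B : set T) : Prop := <<s [set O : set T | open O] >> B.

Definition radon X mu : Prop :=
  [/\ mu (~` X) = 0%E,
      forall K, compact K -> K `<=` X -> (mu K < +oo)%E,
      forall G, relopen X G -> mu.-caratheodory G /\
        mu G = ereal_sup [set mu K | K in [set K | compact K /\ K `<=` G]]
    & forall A, A `<=` X ->
        mu A = ereal_inf [set mu G | G in [set G | relopen X G /\ A `<=` G]]].

Definition borel_regular X mu : Prop :=
  [/\ mu (~` X) = 0%E,
      forall G, relopen X G -> mu.-caratheodory G
    & forall A, A `<=` X ->
        exists B, [/\ borel B, A `<=` B, B `<=` X & mu B = mu A]].

Definition spt X mu : set T :=
  X `\` \bigcup_(G in [set G | relopen X G /\ mu G = 0%E]) G.

(* continuous real valued functions on X with compact support; the values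
   outside X are irrelevant *)
Definition cc_fun X (k : T -> R) : Prop :=
  {within X, continuous k} /\
  compact (X `&` closure (X `&` [set x | k x != 0])).

Definition components A : set (set T) :=
  [set connected_component A x | x in A].

End topological.
End outer_measures.

Section euclidean.
Context {R : realType}.

Definition dot n (u v : 'rV[R]_n) : R := \sum_(i < n) u ord0 i * v ord0 i.

Definition enorm n (u : 'rV[R]_n) : R := Num.sqrt (dot u u).

Definition eball n (x : 'rV[R]_n) (r : R) : set 'rV[R]_n :=
  [set y | enorm (y - x) <= r].

Definition box n (ab : 'rV[R]_n * 'rV[R]_n) : set 'rV[R]_n :=
  [set x | forall i, ab.1 ord0 i <= x ord0 i <= ab.2 ord0 i].

Definition box_volume n (ab : 'rV[R]_n * 'rV[R]_n) : R :=
  \prod_(i < n) (ab.2 ord0 i - ab.1 ord0 i).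

Definition lebesgue_outer n (A : set 'rV[R]_n) : \bar R :=
  ereal_inf [set (\sum_(0 <= k <oo) (box_volume (ab k))%:E)%E |
    ab in [set ab : nat -> 'rV[R]_n * 'rV[R]_n |
      (forall k i, (ab k).1 ord0 i <= (ab k).2 ord0 i) /\
      A `<=` \bigcup_k box (ab k)]].

Definition alpha (m : nat) : R :=
  fine (lebesgue_outer (eball (0 : 'rV[R]_m) 1)).

(* Theta^m(mu, x) exists, possibly infinite, and equals l. *)
Definition density_is n (m : nat) (mu : set 'rV[R]_n -> \bar R)
    (x : 'rV[R]_n) (l : \bar R) : Prop :=
  (mu (eball x r) * ((alpha m * r ^+ m)^-1)%:E)%E @[r --> 0^'+] --> l.

Fixpoint Ck (V W : normedModType R) (k : nat) (f : V -> W) : Prop :=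
  match k with
  | 0 => continuous f
  | k'.+1 => (forall x, differentiable f x) /\
             (forall v, Ck k' (fun x => 'D_v f x))
  end.

Definition smooth (V W : normedModType R) (f : V -> W) : Prop :=
  forall k, Ck k f.

Definition fun_spt n p (f : 'rV[R]_n -> 'rV[R]_p) : set 'rV[R]_n :=
  closure [set x | f x != 0].

(* D(U, R^n), the functions being extended by 0 to all of R^n *)
Definition test_fun n (U : set 'rV[R]_n) (theta : 'rV[R]_n -> 'rV[R]_n) : Prop :=
  [/\ smooth theta, compact (fun_spt theta) & fun_spt theta `<=` U].

(* A subspace P is encoded by (the matrix of) the orthogonal projection
   P_natural onto it, whence also the topology of G(n, m). *)
Definition Grass n (m : nat) : set 'M[R]_n :=
  [set P | [/\ P^T = P, P *m P = P & \rank P = m]].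

(* With row vectors, sigma^* o tau has matrix tau *m sigma^T, which has the same
   trace. *)
Definition mxdot n (sigma tau : 'M[R]_n) : R := \tr (sigma^T *m tau).

Definition L1 n (mu : {outer_measure set 'rV[R]_n -> \bar R})
    (f : 'rV[R]_n -> 'rV[R]_n) : Prop :=
  omeasurable mu f /\ (oint mu setT (fun x => (enorm (f x))%:E) < +oo)%E.

Definition Lploc n (U : set 'rV[R]_n) (p : nat)
    (mu : {outer_measure set 'rV[R]_n -> \bar R})
    (f : 'rV[R]_n -> 'rV[R]_n) : Prop :=
  omeasurable mu f /\ forall K, compact K -> K `<=` U ->
    (oint mu K (fun x => (enorm (f x) ^+ p)%:E) < +oo)%E.

End euclidean.

Section functionals.
Context {R : realType} {n : nat}.
Variable U : set 'rV[R]_n.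
Implicit Types (S : ('rV[R]_n -> 'rV[R]_n) -> R)
  (nu : {outer_measure set 'rV[R]_n -> \bar R}).

Definition variation_on_open S nu : Prop :=
  forall G, open G -> G `<=` U ->
    nu G = ereal_sup [set (S theta)%:E | theta in [set theta |
      [/\ test_fun U theta, fun_spt theta `<=` G &
          forall x, enorm (theta x) <= 1]]].

Definition is_variation S nu : Prop :=
  [/\ borel_regular U nu, variation_on_open S nu &
      forall nu', borel_regular U nu' -> variation_on_open S nu' ->
        forall A, (nu' A <= nu A)%E].

(* ||S||; for linear S the largest measure exists, so the default is unused *)
Definition variation S : {outer_measure set 'rV[R]_n -> \bar R} :=
  xget (@ozero R 'rV[R]_n : {outer_measure set 'rV[R]_n -> \bar R})
    [set nu | is_variation S nu].

Definition is_L1_extension S (T : ('rV[R]_n -> 'rV[R]_n) -> R) : Prop :=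
  (forall theta, test_fun U theta -> T theta = S theta) /\
  (forall f, L1 (variation S) f -> forall e : R, 0 < e ->
    exists2 d : R, 0 < d & forall g, L1 (variation S) g ->
      (oint (variation S) setT (fun x => (enorm (f x - g x))%:E) < d%:E)%E ->
      `|T f - T g| < e).

(* the continuous extension of S to L_1(||S||, R^n) for Radon ||S||; unique there, arbitrary on
   other functions *)
Definition L1_extension S : ('rV[R]_n -> 'rV[R]_n) -> R :=
  xget (fun=> 0) [set T | is_L1_extension S T].

Definition frestr S (A : set 'rV[R]_n) (theta : 'rV[R]_n -> 'rV[R]_n) : R :=
  L1_extension S (patch (fun=> 0) A theta).

End functionals.

Section varifolds.
Context {R : realType} {n : nat}.
Variables (U : set 'rV[R]_n) (m : nat).

Local Notation vmeas :=
  {outer_measure set ('rV[R]_n * 'M[R]_n)%type -> \bar R}.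
Local Notation G := (@Grass R n m).
Implicit Types (V W X : vmeas) (E F : set 'rV[R]_n).

Definition varifold V : Prop := radon (U `*` G) V.

Definition weight V : {outer_measure set 'rV[R]_n -> \bar R} := ocyl V G.

Definition vrestr V E : vmeas := orestr V (E `*` G).

Definition first_var V (theta : 'rV[R]_n -> 'rV[R]_n) : R :=
  ointR V (fun z => mxdot z.2 (jacobian theta z.1)).

Definition var_measure V : {outer_measure set 'rV[R]_n -> \bar R} :=
  variation U (first_var V).

Definition vball_fun (x : 'rV[R]_n) (r : R) (u : 'rV[R]_n) :
  'rV[R]_n -> 'rV[R]_n := fun y => \1_(eball x r) y *: u.

Definition is_mean_curv V (x h : 'rV[R]_n) : Prop :=
  forall u, - (L1_extension U (first_var V) (vball_fun x r u) /
               fine (weight V (eball x r))) @[r --> 0^'+] --> dot h u.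

(* h(V, x); 0 by convention where it does not exist *)
Definition mean_curv V (x : 'rV[R]_n) : 'rV[R]_n :=
  xget 0 [set h | is_mean_curv V x h].

Definition vmeasurable V E : Prop :=
  E `<=` U /\ (fun A => weight V A + var_measure V A)%E.-caratheodory E.

Definition vboundary V E (theta : 'rV[R]_n -> 'rV[R]_n) : R :=
  frestr U (first_var V) E theta - first_var (vrestr V E) theta.

Definition no_boundary V E : Prop :=
  forall theta, test_fun U theta -> vboundary V E theta = 0.

Definition indecomposable V : Prop :=
  [/\ varifold V, radon U (var_measure V) &
    ~ exists E, [/\ vmeasurable V E, (0 < weight V E)%E,
                    (0 < weight V (U `\` E))%E & no_boundary V E]].

Definition is_component V W : Prop :=
  [/\ varifold W, ~ (forall A, W A = 0%E), indecomposable W &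
    exists E, [/\ vmeasurable V E, no_boundary V E & W = vrestr V E]].

Definition decomposition V (Xi : set vmeas) : Prop :=
  [/\ forall W, Xi W -> is_component V W,
      forall W X, Xi W -> Xi X -> W <> X -> exists E F,
        [/\ vmeasurable V E /\ vmeasurable V F, E `&` F = set0,
            no_boundary V E /\ no_boundary V F,
            W = vrestr V E & X = vrestr V F]
    & forall k, cc_fun (U `*` G) k ->
        (* the sum of a numerical family, as the difference of the sums of the
           positive and negative parts *)
        ((ointR V k)%:E = \esum_(W in Xi) (Num.max (ointR W k) 0)%:E
                        - \esum_(W in Xi) (Num.max (- ointR W k) 0)%:E)%E].

End varifolds.

(* Main.v *)
Require Import Defs.
From HB Require Import structures.
From mathcomp Require Import all_boot all_order all_algebra.
From mathcomp Require Import all_classical all_reals all_analysis.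
From mathcomp Require finmap.
From mathcomp Require Import measurable_realfun.
From mathcomp Require Import ring lra.
Import Order.TTheory GRing.Theory Num.Theory.
Import numFieldNormedType.Exports.
Set Implicit Arguments.
Unset Strict Implicit.
Unset Printing Implicit Defensive.
Local Open Scope classical_set_scope.
Local Open Scope ring_scope.

(** The heart of the proof is a finiteness principle ([finite_parts]): a compact
    subset of [U] meets the supports of only boundedly many disjoint parts of [V]
    without boundary. A part which occupies a small portion of a ball, and carries
    little curvature there, must have zero mass in the concentric ball of half the
    radius ([small_part_vanishes]); so each of the disjoint parts takes a definite
    amount of mass or of curvature near the compact set.

    That small parts vanish is a De Giorgi iteration of a local isoperimetric
    inequality ([mass_step]). To obtain the latter, the first variation of the part
    is tested with a cutoff multiple of the radial field [z - y], at a point [y] where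
    the part has positive lower density ([weak_density]). The resulting monotonicity
    inequality ([localized_monotonicity]) bounds the mass ratio at a small scale by the
    mass ratio at a large scale, which is tiny, plus contributions of the cutoff and of
    the variation measure in dyadic balls. Hence at some scale the mass of a ball is
    controlled by these contributions in a four times smaller ball ([good_scale],
    [good_radius]), and a covering argument of Vitali type ([vitali_le]) sums up.
    Absence of boundary enters through [no_boundary_le]: the first variation of
    the part is controlled by the variation measure of [V] on it. The extension of the
    first variation to integrable fields is characterized by continuity only, whence
    the bound of a functional by its variation measure ([functional_le_integral]) and
    approximations by test fields. In dimension one the variation measure itself
    measures the curvature; otherwise the integral of the power [m] of the mean
    curvature does, by Young's inequality ([curvature_young]).

    A relatively clopen subset of the support of [V] has no boundary, because the
    indicator may be replaced by a smooth function ([clopen_no_boundary]). With the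
    finiteness principle this shows that quasi-components of the support are relatively
    open ([spt_quasi_open]); they are therefore clopen and connected, that is, they are
    the connected components. Local finiteness, relative openness and the absence of
    boundary of the components follow.

    Finally, the support of a member of a decomposition is connected
    ([indecomposable_connected_spt]), so that it lies in a single component. Finitely
    many members may be represented by disjoint parts of [V] without boundary, whence
    the supports of the members form a locally finite family
    ([decomposition_locally_finite]); by the summation formula their union is then all
    of the support of [V] ([decomposition_cover]). *)

(** * Calculus of functions of class C^k *)

Section Ck_closure.
Context {R : realType} {V : normedModType R}.
Implicit Types (W : normedModType R) (f g : V -> R).

Lemma Ck_lower W k (f : V -> W) : Ck k.+1 f -> Ck k f.
Proof.
elim: k f => [f [df _] x|k IH f [df Df]].
  exact: differentiable_continuous.
by split=> // v; exact/IH/Df.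
Qed.

Lemma Ck_cst W k (w : W) : Ck k (cst w : V -> W).
Proof.
elim: k w => [w|k IH w]; first exact: cst_continuous.
split=> [x|v]; first exact: differentiable_cst.
rewrite (_ : (fun x => _) = cst 0) //.
by apply/funext => x; rewrite derive_cst.
Qed.

Lemma Ck_add W k (f g : V -> W) : Ck k f -> Ck k g -> Ck k (fun x => f x + g x).
Proof.
elim: k f g => [f g cf cg x|k IH f g [df Df] [dg Dg]].
  by apply: cvgD; [exact: cf|exact: cg].
split=> [x|v]; first exact: differentiableD.
rewrite (_ : (fun x => _) = (fun x => 'D_v f x + 'D_v g x)).
  by apply: IH; [exact: Df|exact: Dg].
by apply/funext => x; apply: deriveD; exact: diff_derivable.
Qed.

Lemma Ck_sum W k I (s : seq I) (f : I -> V -> W) : (forall i, Ck k (f i)) ->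
  Ck k (fun x => \sum_(i <- s) f i x).
Proof.
move=> fk; elim: s => [|i s IH].
  rewrite (_ : (fun x => _) = cst 0); first exact: Ck_cst.
  by apply/funext => x; rewrite big_nil.
rewrite (_ : (fun x => _) = (fun x => f i x + \sum_(j <- s) f j x)).
  exact: Ck_add.
by apply/funext => x; rewrite big_cons.
Qed.

Lemma Ck_scale W k f (w : W) : Ck k f -> Ck k (fun x => f x *: w).
Proof.
elim: k f => [f cf x|k IH f [df Df]].
  by apply: cvgZr_tmp; exact: cf.
split=> [x|v]; first exact: differentiableZl.
rewrite (_ : (fun x => _) = (fun x => 'D_v f x *: w)); first exact/IH/Df.
apply/funext => x; rewrite !deriveE//; last exact: differentiableZl.
by rewrite diffZl.
Qed.

Lemma Ck_mul k f g : Ck k f -> Ck k g -> Ck k (fun x => f x * g x).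
Proof.
elim: k f g => [f g cf cg x|k IH f g fk gk].
  by apply: cvgM; [exact: cf|exact: cg].
have [[df Df] [dg Dg]] := (fk, gk).
split=> [x|v]; first exact: differentiableM.
rewrite (_ : (fun x => _) = (fun x => f x * 'D_v g x + g x * 'D_v f x)).
  apply: Ck_add; apply: IH; try exact: Df; try exact: Dg; exact: Ck_lower.
by apply/funext => x; apply: deriveM; exact: diff_derivable.
Qed.

Lemma Ck_inv k f : (forall x, f x != 0) -> Ck k f -> Ck k (fun x => (f x)^-1).
Proof.
move=> f0; elim: k => [cf x|k IH fk].
  by apply: cvgV => //; exact: cf.
have [df Df] := fk.
split=> [x|v]; first exact: differentiableV.
rewrite (_ : (fun x => _) = (fun x => (-1) * ((f x)^-1 * (f x)^-1 * 'D_v f x))).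
  apply: Ck_mul; first exact: Ck_cst.
  by apply: Ck_mul; [apply: Ck_mul; apply: IH; exact: Ck_lower|exact: Df].
apply/funext => x; rewrite deriveV//; last exact: diff_derivable.
by rewrite mulN1r -expr2 exprVn /GRing.scale /= mulNr.
Qed.

Lemma derive_comp_real (h : R -> R) (dh : R) f x v :
  differentiable f x -> is_derive (f x) 1 h dh ->
  'D_v (h \o f) x = 'D_v f x * dh.
Proof.
move=> df [dhx Dh]; have dhx' : differentiable h (f x) by exact/derivable1_diffP.
rewrite deriveE; last exact: differentiable_comp.
rewrite diff_comp//= deriv1E// derive1E Dh [RHS]mulrC deriveE//.
by rewrite mulrC.
Qed.

Lemma Ck_sqrt k f : (forall x, 0 < f x) -> Ck k f ->
  Ck k (fun x => Num.sqrt (f x)).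
Proof.
move=> f0; elim: k => [cf x|k IH fk].
  by apply: (@cvg_comp _ _ _ f Num.sqrt); [exact: cf|exact: sqrt_continuous].
have [df Df] := fk.
have ds x : differentiable (@Num.sqrt R) (f x).
  by apply/derivable1_diffP; have [] := is_derive1_sqrt (f0 x).
split=> [x|v]; first exact: (differentiable_comp (df x) (ds x)).
rewrite (_ : (fun x => _) =
    (fun x => 'D_v f x * (2^-1 * (Num.sqrt (f x))^-1))).
  apply: Ck_mul; first exact: Df.
  apply: Ck_mul; first exact: Ck_cst.
  apply: Ck_inv; last by apply: IH; exact: Ck_lower.
  by move=> x; rewrite gt_eqF// sqrtr_gt0.
apply/funext => x; rewrite (derive_comp_real v (df x) (is_derive1_sqrt (f0 x))).
by rewrite invfM.
Qed.

Lemma Ck_exp k f p : Ck k f -> Ck k (fun x => f x ^+ p).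
Proof.
move=> fk; elim: p => [|p IH]; first exact: Ck_cst.
rewrite (_ : (fun x => _) = (fun x => f x * f x ^+ p)); first exact: Ck_mul.
by apply/funext => x; rewrite exprS.
Qed.

End Ck_closure.

Section matrix_valued.
Context {R : realType} {V : normedModType R}.

Lemma Ck_mx k n (f : V -> 'rV[R]_n) :
  Ck k f <-> forall i, Ck k (fun x => f x ord0 i).
Proof.
split; last first.
  move=> fk.
  rewrite (_ : f = fun x => \sum_(i <- enum 'I_n) f x ord0 i *: delta_mx ord0 i).
    by apply: Ck_sum => i; apply: Ck_scale.
  by apply/funext => x; rewrite big_enum /= -row_sum_delta.
elim: k f => [f cf i x|k IH f [df Df] i].
  by apply: (@cvg_comp _ _ _ f (fun M : 'rV[R]_n => M ord0 i));
    [exact: cf|exact: coord_continuous].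
have dfi x : differentiable (fun x => f x ord0 i) x.
  by apply: (@differentiable_comp _ _ _ _ f (fun M : 'rV[R]_n => M ord0 i));
    [exact: df|exact: differentiable_coord].
split=> // v.
rewrite (_ : (fun x => _) = (fun x => 'D_v f x ord0 i)); first exact/IH/Df.
apply/funext => x; rewrite (derive_mx (M := f)) ?mxE//.
exact: diff_derivable.
Qed.

Lemma Ck_scalev k n (f : V -> R) (u : V -> 'rV[R]_n) : Ck k f -> Ck k u ->
  Ck k (fun x => f x *: u x).
Proof.
move=> fk /Ck_mx uk; apply/Ck_mx => i.
rewrite (_ : (fun x => _) = (fun x => f x * u x ord0 i)); first exact: Ck_mul.
by apply/funext => x; rewrite mxE.
Qed.

End matrix_valued.

Lemma Ck_id {R : realType} {V : normedModType R} k : Ck k (@id V).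
Proof.
case: k => [|k]; first by move=> x.
split=> // v; rewrite (_ : (fun x => _) = cst v); first exact: Ck_cst.
by apply/funext => x; rewrite derive_id.
Qed.

(** * Flat functions and smooth steps *)

Section flat_functions.
Context {R : realType}.
Implicit Types (t : R) (k : nat).

(** The powers of [1/t] make the family closed under differentiation. *)
Definition flat k t : R := if 0 < t then t^-1 ^+ k * expR (- t^-1) else 0.

Lemma flat_ge0 k t : 0 <= flat k t.
Proof.
rewrite /flat; case: ifPn => // t0.
by rewrite mulr_ge0 ?expR_ge0// exprn_ge0// invr_ge0 ltW.
Qed.

Lemma flat_le0 k t : t <= 0 -> flat k t = 0.
Proof. by rewrite /flat leNgt => /negbTE ->. Qed.

Lemma flat_gt0 k t : 0 < t -> 0 < flat k t.
Proof. by move=> t0; rewrite /flat t0 mulr_gt0 ?expR_gt0// exprn_gt0// invr_gt0. Qed.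

Lemma flat_le k t : flat k t <= k`!%:R.
Proof.
rewrite /flat; case: ifPn => // t0.
have u0 : 0 < t^-1 by rewrite invr_gt0.
set u := t^-1 in u0 *; rewrite expRN ler_pdivrMr ?expR_gt0// -ler_pdivrMl; last first.
  by rewrite ltr0n fact_gt0.
case: k => [|k].
  by rewrite fact0 expr0 mulr1 invr1 -expR0 ler_expR ltW.
by rewrite mulrC (le_trans _ (expR_ge1Dxn k (ltW u0)))// lerDr.
Qed.

Lemma flat_le_lin k t : flat k t <= k.+1`!%:R * `|t|.
Proof.
have [t0|t0] := leP t 0; first by rewrite flat_le0// mulr_ge0.
rewrite gtr0_norm// -ler_pdivrMr//; apply: le_trans (flat_le k.+1 t).
by rewrite /flat t0 exprS mulrC mulrA.
Qed.

(** All derivatives exist at the origin because [flat k.+1] dominates the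
    difference quotient of [flat k] and vanishes there. *)
Lemma is_derive_flat k t :
  is_derive t 1 (flat k) (- k%:R * flat k.+1 t + flat k.+2 t).
Proof.
have [t0|t0|->] := ltgtP t 0.
- rewrite !flat_le0 ?ltW// mulr0 addr0.
  apply: (near_eq_is_derive (f := cst 0)).
    near=> s; rewrite /= flat_le0// ltW//.
    by near: s; exact: lt_nbhsl.
- apply: (@near_eq_is_derive R R R (fun s : R => s^-1 ^+ k * expR (- s^-1)) (flat k)). 
  + near=> s; rewrite /flat ifT//; near: s; exact: (open_nbhs_nbhs (conj (@open_gt _ 0) t0)).
  have t1 : t != 0 by rewrite gt_eqF.
  have dV : is_derive t 1 (fun s : R => s^-1) (- t^-2).
    have -> : - t^-2 = - t^-2 *: (1 : R) by rewrite [RHS]mulr1.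
    exact: is_deriveV.
  have dX : is_derive t 1 (fun s : R => s^-1 ^+ k) (- k%:R * t^-1 ^+ k.+1).
    have -> : (fun s : R => s^-1 ^+ k) = (fun s : R => s^-1) ^+ k.
      by apply/funext => s; rewrite exprfctE.
    have := @is_deriveX R R (fun s => s^-1) k t 1 _ dV.
    move=> /is_derive_eq; apply.
    rewrite /GRing.scale /= -exprVn.
    case: (k) => [|j]; first by rewrite !mul0r oppr0 mul0r.
    rewrite [in RHS]exprS [in RHS]exprS; ring.
  have dE : is_derive t 1 (fun s : R => expR (- s^-1)) (t^-2 * expR (- t^-1)).
    have dN := @is_deriveN R R R _ t 1 _ dV.
    have := @is_derive1_comp R expR (- (fun s : R => s^-1)) t _ _ (is_derive_expR _) dN.
    by move=> /is_derive_eq; apply; rewrite /GRing.scale /= opprK mulrC.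
  have := @is_deriveM R R _ _ t 1 _ _ dX dE.
  move=> /is_derive_eq; apply.
  rewrite /flat t0 /GRing.scale /= -exprVn !exprS expr0; ring.
rewrite !flat_le0// mulr0 addr0.
suff H : (fun h : R => h^-1 *: ((flat k \o shift 0) (h *: 1) - flat k 0)) @ 0^' --> 0.
  by apply: DeriveDef; [apply/cvg_ex; exists 0|exact/cvg_lim].
apply/cvgr0Pnorm_le => e e0; near=> h.
rewrite /= addr0 [h *: 1]mulr1 (flat_le0 _ (lexx 0)) subr0.
have h0 : h != 0 by near: h; exact: nbhs_dnbhs_neq.
have [hn|hp] := leP h 0; first by rewrite flat_le0// scaler0 normr0 ltW.
rewrite /GRing.scale /= (_ : _ * _ = flat k.+1 h); last first.
  by rewrite /flat hp exprS mulrA.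
rewrite ger0_norm ?flat_ge0// (le_trans (flat_le_lin _ _))// -ler_pdivlMl; last first.
  by rewrite ltr0n fact_gt0.
near: h; apply: dnbhs0_le; rewrite mulr_gt0// invr_gt0 ltr0n fact_gt0//.
Unshelve. all: by end_near. Qed.

Lemma flat_continuous k : continuous (flat k).
Proof.
move=> t; apply/differentiable_continuous/derivable1_diffP.
by have [] := is_derive_flat k t.
Qed.

Lemma flat0_le s t : s <= t -> flat 0 s <= flat 0 t.
Proof.
rewrite /flat => st; case: ifPn => [s0|_]; last first.
  by case: ifPn => // _; rewrite expr0 mul1r expR_ge0.
rewrite (lt_le_trans s0 st) !expr0 !mul1r ler_expR lerN2 lef_pV2// posrE//.
exact: lt_le_trans st.
Qed.

Lemma Ck_flat (V : normedModType R) (f : V -> R) k p :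
  Ck k f -> Ck k (fun x => flat p (f x)).
Proof.
elim: k p => [p cf x|k IH p fk].
  by apply: (@cvg_comp _ _ _ f (flat p)); [exact: cf|exact: flat_continuous].
have [df Df] := fk.
split=> [x|v].
  apply: (@differentiable_comp _ _ _ _ f (flat p)) => //.
  by apply/derivable1_diffP; have [] := is_derive_flat p (f x).
rewrite (_ : (fun x => _) = (fun x => 'D_v f x *
   (- p%:R * flat p.+1 (f x) + flat p.+2 (f x)))).
  apply: Ck_mul; first exact: Df.
  apply: Ck_add; last by apply: IH; exact: Ck_lower.
  by apply: Ck_mul; [exact: Ck_cst|apply: IH; exact: Ck_lower].
apply/funext => x; exact: (derive_comp_real v (df x) (is_derive_flat p (f x))).
Qed.

(** A smooth step: [0] on the negative axis and [1] beyond [1]. *)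
Definition plateau t : R := flat 0 t / (flat 0 t + flat 0 (1 - t)).

Lemma plateau_den_gt t : expR (- 2) <= flat 0 t + flat 0 (1 - t).
Proof.
have h : flat 0 2^-1 = expR (- 2) :> R by rewrite /flat invr_gt0 ltr0n expr0 mul1r invrK.
have [t2|t2] := leP 2^-1 t.
  by rewrite -h (le_trans (flat0_le t2))// lerDl flat_ge0.
rewrite -h (@le_trans _ _ (flat 0 (1 - t)))//; last by rewrite lerDr flat_ge0.
apply: flat0_le; lra.
Qed.

Lemma plateau_den_gt0 t : 0 < flat 0 t + flat 0 (1 - t).
Proof. exact: lt_le_trans (expR_gt0 _) (plateau_den_gt t). Qed.

Lemma plateau_itv t : 0 <= plateau t <= 1.
Proof.
have d0 := plateau_den_gt0 t; apply/andP; split.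
  by rewrite /plateau divr_ge0 ?flat_ge0// ltW.
by rewrite /plateau ler_pdivrMr// mul1r lerDl flat_ge0.
Qed.

Lemma plateau0 t : t <= 0 -> plateau t = 0.
Proof. by move=> t0; rewrite /plateau flat_le0// mul0r. Qed.

Lemma plateau1 t : 1 <= t -> plateau t = 1.
Proof.
move=> t1; rewrite /plateau (@flat_le0 0 (1 - t)) ?subr_le0// addr0 divff// gt_eqF//.
by rewrite flat_gt0// (lt_le_trans ltr01).
Qed.

Lemma Ck_plateau (V : normedModType R) (f : V -> R) k :
  Ck k f -> Ck k (fun x => plateau (f x)).
Proof.
move=> fk; apply: Ck_mul; first exact: Ck_flat.
apply: Ck_inv => [x|]; first by rewrite gt_eqF// plateau_den_gt0.
apply: Ck_add; first exact: Ck_flat.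
apply: Ck_flat; apply: Ck_add; first exact: Ck_cst.
rewrite (_ : (fun x => _) = (fun x => -1 * f x)); last by apply/funext => x; rewrite mulN1r.
by apply: Ck_mul => //; exact: Ck_cst.
Qed.

Lemma plateau_derive_bound :
  exists2 C : R, 0 < C & forall t, exists2 d, is_derive t 1 plateau d & `|d| <= C.
Proof.
pose c : R := expR (- 2).
exists (4 / c ^+ 2); first by rewrite divr_gt0// exprn_gt0// expR_gt0.
move=> t; pose a := flat 0 t; pose b := flat 0 (1 - t).
pose a' := flat 2 t; pose b' := flat 2 (1 - t).
have ab := plateau_den_gt t; have ab0 := plateau_den_gt0 t.
rewrite -/a -/b in ab ab0.
have da : is_derive t 1 (flat 0) a'.
  by have := is_derive_flat 0 t; rewrite mulr0n oppr0 mul0r add0r.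
have d1 : is_derive t 1 (fun s : R => 1 - s) (- 1).
  have := @is_deriveB R R R (cst 1) id t 1 _ _ (is_derive_cst _ _ _) (is_derive_id _ _).
  by rewrite sub0r.
have db : is_derive t 1 (fun s => flat 0 (1 - s)) (- b').
  have d0 := is_derive_flat 0 (1 - t).
  have := @is_derive1_comp R (flat 0) (fun s => 1 - s) t _ _ d0 d1.
  by move=> /is_derive_eq; apply; rewrite /GRing.scale /= mulr0n oppr0 mul0r add0r mulrN1.
have dab := @is_deriveD R R R _ _ t 1 _ _ da db.
have dV : is_derive t 1 (fun s => (flat 0 s + flat 0 (1 - s))^-1)
   (- (a + b) ^- 2 *: (a' - b')).
  apply: is_deriveV => //; exact: lt0r_neq0.
have dp := @is_deriveM R R _ _ t 1 _ _ da dV.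
exists (flat 0 t *: (- (a + b) ^- 2 *: (a' - b')) + (a + b)^-1 *: a').
  exact: dp.
rewrite /GRing.scale /= -/a.
have -> : a * (- (a + b) ^- 2 * (a' - b')) + (a + b)^-1 * a' =
  (a' * b + a * b') / (a + b) ^+ 2.
  by field; rewrite gt_eqF.
have [a0 b0 a'0 b'0] : [/\ 0 <= a, 0 <= b, 0 <= a' & 0 <= b'].
  by rewrite !flat_ge0.
have [a1 b1 a'1 b'1] : [/\ a <= 1, b <= 1, a' <= 2 & b' <= 2].
  by split; [exact: flat_le 0 _|exact: flat_le 0 _|exact: flat_le 2 _|exact: flat_le 2 _].
rewrite ger0_norm; last by rewrite divr_ge0 ?exprn_ge0 ?addr_ge0 ?mulr_ge0.
apply: ler_pM.
- by rewrite addr_ge0// mulr_ge0.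
- by rewrite invr_ge0 exprn_ge0// ltW.
- have -> : 4 = 2 * 1 + 1 * 2 :> R by lra.
  by rewrite lerD// ler_pM.
rewrite lef_pV2 ?posrE ?exprn_gt0 ?expR_gt0//.
by rewrite lerXn2r ?nnegrE ?expR_ge0// ltW.
Qed.

End flat_functions.

(** * Euclidean geometry and cutoffs *)

(** Compactness as an induction principle for sets. *)
Lemma compact_ind {T : ptopologicalType} (K : set T) (P : set T -> Prop) :
  compact K -> P set0 -> (forall A B, A `<=` B -> P B -> P A) ->
  (forall A B, P A -> P B -> P (A `|` B)) ->
  (forall x, K x -> exists2 A, nbhs x A & P A) -> P K.
Proof.
move=> cK P0 Ple PU PK.
have /choice[F FP] : forall x, exists A, K x -> [/\ open A, A x & P A].
  move=> x; have [/PK[A xA PA]|nKx] := pselect (K x); last by exists set0.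
  exists A^° => _; split; [exact: open_interior|exact: xA|].
  exact: (Ple _ _ (@interior_subset _ _) PA).
have PF (s : seq T) : (forall i, i \in s -> K i) ->
    P (\bigcup_(i in [set i | i \in s]) F i).
  elim: s => [_|i s IH sK]; first by apply: Ple P0 => x [].
  apply: (Ple _ (F i `|` \bigcup_(i in [set i | i \in s]) F i)).
    by move=> x [j /=]; rewrite inE => /predU1P[->|js Fj]; [left|right; exists j].
  apply: PU; first by have [] := FP i (sK i (mem_head _ _)).
  by apply: IH => j js; apply: sK; rewrite inE js orbT.
move: cK; rewrite compact_cover => /(_ T K F)[x /FP[]//|x Kx|D DK KD].
  by exists x => //; have [] := FP _ Kx.
apply: (Ple _ _ KD); apply: (PF (finmap.enum_fset D)) => i iD.
exact/set_mem/(DK i iD).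
Qed.

Section euclid.
Context {R : realType} {n : nat}.
Implicit Types (u v w x y z : 'rV[R]_n) (r s : R).

Lemma dotC u v : dot u v = dot v u.
Proof. by apply: eq_bigr => i _; rewrite mulrC. Qed.

Lemma dotDl u v w : dot (u + v) w = dot u w + dot v w.
Proof. by rewrite -big_split; apply: eq_bigr => i _; rewrite mxE mulrDl. Qed.

Lemma dotZl (a : R) u v : dot (a *: u) v = a * dot u v.
Proof. by rewrite /dot mulr_sumr; apply: eq_bigr => i _; rewrite mxE mulrA. Qed.

Lemma dotNl u v : dot (- u) v = - dot u v.
Proof. by rewrite -scaleN1r dotZl mulN1r. Qed.

Lemma dotBl u v w : dot (u - v) w = dot u w - dot v w.
Proof. by rewrite dotDl dotNl. Qed.

Lemma dotDr u v w : dot w (u + v) = dot w u + dot w v.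
Proof. by rewrite dotC dotDl !(dotC w). Qed.

Lemma dotZr (a : R) u v : dot u (a *: v) = a * dot u v.
Proof. by rewrite dotC dotZl dotC. Qed.

Lemma dotBr u v w : dot w (u - v) = dot w u - dot w v.
Proof. by rewrite dotC dotBl !(dotC w). Qed.

Lemma dot_ge0 u : 0 <= dot u u.
Proof. by apply: sumr_ge0 => i _; rewrite -expr2 sqr_ge0. Qed.

Lemma sqr_coord_le u i : u ord0 i ^+ 2 <= dot u u.
Proof.
rewrite /dot (bigD1 i)//= -expr2 lerDl.
by apply: sumr_ge0 => j _; rewrite -expr2 sqr_ge0.
Qed.

Lemma dot_eq0 u : dot u u = 0 -> u = 0.
Proof.
move=> u0; apply/rowP => i; rewrite mxE; apply/eqP; rewrite -sqrf_eq0.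
by apply/eqP/le_anti; rewrite sqr_ge0 andbT -u0 sqr_coord_le.
Qed.

Lemma dot_sqr_le u v : dot u v ^+ 2 <= dot u u * dot v v.
Proof.
have [v0|v0] := eqVneq (dot v v) 0.
  rewrite (dot_eq0 v0) (_ : dot u 0 = 0) ?expr0n ?mulr_ge0 ?dot_ge0//.
  by rewrite -(scale0r 0) dotZr mul0r.
have vp : 0 < dot v v by rewrite lt_neqAle eq_sym v0 dot_ge0.
have := dot_ge0 (dot v v *: u - dot u v *: v).
rewrite dotBl !dotBr !dotZl !dotZr (dotC v u).
set a := dot u u; set b := dot u v; set c := dot v v => h.
have : 0 <= c * (c * a - b ^+ 2) by move: h; congr (_ <= _); ring.
by rewrite pmulr_rge0// subr_ge0 mulrC.
Qed.

Lemma enorm_ge0 u : 0 <= enorm u. Proof. exact: sqrtr_ge0. Qed.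

Lemma sqr_enorm u : enorm u ^+ 2 = dot u u.
Proof. by rewrite sqr_sqrtr// dot_ge0. Qed.

Lemma dot_le u v : `|dot u v| <= enorm u * enorm v.
Proof.
rewrite -ler_sqr ?nnegrE ?mulr_ge0 ?enorm_ge0 ?normr_ge0//.
by rewrite real_normK ?num_real// exprMn !sqr_enorm dot_sqr_le.
Qed.

Lemma enormD u v : enorm (u + v) <= enorm u + enorm v.
Proof.
rewrite -ler_sqr ?nnegrE ?addr_ge0 ?enorm_ge0//.
rewrite sqr_enorm dotDl !dotDr (dotC v u) sqrrD !sqr_enorm.
have := le_trans (ler_norm _) (dot_le u v); lra.
Qed.

Lemma enormZ (a : R) u : enorm (a *: u) = `|a| * enorm u.
Proof. by rewrite /enorm dotZl dotZr mulrA -expr2 sqrtrM ?sqr_ge0// sqrtr_sqr. Qed.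

Lemma enormN u : enorm (- u) = enorm u.
Proof. by rewrite -scaleN1r enormZ normrN1 mul1r. Qed.

Lemma enormB u v : enorm (u - v) = enorm (v - u).
Proof. by rewrite -enormN opprB. Qed.

Lemma enorm0 : enorm (0 : 'rV[R]_n) = 0.
Proof. by rewrite -(scale0r 0) enormZ normr0 mul0r. Qed.

Lemma coord_le_enorm u i : `|u ord0 i| <= enorm u.
Proof.
rewrite -ler_sqr ?nnegrE ?enorm_ge0//.
by rewrite real_normK ?num_real// sqr_enorm sqr_coord_le.
Qed.

Lemma norm_le_enorm u : `|u| <= enorm u.
Proof.
rewrite [leLHS]/Num.Def.normr/= mx_normrE bigmax_le ?enorm_ge0//.
by move=> [i j] _ /=; rewrite (ord1 i) coord_le_enorm.
Qed.

Lemma enorm_le_norm u : enorm u <= n.+1%:R * `|u|.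
Proof.
rewrite -ler_sqr ?nnegrE ?enorm_ge0 ?mulr_ge0// sqr_enorm exprMn.
apply: (@le_trans _ _ (\sum_(i < n) `|u| ^+ 2)).
  apply: ler_sum => i _; rewrite -expr2 -real_normK ?num_real//.
  rewrite lerXn2r ?nnegrE// [leRHS]/Num.Def.normr/= mx_normrE.
  exact: (le_bigmax _ _ (ord0, i)).
rewrite sumr_const card_ord -[leLHS]mulr_natl ler_wpM2r ?sqr_ge0// expr2.
by rewrite -natrM ler_nat (leq_trans (leqnSn n))// leq_pmulr.
Qed.

Lemma enorm_lip u v : `|enorm u - enorm v| <= enorm (u - v).
Proof.
rewrite ler_norml; apply/andP; split.
  by rewrite lerNl opprB lerBlDr enormB (le_trans _ (enormD _ _))// subrK.
by rewrite lerBlDr (le_trans _ (enormD _ _))// subrK.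
Qed.

Lemma enorm_continuous : continuous (@enorm R n).
Proof.
move=> u; apply/(@cvgrPdist_le _ _ _ (nbhs u)) => e e0.
have /cvgrPdist_le idu : (fun v : 'rV[R]_n => v) @ u --> u by exact: cvg_id.
have e1 : 0 < n.+1%:R^-1 * e by rewrite mulr_gt0// invr_gt0.
apply: (@filterS _ (nbhs u) _ _ _ _ (idu _ e1)) => v uv.
rewrite (le_trans (enorm_lip _ _))// (le_trans (enorm_le_norm _))//.
by rewrite -ler_pdivlMl.
Qed.

Lemma distl_continuous y : continuous (fun z => enorm (z - y)).
Proof.
move=> z; apply: (@continuous_comp _ _ _ (fun z => z - y) (@enorm R n)).
  by apply: (@continuousB _ _ _ id (cst y)); [exact: cvg_id|exact: cst_continuous].
exact: enorm_continuous.
Qed.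

Lemma edist_tri x y z : enorm (x - z) <= enorm (x - y) + enorm (y - z).
Proof. by rewrite (le_trans _ (enormD _ _))// addrA subrK. Qed.

Definition oball x r : set 'rV[R]_n := [set y | enorm (y - x) < r].

Lemma oball_open x r : open (oball x r).
Proof.
apply: (@open_comp _ _ (fun z => enorm (z - x)) [set t | t < r]).
  by move=> z _; exact: distl_continuous.
exact: open_lt.
Qed.

Lemma eball_closed x r : closed (eball x r).
Proof.
apply: (@preimage_closed _ _ (fun z => enorm (z - x)) [set t | t <= r]).
  by move=> z _; exact: distl_continuous.
exact: closed_le.
Qed.

Lemma eball_compact x r : compact (eball x r).
Proof.
apply: bounded_closed_compact; last exact: eball_closed.
exists (`|x| + r); split; first exact: num_real.
move=> M rM y /= yr; apply/ltW/(le_lt_trans _ rM).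
rewrite -(subrK x y) addrC (le_trans (ler_normD _ _))// lerD2l.
exact: le_trans (norm_le_enorm _) yr.
Qed.

Lemma nbhs_oball x r : 0 < r -> nbhs x (oball x r).
Proof.
move=> r0; apply: open_nbhs_nbhs; split; first exact: oball_open.
by rewrite /oball /= subrr enorm0.
Qed.

Lemma nbhs_eball x (A : set 'rV[R]_n) : nbhs x A -> exists2 r, 0 < r & eball x r `<=` A.
Proof.
move=> /nbhs_ballP[e /= e0 eA]; exists (e / 2); first by rewrite divr_gt0.
move=> y /= ye; apply: eA; rewrite -ball_normE /ball_ /=.
by rewrite distrC (le_lt_trans (norm_le_enorm _))// (le_lt_trans ye)// ltr_pdivrMr// mulr_natr mulr2n ltrDl.
Qed.

Lemma oball_sub_eball x r : oball x r `<=` eball x r.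
Proof. by move=> y /ltW. Qed.

Lemma eball_subo x r s : r < s -> eball x r `<=` oball x s.
Proof. by move=> rs y /= yr; exact: le_lt_trans rs. Qed.

Lemma Ck_dot k (V : normedModType R) (f g : V -> 'rV[R]_n) :
  Ck k f -> Ck k g -> Ck k (fun z : V => dot (f z) (g z)).
Proof.
by move=> /Ck_mx fk /Ck_mx gk; apply: Ck_sum => i; apply: Ck_mul.
Qed.

Lemma Ck_subr k y : Ck k (fun z => z - y).
Proof. by apply: Ck_add; [exact: Ck_id|exact: Ck_cst]. Qed.

Lemma Ck_sqdist k y : Ck k (fun z => dot (z - y) (z - y)).
Proof. by apply: Ck_dot; exact: Ck_subr. Qed.

Lemma derive_sqdist y z v : 'D_v (fun z => dot (z - y) (z - y)) z = 2 * dot v (z - y).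
Proof.
have du (i : 'I_n) : 'D_v (fun z => (z - y) ord0 i) z = v ord0 i.
  have -> : (fun z => (z - y) ord0 i) = (fun z : 'rV[R]_n => z ord0 i) - cst (y ord0 i).
    by apply/funext => w; rewrite !mxE.
  have dc : derivable (fun z : 'rV[R]_n => z ord0 i) z v.
    exact/diff_derivable/differentiable_coord.
  rewrite deriveB// derive_cst subr0.
  by have := derive_mx (@derivable_id _ _ z v); rewrite derive_id => /rowP/(_ i); rewrite mxE.
have dd (i : 'I_n) : derivable (fun z => (z - y) ord0 i) z v.
  have -> : (fun z => (z - y) ord0 i) = (fun z : 'rV[R]_n => z ord0 i) - cst (y ord0 i).
    by apply/funext => w; rewrite !mxE.
  by apply: derivableB => //; exact/diff_derivable/differentiable_coord.
have -> : (fun z => dot (z - y) (z - y)) =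
    \sum_(i < n) ((fun z => (z - y) ord0 i) * (fun z => (z - y) ord0 i)).
  by apply/funext => w; rewrite fct_sumE.
rewrite derive_sum; last by move=> i; exact: derivableM.
rewrite /dot mulr_sumr; apply: eq_bigr => i _.
rewrite deriveM// du /GRing.scale /= !mxE; ring.
Qed.

(** A smooth cutoff: [1] on the ball of radius [s], [0] off the ball of
    radius [r]. *)
Definition cutoff x s r z : R :=
  plateau ((r ^+ 2 - dot (z - x) (z - x)) / (r ^+ 2 - s ^+ 2)).

Lemma cutoff_itv x s r z : 0 <= cutoff x s r z <= 1.
Proof. exact: plateau_itv. Qed.

Lemma cutoff_smooth x s r : smooth (cutoff x s r).
Proof.
move=> k; apply: Ck_plateau; apply: Ck_mul; last exact: Ck_cst.
apply: Ck_add; first exact: Ck_cst.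
rewrite (_ : (fun z => _) = (fun z => -1 * dot (z - x) (z - x))).
  by apply: Ck_mul; [exact: Ck_cst|exact: Ck_sqdist].
by apply/funext => z; rewrite mulN1r.
Qed.

Lemma cutoff1 x s r z : 0 <= s < r -> enorm (z - x) <= s -> cutoff x s r z = 1.
Proof.
move=> /andP[s0 sr] zs; apply: plateau1.
have rs : 0 < r ^+ 2 - s ^+ 2 by rewrite subr_gt0 ltrXn2r// ?nnegrE ltW// (le_lt_trans s0).
by rewrite ler_pdivlMr// mul1r lerD2l lerN2 -sqr_enorm lerXn2r ?nnegrE ?enorm_ge0.
Qed.

Lemma cutoff0 x s r z : 0 <= s < r -> r <= enorm (z - x) -> cutoff x s r z = 0.
Proof.
move=> /andP[s0 sr] zs; apply: plateau0.
have r0 := le_lt_trans s0 sr.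
have rs : 0 < r ^+ 2 - s ^+ 2 by rewrite subr_gt0 ltrXn2r// ?nnegrE ltW.
rewrite pmulr_lle0 ?invr_gt0// subr_le0 -sqr_enorm lerXn2r ?nnegrE ?enorm_ge0//.
exact: ltW.
Qed.

End euclid.

Arguments distl_continuous {R n} y x.
Arguments enorm_continuous {R n} x.
Arguments eball_compact {R n} x r.
Arguments eball_closed {R n} x r.
Arguments oball_open {R n} x r.

(** * Smooth Urysohn functions and test fields *)

Section cutoffs.
Context {R : realType} {n : nat}.
Implicit Types (u v w x y z : 'rV[R]_n) (r s : R).

Lemma smooth_differentiable (V W : normedModType R) (f : V -> W) (x : V) :
  smooth f -> differentiable f x.
Proof. by move=> /(_ 1%N)[]. Qed.

Lemma smooth_continuous (V W : normedModType R) (f : V -> W) :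
  smooth f -> continuous f.
Proof. by move=> /(_ 0%N). Qed.

Lemma differentiable_sqdist y z : differentiable (fun z => dot (z - y) (z - y)) z.
Proof. by have [] := @Ck_sqdist R n 1 y. Qed.

Lemma cutoff_derive_bound : exists2 C : R, 0 < C &
  forall x s r z v, 0 <= s < r ->
    `|'D_v (cutoff x s r) z| <= C / (r - s) * enorm v * \1_(eball x r) z.
Proof.
have [C C0 HC] := @plateau_derive_bound R.
exists (2 * C); first by rewrite mulr_gt0.
move=> x s r z v /[dup] sr /andP[s0 sr0].
have r0 : 0 < r by exact: le_lt_trans sr0.
have rs : 0 < r - s by rewrite subr_gt0.
have rs2 : r ^+ 2 - s ^+ 2 = (r - s) * (r + s) by ring.
have rs20 : 0 < r ^+ 2 - s ^+ 2 by rewrite rs2 mulr_gt0// ltr_pwDl.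
have [zr|zr] := leP (enorm (z - x)) r; last first.
  rewrite (_ : 'D_v _ z = 0) ?normr0; last first.
    rewrite (near_eq_derive (g := cst 0)) ?derive_cst//.
    have oz : open [set w | r < enorm (w - x)].
      apply: (@open_comp _ _ (fun z => enorm (z - x)) [set t | r < t]).
        by move=> w _; exact: distl_continuous.
      exact: open_gt.
    apply: filterS (open_nbhs_nbhs (conj oz zr)) => w /= /ltW; exact: cutoff0.
  by rewrite mulr_ge0// mulr_ge0 ?enorm_ge0// divr_ge0 ?mulr_ge0 ?(ltW C0) ?(ltW rs).
rewrite indicE mem_set// mulr1.
pose f z := (r ^+ 2 - dot (z - x) (z - x)) / (r ^+ 2 - s ^+ 2).
have df : differentiable f z.
  rewrite /f; apply: differentiableM => //; apply: differentiableB => //.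
  exact: differentiable_sqdist.
have [d dp dC] := HC (f z).
rewrite (derive_comp_real v df dp) normrM.
have -> : 'D_v f z = - (2 * dot v (z - x)) / (r ^+ 2 - s ^+ 2).
  have dq : derivable (fun z => dot (z - x) (z - x)) z v.
    exact/diff_derivable/differentiable_sqdist.
  have -> : f = (r ^+ 2 - s ^+ 2)^-1 *: (cst (r ^+ 2) - (fun z => dot (z - x) (z - x))).
    by apply/funext => w; rewrite /f [RHS]mulrC.
  rewrite deriveZ/=; last exact: derivableB.
  by rewrite deriveB// derive_cst sub0r derive_sqdist [LHS]mulrC.
apply: (@le_trans _ _ ((2 * (enorm v * r)) / (r ^+ 2 - s ^+ 2) * C)).
  apply: ler_pM => //.
  rewrite normrM normrN normrM normr_nat [`|_^-1|]gtr0_norm ?invr_gt0//.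
  rewrite ler_pM2r ?invr_gt0// ler_pM2l// (le_trans (dot_le _ _))//.
  by rewrite ler_wpM2l// enorm_ge0.
rewrite rs2 [leLHS](_ : _ = 2 * C / (r - s) * enorm v * (r / (r + s))); last first.
  by field; rewrite !gt_eqF// ltr_pwDl.
rewrite ler_piMr ?mulr_ge0 ?enorm_ge0 ?invr_ge0 ?(ltW C0) ?(ltW rs)//.
by rewrite ler_pdivrMr ?mul1r ?lerDl// ltr_pwDl.
Qed.

(** Smooth Urysohn functions; [psi] is [1] near [K], not only on it, which is
    what splitting a test field along a cover of its support requires. *)
Lemma smooth_urysohn (K O : set 'rV[R]_n) : compact K -> open O -> K `<=` O ->
  exists psi : 'rV[R]_n -> R, [/\ smooth psi, forall z, 0 <= psi z <= 1,
    exists N, [/\ open N, K `<=` N & forall z, N z -> psi z = 1],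
    compact (closure [set z | psi z != 0]) & closure [set z | psi z != 0] `<=` O].
Proof.
move=> cK oO KO.
apply: (@compact_ind _ K (fun K => exists psi : 'rV[R]_n -> R,
  [/\ smooth psi, forall z, 0 <= psi z <= 1,
    exists N, [/\ open N, K `<=` N & forall z, N z -> psi z = 1],
    compact (closure [set z | psi z != 0]) & closure [set z | psi z != 0] `<=` O])) => //.
- exists (cst 0); split.
  + by move=> k; exact: Ck_cst.
  + by move=> z; rewrite lexx ler01.
  + by exists set0; split => //; exact: open0.
  + rewrite (_ : [set _ | _] = set0) ?closure0; first exact: compact0.
    by apply/seteqP; split => // z /=; rewrite eqxx.
  + rewrite (_ : [set _ | _] = set0) ?closure0//.
    by apply/seteqP; split => // z /=; rewrite eqxx.
- move=> A B AB [psi [sp ip [N [oN BN N1]] cp pO]]; exists psi; split => //.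
  by exists N; split => //; exact: subset_trans BN.
- move=> A B [f [sf pf [N [oN AN N1]] cf fO]] [g [sg pg [M [oM BM M1]] cg gO]].
  have supp : [set z | 1 - (1 - f z) * (1 - g z) != 0] `<=`
      [set z | f z != 0] `|` [set z | g z != 0].
    move=> z /=; apply: contraPP => /not_orP[/negP/negPn/eqP -> /negP/negPn/eqP ->].
    by rewrite !subr0 mulr1 subrr eqxx.
  have csupp : closure [set z | 1 - (1 - f z) * (1 - g z) != 0] `<=`
      closure [set z | f z != 0] `|` closure [set z | g z != 0].
    by rewrite -closureU; exact: closure_subset.
  exists (fun z => 1 - (1 - f z) * (1 - g z)); split.
  + have s1 k (h : 'rV[R]_n -> R) : Ck k h -> Ck k (fun z => 1 - h z).
      move=> hk; rewrite (_ : (fun z => _) = (fun z => cst 1 z + (-1) * h z)).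
        by apply: Ck_add; [exact: Ck_cst|apply: Ck_mul => //; exact: Ck_cst].
      by apply/funext => z; rewrite mulN1r.
    by move=> k; apply/s1/Ck_mul; apply/s1.
  + move=> z; have /andP[f0 f1] := pf z; have /andP[g0 g1] := pg z.
    have h0 : 0 <= (1 - f z) * (1 - g z) by rewrite mulr_ge0// subr_ge0.
    have h1 : (1 - f z) * (1 - g z) <= 1 by rewrite mulr_ile1// ?subr_ge0// gerBl.
    by rewrite subr_ge0 h1 gerBl h0.
  + exists (N `|` M); split; [exact: openU|exact: setUSS|].
    by move=> z [/N1 ->|/M1 ->]; rewrite subrr ?mul0r ?mulr0 subr0.
  + apply: (subclosed_compact _ (compactU cf cg)) => //.
    exact: closed_closure.
  + by move=> z /csupp [/fO|/gO].
move=> x /KO Ox.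
have [r r0 rO] : exists2 r, 0 < r & eball x r `<=` O.
  by apply: nbhs_eball; exact: open_nbhs_nbhs.
exists (oball x (r / 2)); first by apply: nbhs_oball; rewrite divr_gt0.
have sr : 0 <= r / 2 < r.
  by rewrite divr_ge0 ?ltW//= ltr_pdivrMr// mulr_natr mulr2n ltrDl.
have supp : closure [set z | cutoff x (r / 2) r z != 0] `<=` eball x r.
  rewrite [X in _ `<=` X](closure_id _).1; last exact: eball_closed.
  apply: closure_subset => z /=; apply: contraNT; rewrite /eball/= -ltNge => /ltW zr.
  by rewrite cutoff0.
exists (cutoff x (r / 2) r); split.
- exact: cutoff_smooth.
- exact: cutoff_itv.
- exists (oball x (r / 2)); split => //; first exact: oball_open.
  by move=> z /ltW zr; exact: cutoff1.
- by apply: (subclosed_compact _ (eball_compact x r)) => //; exact: closed_closure.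
- exact: subset_trans rO.
Qed.

End cutoffs.

Section test_functions.
Context {R : realType} {n : nat} (U : set 'rV[R]_n).
Implicit Types (th : 'rV[R]_n -> 'rV[R]_n) (f : 'rV[R]_n -> R).

Lemma fun_spt_sub th th' : (forall x, th' x = 0 -> th x = 0) ->
  fun_spt th `<=` fun_spt th'.
Proof.
move=> H; apply: closure_subset => x /=; apply: contraNN => /eqP /H ->.
by rewrite eqxx.
Qed.

Lemma fun_spt0 x th : ~ fun_spt th x -> th x = 0.
Proof.
move=> xs; apply/eqP; apply: contra_notT xs => x0; exact: subset_closure.
Qed.

Lemma test_fun0 : test_fun U (cst 0).
Proof.
have e : fun_spt (cst 0 : 'rV[R]_n -> 'rV[R]_n) = set0.
  rewrite /fun_spt (_ : [set _ | _] = set0) ?closure0//.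
  by apply/seteqP; split => // z /=; rewrite eqxx.
split; rewrite ?e//; [by move=> k; exact: Ck_cst|exact: compact0].
Qed.

Lemma test_fun_add th th' : test_fun U th -> test_fun U th' ->
  test_fun U (fun x => th x + th' x).
Proof.
move=> [s c sU] [s' c' sU'].
have h : fun_spt (fun x => th x + th' x) `<=` fun_spt th `|` fun_spt th'.
  rewrite /fun_spt -closureU; apply: closure_subset => x /=.
  by apply: contraPP => /not_orP[/negP/negPn/eqP -> /negP/negPn/eqP ->]; rewrite addr0 eqxx.
split; [by move=> k; exact: Ck_add| |by move=> x /h [/sU|/sU']].
by apply: (subclosed_compact _ (compactU c c')) => //; exact: closed_closure.
Qed.

Lemma test_fun_mul f th : smooth f -> test_fun U th ->
  test_fun U (fun x => f x *: th x).
Proof.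
move=> sf [s c sU].
have h : fun_spt (fun x => f x *: th x) `<=` fun_spt th.
  by apply: fun_spt_sub => x ->; rewrite scaler0.
split; [by move=> k; exact: Ck_scalev| |exact: subset_trans sU].
by apply: (subclosed_compact _ c) => //; exact: closed_closure.
Qed.

Lemma test_fun_scale (a : R) th : test_fun U th -> test_fun U (fun x => a *: th x).
Proof. by apply: (@test_fun_mul (cst a)) => k; exact: Ck_cst. Qed.

Lemma test_fun_opp th : test_fun U th -> test_fun U (fun x => - th x).
Proof.
by move=> /(test_fun_scale (-1)); under eq_fun do rewrite scaleN1r.
Qed.

Lemma test_fun_bounded th : test_fun U th -> exists2 M, 0 < M & forall x, enorm (th x) <= M.
Proof.
move=> [s c sU].
have [M [_ HM]] : bounded_set (th @` fun_spt th).
  apply/compact_bounded/continuous_compact => //.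
  by apply/continuous_subspaceT/smooth_continuous.
have M1 : M < `|M| + 1 by rewrite (le_lt_trans (ler_norm _))// ltrDl.
exists (n.+1%:R * (`|M| + 1)); first by rewrite mulr_gt0// ltr_pwDr.
move=> x; have [xs|/fun_spt0 ->] := pselect (fun_spt th x); last first.
  by rewrite enorm0 mulr_ge0.
rewrite (le_trans (enorm_le_norm _))// ler_pM2l//; apply: (HM _ M1).
by exists x.
Qed.

End test_functions.

(** * The Grassmannian and radial fields *)

Section grassmannian.
Context {R : realType} {n : nat}.
Implicit Types (P : 'M[R]_n) (w y z : 'rV[R]_n).

Lemma mxtrace_idem P : P *m P = P -> \tr P = (\rank P)%:R.
Proof.
move=> PP; have E : row_base P *m col_base P = 1%:M.
  apply: (row_free_inj (row_base_free P)); rewrite mul1mx.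
  have cf : row_free (col_base P)^T by rewrite /row_free mxrank_tr; exact: col_base_full.
  apply: trmx_inj; apply: (row_free_inj cf); rewrite -!trmx_mul; congr (_^T).
  have -> : col_base P *m (row_base P *m col_base P *m row_base P) =
      (col_base P *m row_base P) *m (col_base P *m row_base P) by rewrite !mulmxA.
  by rewrite mulmx_base PP.
by rewrite -{1}(mulmx_base P) mxtrace_mulC E mxtrace1.
Qed.

Lemma GrassE m : @Grass R n m = [set P : 'M[R]_n | [/\ P^T = P, P *m P = P & \tr P = m%:R]].
Proof.
apply/seteqP; split=> P /= [PT PP h]; split => //; first by rewrite mxtrace_idem// h.
by apply/eqP; rewrite -(eqr_nat R) -mxtrace_idem// h.
Qed.

Lemma Grass_coord_le m P i j : @Grass R n m P -> `|P i j| <= 1.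
Proof.
move=> [PT PP _].
have E k : P k k = \sum_l P k l ^+ 2.
  by rewrite -{1}PP mxE; apply: eq_bigr => l _; rewrite -{2}PT mxE expr2.
have le k l : P k l ^+ 2 <= P k k.
  by rewrite [leRHS]E (bigD1 l)//= lerDl sumr_ge0// => ? _; exact: sqr_ge0.
have d1 k : P k k <= 1.
  have := le k k; rewrite expr2 => h.
  have [//|h1] := leP (P k k) 1.
  by move: h; rewrite ger_pMl ?(lt_trans ltr01)// => /le_lt_trans/(_ h1); rewrite ltxx.
by rewrite -ler_sqr ?nnegrE// expr1n real_normK ?num_real// (le_trans (le i j)).
Qed.

(** Among symmetric idempotents the rank is the trace, so that the Grassmannian is cut
    out by closed conditions; its entries are bounded by [1]. *)
Lemma Grass_compact m : compact (@Grass R n m : set 'M[R]_n).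
Proof.
have coordC i j : Ck 0 (fun P : 'M[R]_n => P i j) by exact: coord_continuous.
have closedE (f g : 'M[R]_n -> R) : Ck 0 f -> Ck 0 g -> closed [set P | f P = g P].
  move=> cf cg; have -> : [set P | f P = g P] = (fun P => f P + (-1) * g P) @^-1` [set 0].
    apply/seteqP; split=> P /= => [->|]; first by rewrite mulN1r subrr.
    by rewrite mulN1r => /subr0_eq.
  have h : Ck 0 (fun P => f P + (-1) * g P).
    by apply: Ck_add => //; apply: Ck_mul => //; exact: Ck_cst.
  by apply: preimage_closed; [move=> P _; exact: h|exact: closed_eq].
have vec_cont : continuous (vec_mx : 'rV[R]_(n * n) -> 'M[R]_n).
  move=> u; apply/(@cvgrPdist_le _ _ _ (nbhs u)) => e e0.
  have /cvgrPdist_le idu : (fun v : 'rV[R]_(n * n) => v) @ u --> u by exact: cvg_id.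
  apply: (@filterS _ (nbhs u) _ _ _ _ (idu _ e0)) => v /(le_trans _); apply.
  rewrite -linearB [leLHS]/Num.Def.normr/= mx_normrE bigmax_le//= => -[i j] _ /=.
  rewrite mxE [leRHS]/Num.Def.normr/= mx_normrE.
  exact: (le_bigmax _ _ (ord0, mxvec_index i j)).
have cC : compact [set v : 'rV[R]_(n * n) | forall i, `[(-1 : R), 1]%classic (v ord0 i)].
  by apply: (@rV_compact R _ (fun=> `[(-1 : R), 1]%classic)) => _; exact: segment_compact.
have cB := continuous_compact (continuous_subspaceT vec_cont) cC.
apply: (subclosed_compact _ cB); last first.
  move=> P GP; exists (mxvec P); last exact: mxvecK.
  move=> k /=; rewrite in_itv/= -ler_norml.
  by case/mxvec_indexP: k => i j; rewrite mxvecE (Grass_coord_le _ _ GP).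
rewrite GrassE.
have -> : [set P : 'M[R]_n | [/\ P^T = P, P *m P = P & \tr P = m%:R]] =
   (\bigcap_(ij in [set: 'I_n * 'I_n]) [set P : 'M[R]_n | P ij.2 ij.1 = P ij.1 ij.2]) `&`
   (\bigcap_(ij in [set: 'I_n * 'I_n])
      [set P : 'M[R]_n | \sum_k P ij.1 k * P k ij.2 = P ij.1 ij.2]) `&`
   [set P : 'M[R]_n | \sum_i P i i = m%:R].
  apply/seteqP; split=> P /= => [[PT PP tP]|[[PT PP] tP]].
    split => //; split=> -[i j] _ /=; first by rewrite -{1}PT mxE.
    by rewrite -{3}PP mxE.
  split => //; apply/matrixP => i j; rewrite mxE.
    by rewrite (PT (i, j)).
  by rewrite (PP (i, j)).
apply: closedI; first apply: closedI.
- by apply: closed_bigI => -[i j] _; exact: closedE.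
- apply: closed_bigI => -[i j] _; apply: closedE => //.
  by apply: Ck_sum => k; apply: (@Ck_mul _ _ 0).
- by apply: closedE; [exact: (@Ck_sum _ _ _ 0)|exact: (Ck_cst 0)].
Qed.

Lemma Grass_dot m P w : @Grass R n m P -> 0 <= dot (w *m P) w <= dot w w.
Proof.
move=> [PT PP _].
have E : dot (w *m P) w = dot (w *m P) (w *m P).
  have dE u v : dot u v = (u *m v^T) ord0 ord0 :> R.
    by rewrite mxE; apply: eq_bigr => i _; rewrite mxE.
  by rewrite !dE trmx_mul PT -!mulmxA (mulmxA P P) PP mulmxA.
rewrite E dot_ge0/=; have := dot_sqr_le (w *m P) w; rewrite E expr2.
have [->|p0] := eqVneq (dot (w *m P) (w *m P)) 0; first by rewrite dot_ge0.
by rewrite ler_pM2l// lt_neqAle eq_sym p0 dot_ge0.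
Qed.

Lemma Grass_enorm_le m P w : @Grass R n m P -> enorm (w *m P) <= enorm w.
Proof.
move=> GP; have := Grass_dot w GP => /andP[_].
have [PT PP _] := GP.
have E : dot (w *m P) w = dot (w *m P) (w *m P).
  have dE u v : dot u v = (u *m v^T) ord0 ord0 :> R.
    by rewrite mxE; apply: eq_bigr => i _; rewrite mxE.
  by rewrite !dE trmx_mul PT -!mulmxA (mulmxA P P) PP mulmxA.
by rewrite E -!sqr_enorm ler_sqr ?nnegrE ?enorm_ge0.
Qed.

Lemma mxdot_jacobian P (th : 'rV[R]_n -> 'rV[R]_n) z : differentiable th z ->
  mxdot P (jacobian th z) =
  \sum_i \sum_j P j i * 'D_(delta_mx ord0 j) th z ord0 i.
Proof.
move=> dth; rewrite /mxdot /mxtrace; apply: eq_bigr => i _.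
rewrite mxE; apply: eq_bigr => j _; rewrite mxE; congr (_ * _).
by rewrite deriveEjacobian// -rowE [RHS]mxE.
Qed.

(** For a radial field the tangential divergence reduces to a directional
    derivative of the profile. *)
Lemma mxdot_radial m P (om : 'rV[R]_n -> R) y z : @Grass R n m P -> differentiable om z ->
  mxdot P (jacobian (fun z => om z *: (z - y)) z) =
  m%:R * om z + 'D_((z - y) *m P) om z.
Proof.
move=> GP dom; have [PT PP _] := GP.
have dc i : differentiable (fun z => (z - y) ord0 i) z.
  have h : Ck 1 (fun z : 'rV[R]_n => (z - y) ord0 i).
    by move: i; apply/Ck_mx; exact: Ck_subr.
  by have [] := h.
have dth : differentiable (fun z => om z *: (z - y)) z.
  have -> : (fun z => om z *: (z - y)) =
     \sum_(i < n) (fun z => (om z * (z - y) ord0 i) *: delta_mx ord0 i).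
    apply/funext => w; rewrite fct_sumE [LHS]row_sum_delta.
    by apply: eq_bigr => i _; rewrite mxE.
  by apply: differentiable_sum => i; apply: differentiableZl; exact: differentiableM.
rewrite mxdot_jacobian//.
have D j i : 'D_(delta_mx ord0 j) (fun z => om z *: (z - y)) z ord0 i =
   om z * (j == i)%:R + (z - y) ord0 i * 'D_(delta_mx ord0 j) om z.
  rewrite derive_mx ?mxE; last exact: diff_derivable.
  have -> : (fun t => (om t *: (t - y)) ord0 i) = om * (fun t => (t - y) ord0 i).
    by apply/funext => t; rewrite mxE.
  rewrite deriveM; [|exact: diff_derivable|exact: diff_derivable].
  congr (_ + _); last by rewrite /GRing.scale /= !mxE.
  rewrite /GRing.scale /=; congr (_ * _).
  have := derive_mx (M := fun t => t - y) (t := z) (v := delta_mx ord0 j).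
  have dv : derivable (fun t : 'rV[R]_n => t - y) z (delta_mx ord0 j).
    by apply: derivableB; [exact: derivable_id|exact: derivable_cst].
  move=> /(_ dv) /rowP/(_ i); rewrite mxE => <-.
  have -> : 'D_(delta_mx ord0 j) (fun t : 'rV[R]_n => t - y) z = delta_mx ord0 j.
    rewrite (@deriveB _ _ _ (@id 'rV[R]_n) (cst y)); [|exact: derivable_id|exact: derivable_cst].
    by rewrite derive_id derive_cst subr0.
  by rewrite mxE eqxx/= 1?eq_sym.
transitivity (\sum_i (\sum_j P j i * (om z * (j == i)%:R) +
    \sum_j P j i * ((z - y) ord0 i * 'D_(delta_mx ord0 j) om z))).
  apply: eq_bigr => i _; rewrite -big_split; apply: eq_bigr => j _.
  by rewrite D mulrDr.
rewrite big_split /=; congr (_ + _).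
  move: GP; rewrite GrassE => -[_ _ <-]; rewrite /mxtrace mulr_suml; apply: eq_bigr => i _.
  rewrite (bigD1 i)//= eqxx mulr1 big1 ?addr0// => j /negbTE ->.
  by rewrite !mulr0.
rewrite deriveE//.
have -> : (z - y) *m P = \sum_i \sum_j ((z - y) ord0 i * P j i) *: delta_mx ord0 j.
  rewrite exchange_big /= [LHS]row_sum_delta; apply: eq_bigr => j _.
  rewrite -scaler_suml mxE; congr (_ *: _); apply: eq_bigr => i _.
  by congr (_ * _); rewrite -{1}PT mxE.
rewrite linear_sum /=; apply: eq_bigr => i _; rewrite linear_sum; apply: eq_bigr => j _.
by rewrite linearZ deriveE// /GRing.scale /= mulrCA mulrA.
Qed.

End grassmannian.

(** * The radial profile *)

Section real_derivatives.
Context {R : realType}.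
Implicit Types (f g : R -> R) (t a b : R).

Lemma is_deriveD_fun f g t a b : is_derive t 1 f a -> is_derive t 1 g b ->
  is_derive t 1 (fun t => f t + g t) (a + b).
Proof. exact: (@is_deriveD R R R). Qed.

Lemma is_deriveM_fun f g t a b : is_derive t 1 f a -> is_derive t 1 g b ->
  is_derive t 1 (fun t => f t * g t) (f t * b + g t * a).
Proof. exact: (@is_deriveM R R). Qed.

Lemma is_deriveZ_fun f c t a : is_derive t 1 f a ->
  is_derive t 1 (fun t => c * f t) (c * a).
Proof. exact: (@is_deriveZ R R R). Qed.

Lemma is_deriveX_fun f n t a : is_derive t 1 f a ->
  is_derive t 1 (fun t => f t ^+ n) (n%:R * f t ^+ n.-1 * a).
Proof.
move=> h; have -> : (fun t => f t ^+ n) = f ^+ n.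
  by apply/funext => s; rewrite exprfctE.
exact: (@is_deriveX R R f n t 1 a h).
Qed.

Lemma is_derive_comp_fun f g t a b : is_derive (g t) 1 f a -> is_derive t 1 g b ->
  is_derive t 1 (fun t => f (g t)) (a * b).
Proof. exact: is_derive1_comp. Qed.

End real_derivatives.

Section profile.
Context {R : realType}.
Variables (p : nat) (sg rho : R).
Hypotheses (sg0 : 0 < sg) (rho0 : 0 < rho).
Local Notation m := p.+1.

(** The profile [t^(-m/2)], smoothed at scale [sg] near [0] and cut off at
    [t = rho ^+ 2]; the power in the cutoff makes its derivative vanish at [0]
    fast enough to compensate the singularity. *)
Definition profile (t : R) : R :=
  flat 0 (1 - (t / rho ^+ 2) ^+ m) * (Num.sqrt (t + sg ^+ 2))^-1 ^+ m.

Definition dprofile (t : R) : R :=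
  let a := (Num.sqrt (t + sg ^+ 2))^-1 in let u := t / rho ^+ 2 in
  - (m%:R / 2 * flat 0 (1 - u ^+ m) * a ^+ m * a ^+ 2)
  - m%:R * u ^+ p / rho ^+ 2 * flat 2 (1 - u ^+ m) * a ^+ m.

Lemma is_derive_profile (t : R) : 0 <= t -> is_derive t 1 profile (dprofile t).
Proof.
move=> t0; have ts : 0 < t + sg ^+ 2 by rewrite ltr_wpDl// exprn_gt0.
have s0 : Num.sqrt (t + sg ^+ 2) != 0 by rewrite gt_eqF// sqrtr_gt0.
have d1 : is_derive t 1 (fun t : R => t / rho ^+ 2) (rho ^- 2).
  have := is_deriveZ_fun (rho ^- 2) (is_derive_id t 1).
  by rewrite mulr1; under eq_fun do rewrite mulrC.
have d2 : is_derive t 1 (fun t : R => 1 - (t / rho ^+ 2) ^+ m)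
   (- (m%:R * (t / rho ^+ 2) ^+ p * rho ^- 2)).
  have := is_deriveD_fun (@is_derive_cst R R R 1 t 1) (is_deriveZ_fun (-1) (is_deriveX_fun m d1)).
  by rewrite add0r mulN1r; under eq_fun do rewrite mulN1r.
have f0 := is_derive_flat 0 (1 - (t / rho ^+ 2) ^+ m).
rewrite mulr0n oppr0 mul0r add0r in f0.
have d3 := @is_derive_comp_fun _ (flat 0) (fun t => 1 - (t / rho ^+ 2) ^+ m) _ _ _ f0 d2.
have d4 : is_derive t 1 (fun t : R => t + sg ^+ 2) 1.
  by have := is_deriveD_fun (is_derive_id t 1) (@is_derive_cst R R R (sg ^+ 2) t 1); rewrite addr0.
have d5 := @is_derive_comp_fun _ Num.sqrt (fun t => t + sg ^+ 2) _ _ _ (is_derive1_sqrt ts) d4.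
have dV := @is_deriveV R (fun t : R => Num.sqrt (t + sg ^+ 2)) t _ 1 s0 d5.
have d6 := is_deriveX_fun m dV.
have := is_deriveM_fun d3 d6 => /is_derive_eq; apply.
rewrite /dprofile /=; set s := Num.sqrt _ in s0 *.
set f := flat 0 _; set g := flat 2 _.
rewrite /GRing.scale /= !exprS; field.
by rewrite s0 gt_eqF.
Qed.

Let aE (t : R) : 0 <= t ->
  (Num.sqrt (t + sg ^+ 2))^-1 ^+ 2 * (t + sg ^+ 2) = 1.
Proof.
move=> t0; have ts : 0 < t + sg ^+ 2 by rewrite ltr_wpDl// exprn_gt0.
by rewrite exprVn sqr_sqrtr ?ltW// mulVf// gt_eqF.
Qed.

Let a0 (t : R) : 0 <= t -> 0 < (Num.sqrt (t + sg ^+ 2))^-1.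
Proof. by move=> t0; rewrite invr_gt0 sqrtr_gt0 ltr_wpDl// exprn_gt0. Qed.

Lemma profile_ge0 (t : R) : 0 <= t -> 0 <= profile t.
Proof. by move=> t0; rewrite mulr_ge0 ?flat_ge0// exprn_ge0// ltW// a0. Qed.

Lemma profile_eq0 (t : R) : rho ^+ 2 <= t -> profile t = 0.
Proof.
move=> rt; rewrite /profile flat_le0 ?mul0r// subr_le0 exprn_ege1//.
by rewrite ler_pdivlMr ?mul1r// exprn_gt0.
Qed.

(** Subharmonicity-type inequality: [s] stands for the squared length of the
    tangential part of the position vector. *)
Lemma profile_ineq (s t : R) : 2 * sg <= rho -> 0 <= s <= t ->
  expR (- 2) / 2 ^+ m.+1 * sg ^- m * (t <= sg ^+ 2)%R%:R
  - 4 * m%:R * rho ^- m * (t <= rho ^+ 2)%R%:R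
  <= m%:R * profile t + 2 * s * dprofile t.
Proof.
move=> sr /andP[s0 st]; have t0 := le_trans s0 st.
rewrite /profile /dprofile.
set a := (Num.sqrt _)^-1; set u := t / rho ^+ 2.
set f := flat 0 _; set g := flat 2 _.
have a1 : a ^+ 2 * (t + sg ^+ 2) = 1 by exact: aE.
have ap : 0 < a by exact: a0.
have r2 : 0 < rho ^+ 2 by rewrite exprn_gt0.
have u0 : 0 <= u by rewrite divr_ge0// ltW.
have f_ge0 : 0 <= f by exact: flat_ge0.
have g_ge0 : 0 <= g by exact: flat_ge0.
have am0 : 0 <= a ^+ m by rewrite exprn_ge0// ltW.
have up0 : 0 <= u ^+ p by rewrite exprn_ge0.
have M1 : m%:R * f * a ^+ m * (a ^+ 2 * sg ^+ 2) <= m%:R * f * a ^+ m * (1 - s * a ^+ 2).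
  apply: ler_wpM2l; first by rewrite !mulr_ge0.
  have := ler_wpM2r (ltW (exprn_gt0 2 ap)) st; lra.
have M2 : expR (- 2) / 2 ^+ m.+1 * sg ^- m * (t <= sg ^+ 2)%R%:R <=
    m%:R * f * a ^+ m * (a ^+ 2 * sg ^+ 2).
  have [tsg|_] := leP t (sg ^+ 2); last first.
    by rewrite mulr0 !mulr_ge0 ?(ltW ap) ?(ltW sg0).
  have as2 : 2^-1 <= a ^+ 2 * sg ^+ 2.
    have : a ^+ 2 * t <= a ^+ 2 * sg ^+ 2 by rewrite ler_wpM2l// exprn_ge0// ltW.
    by move: a1; rewrite mulrDr; set X := _ * t; set Y := _ * sg ^+ 2; lra.
  have asg : (2 * sg)^-1 <= a.
    rewrite -ler_sqr ?nnegrE ?invr_ge0 ?mulr_ge0 ?(ltW sg0) ?(ltW ap)//.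
    rewrite exprVn -[leLHS]mul1r ler_pdivrMr ?exprn_gt0 ?mulr_gt0// exprMn.
    rewrite mulrCA; set Z := a ^+ 2 * _ in as2 *; have -> : (2 : R) ^+ 2 = 4 by ring.
    by lra.
  have fe : expR (- 2) <= f.
    have -> : expR (- 2) = flat 0 2^-1 :> R.
      by rewrite /flat invr_gt0 ltr0n expr0 mul1r invrK.
    apply: flat0_le.
    have u4 : u <= 2^-1.
      rewrite ler_pdivrMr// (le_trans tsg)//.
      have : (2 * sg) ^+ 2 <= rho ^+ 2 by rewrite lerXn2r ?nnegrE ?mulr_ge0 ?(ltW sg0) ?(ltW rho0).
      by rewrite exprMn; have := exprn_gt0 2 sg0; lra.
    have : u ^+ m <= u.
      by rewrite exprS ler_piMr// exprn_ile1// (le_trans u4)// invf_le1// ler1n.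
    lra.
  rewrite mulr1 [leLHS](_ : _ = 1 * expR (- 2) * (2 * sg)^-1 ^+ m * 2^-1); last first.
    by rewrite exprS exprVn exprMn; field; rewrite !expf_neq0// ?gt_eqF.
  have mm : 1 <= m%:R :> R by rewrite ler1n.
  apply: ler_pM => //.
  - by rewrite !mulr_ge0 ?expR_ge0// exprn_ge0// invr_ge0 mulr_ge0// ltW.
  - apply: ler_pM.
    + by rewrite mul1r expR_ge0.
    + by rewrite exprn_ge0// invr_ge0 mulr_ge0// ltW.
    + by apply: ler_pM => //; exact: expR_ge0.
    + by rewrite lerXn2r ?nnegrE ?invr_ge0 ?mulr_ge0 ?(ltW sg0) ?(ltW ap).
have M3 : 2 * s * (m%:R * u ^+ p / rho ^+ 2 * g * a ^+ m) <=
    4 * m%:R * rho ^- m * (t <= rho ^+ 2)%R%:R.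
  have h0 : 0 <= 2 * m%:R * u ^+ p * g * a ^+ m.
    by rewrite !mulr_ge0.
  have h1 : 2 * s * (m%:R * u ^+ p / rho ^+ 2 * g * a ^+ m) <=
      2 * m%:R * g * (u * a) ^+ m.
    rewrite [leLHS](_ : _ = (2 * m%:R * u ^+ p * g * a ^+ m) * (s / rho ^+ 2)); last by field; rewrite gt_eqF.
    rewrite [leRHS](_ : _ = (2 * m%:R * u ^+ p * g * a ^+ m) * u); last first.
      by rewrite exprMn [u ^+ m]exprS; ring.
    by rewrite ler_wpM2l// ler_wpM2r// invr_ge0 ltW.
  apply: (le_trans h1).
  have [tr|tr] := leP t (rho ^+ 2); last first.
    rewrite mulr0 /g flat_le0 ?mulr0 ?mul0r// subr_le0 exprn_ege1//.
    by rewrite ler_pdivlMr// mul1r ltW.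
  rewrite mulr1 -exprVn.
  have ua : u * a <= rho^-1.
    rewrite -ler_sqr ?nnegrE ?mulr_ge0 ?invr_ge0 ?(ltW ap) ?(ltW rho0) ?(ltW r2)//.
    have ta : a ^+ 2 * t <= 1.
      by rewrite -a1 ler_wpM2l ?lerDl ?exprn_ge0 ?(ltW ap) ?(ltW sg0).
    rewrite [leLHS](_ : _ = (a ^+ 2 * t) * (t / rho ^+ 4)); last by rewrite /u; field; rewrite gt_eqF.
    rewrite [leRHS](_ : _ = 1 * (rho ^+ 2 / rho ^+ 4)); last by field; rewrite gt_eqF.
    apply: ler_pM => //; first by rewrite mulr_ge0// exprn_ge0// ltW.
      by rewrite divr_ge0// exprn_ge0// ltW.
    by rewrite ler_wpM2r// invr_ge0 exprn_ge0// ltW.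
  have g2 : g <= 2 by exact: flat_le 2 _.
  rewrite [leRHS](_ : _ = 2 * m%:R * 2 * rho^-1 ^+ m); last by set X := _ ^+ m; ring.
  apply: ler_pM => //.
  - by rewrite !mulr_ge0.
  - by rewrite exprn_ge0// mulr_ge0// ltW.
  - by rewrite ler_wpM2l// mulr_ge0.
  - by rewrite lerXn2r ?nnegrE ?mulr_ge0 ?invr_ge0 ?(ltW ap) ?(ltW rho0) ?(ltW r2).
have -> : m%:R * (f * a ^+ m) + 2 * s * (- (m%:R / 2 * f * a ^+ m * a ^+ 2) -
    m%:R * u ^+ p / rho ^+ 2 * g * a ^+ m) =
    m%:R * f * a ^+ m * (1 - s * a ^+ 2) - 2 * s * (m%:R * u ^+ p / rho ^+ 2 * g * a ^+ m).
  by field; rewrite gt_eqF.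
by apply: lerB => //; exact: le_trans M1.
Qed.

End profile.

(** * The test field of the monotonicity formula *)

Section radial_field.
Context {R : realType} {n : nat}.
Variables (p : nat) (sg : R) (U : set 'rV[R]_n) (x y : 'rV[R]_n) (r D : R).
Variable phi : 'rV[R]_n -> R.
Local Notation m := p.+1.
Local Notation s := (fun j : nat => 2 ^+ j * sg).
Hypotheses (sg0 : 0 < sg) (D0 : 0 <= D).
Hypotheses (sphi : smooth phi) (phi01 : forall z, 0 <= phi z <= 1).
Hypothesis phi0 : forall z, ~ eball x r z -> phi z = 0.
Hypothesis dphi : forall z w, `|'D_w phi z| <= D * enorm w * \1_(eball x r) z.
Variables (i J : nat).
Hypothesis iJ : (i < J)%N.

Definition radial_weight (z : 'rV[R]_n) : R :=
  phi z * profile p (s i) (s J) (dot (z - y) (z - y)).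

(** The test field of the monotonicity formula centred at [y], localized by [phi]: it
    behaves like [phi z *: (z - y) / enorm (z - y) ^+ m] between the scales [s i] and
    [s J]. *)
Definition radial_field (z : 'rV[R]_n) : 'rV[R]_n := radial_weight z *: (z - y).

Let s_gt0 j : 0 < s j. Proof. by rewrite mulr_gt0 ?exprn_gt0. Qed.

Let s_le j k : (j <= k)%N -> s j <= s k.
Proof. by move=> jk; rewrite ler_pM2r// ler_eXn2l// ltr1n. Qed.

Let s2 : 2 * s i <= s J.
Proof. by rewrite mulrA -exprS; exact: s_le. Qed.

Lemma profile_sqdist_smooth :
  smooth (fun z => profile p (s i) (s J) (dot (z - y) (z - y))).
Proof.
move=> k; apply: Ck_mul.
  apply: Ck_flat.
  rewrite (_ : (fun z => _) = (fun z : 'rV[R]_n => 1 + (-1) *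
      (dot (z - y) (z - y) / s J ^+ 2) ^+ m)); last first.
    by apply/funext => z; rewrite mulN1r.
  apply: Ck_add; first exact: Ck_cst.
  apply: Ck_mul; first exact: Ck_cst.
  apply: Ck_exp; apply: Ck_mul; [exact: Ck_sqdist|exact: Ck_cst].
have pos (z : 'rV[R]_n) : 0 < dot (z - y) (z - y) + s i ^+ 2.
  by rewrite ltr_wpDl ?dot_ge0// exprn_gt0.
apply: Ck_exp; apply: Ck_inv => [z|]; first by rewrite gt_eqF// sqrtr_gt0.
apply: Ck_sqrt => //; apply: Ck_add; [exact: Ck_sqdist|exact: Ck_cst].
Qed.

Lemma radial_weight_smooth : smooth radial_weight.
Proof.
by move=> k; apply: Ck_mul; [exact: sphi|exact: profile_sqdist_smooth].
Qed.

Lemma radial_field_test : eball x r `<=` U -> test_fun U radial_field.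
Proof.
move=> BU.
have sp : fun_spt radial_field `<=` eball x r.
  rewrite [X in _ `<=` X](closure_id _).1; last exact: eball_closed.
  apply: closure_subset => z /=; apply: contraPP => /phi0 pz.
  by rewrite /radial_field /radial_weight pz mul0r scale0r eqxx.
split; [|apply: (subclosed_compact _ (eball_compact x r)) => //|].
- by move=> k; apply: Ck_scalev; [exact: radial_weight_smooth|exact: Ck_subr].
- exact: closed_closure.
- exact: subset_trans BU.
Qed.

Lemma profile_dist_le (d : R) : 0 <= d ->
  profile p (s i) (s J) (d ^+ 2) * d <=
  2 ^+ p * \sum_(i <= j < J.+1) s j ^- p * (d <= s j)%R%:R.
Proof.
move=> d0.
have S0 : 0 <= \sum_(i <= j < J.+1) s j ^- p * (d <= s j)%R%:R.
  by apply: sumr_ge0 => j _; rewrite mulr_ge0// invr_ge0 exprn_ge0// ltW.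
have [Jd|dJ] := leP (s J) d.
  rewrite profile_eq0 ?s_gt0// ?mul0r ?mulr_ge0 ?exprn_ge0//.
  by rewrite lerXn2r ?nnegrE// ltW.
pose P j := (i <= j)%N && (d <= s j).
have exP : exists j, P j by exists J; rewrite /P ltnW// ltW.
case: (ex_minnP exP) => j /andP[ij dj] jmin.
have jJ : (j < J.+1)%N by rewrite ltnS jmin// /P ltnW// ltW.
set a := (Num.sqrt (d ^+ 2 + s i ^+ 2))^-1.
have den0 : 0 < d ^+ 2 + s i ^+ 2 by rewrite ltr_wpDl ?sqr_ge0// exprn_gt0.
have sq0 : 0 < Num.sqrt (d ^+ 2 + s i ^+ 2) by rewrite sqrtr_gt0.
have le1 (b : R) : 0 <= b -> b ^+ 2 <= d ^+ 2 + s i ^+ 2 ->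
    b <= Num.sqrt (d ^+ 2 + s i ^+ 2).
  move=> b0 h; rewrite -ler_sqr ?nnegrE ?sqrtr_ge0//.
  by rewrite [leRHS]sqr_sqrtr// ltW.
have ad : a * d <= 1.
  by rewrite mulrC ler_pdivrMr// mul1r le1// lerDl sqr_ge0.
have as' : a <= (s j / 2)^-1.
  rewrite lef_pV2 ?posrE ?divr_gt0 ?s_gt0//; apply: le1; first by rewrite divr_ge0// ltW.
  move: ij; rewrite leq_eqVlt => /predU1P[<-|ij].
    apply: (@le_trans _ _ (s i ^+ 2)); last by rewrite lerDr sqr_ge0.
    rewrite lerXn2r ?nnegrE ?divr_ge0 ?(ltW (s_gt0 _))//.
    by rewrite ler_pdivrMr// ler_peMr ?(ltW (s_gt0 _))// ler1n.
  case: j ij => // j ij in dj jmin jJ *.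
  have dj' : s j < d.
    rewrite ltNge; apply/negP => dj'; have := jmin j.
    by rewrite /P -ltnS ij dj' ltnn => /(_ isT).
  apply: (@le_trans _ _ (d ^+ 2)); last by rewrite lerDl sqr_ge0.
  have -> : s j.+1 / 2 = s j by rewrite /= exprS; set X := 2 ^+ j; field.
  by rewrite lerXn2r ?nnegrE ?(ltW (s_gt0 _))// ltW.
have a_ge0 : 0 <= a by rewrite invr_ge0 sqrtr_ge0.
apply: (@le_trans _ _ (2 ^+ p * s j ^- p)).
  have -> : 2 ^+ p * s j ^- p = (s j / 2)^-1 ^+ p.
    by rewrite -exprVn invf_div exprMn exprVn.
  rewrite /profile -/a exprS.
  rewrite -mulrA -[leRHS]mul1r ler_pM ?flat_ge0 ?mulr_ge0 ?exprn_ge0//.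
    exact: flat_le 0 _.
  rewrite [leLHS](_ : _ = (a * d) * a ^+ p); last by rewrite exprS; set X := a ^+ p; ring.
  rewrite -[leRHS]mul1r ler_pM ?mulr_ge0 ?exprn_ge0//.
  by rewrite lerXn2r ?nnegrE ?invr_ge0 ?divr_ge0 ?(ltW (s_gt0 _)).
rewrite ler_pM2l ?exprn_gt0//.
rewrite (big_cat_nat _ (n := j))//= ?(ltnW jJ)//.
rewrite [X in _ + X]big_ltn// dj mulr1 addrCA lerDl addr_ge0// sumr_ge0// => k _;
  by rewrite mulr_ge0// invr_ge0 exprn_ge0// ltW.
Qed.

Local Notation layers z :=
  (\sum_(i <= j < J.+1) s j ^- p * (\1_(eball y (s j)) z * \1_(eball x r) z)).

Let indic_eball (a : 'rV[R]_n) b z : \1_(eball a b) z = (enorm (z - a) <= b)%R%:R :> R.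
Proof.
rewrite indicE; congr (_%:R); congr nat_of_bool.
by apply/idP/idP; rewrite inE.
Qed.

Let layersE z : layers z =
  (\sum_(i <= j < J.+1) s j ^- p * (enorm (z - y) <= s j)%R%:R) * \1_(eball x r) z.
Proof.
by rewrite mulr_suml; apply: eq_bigr => j _; rewrite -indic_eball mulrA.
Qed.

(** Dyadic decomposition: at distance about [s j] from the centre the length of the field
    is at most of order [s j ^- p]. *)
Lemma radial_field_norm z : enorm (radial_field z) <= 2 ^+ p * layers z.
Proof.
have p0 : 0 <= profile p (s i) (s J) (dot (z - y) (z - y)).
  by apply: profile_ge0; rewrite ?s_gt0 ?dot_ge0.
have /andP[f0 f1] := phi01 z.
rewrite /radial_field /radial_weight enormZ ger0_norm; last exact: mulr_ge0.
rewrite layersE mulrA -[leLHS]mulrA -sqr_enorm [leLHS]mulrC.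
apply: ler_pM; [by rewrite mulr_ge0 ?enorm_ge0// sqr_enorm|by []| |].
  exact/profile_dist_le/enorm_ge0.
rewrite indicE; have [zB|/negP zB] := boolP (z \in _); first exact: f1.
by rewrite phi0// => /mem_set.
Qed.

(** The radial part of the field contributes mass ratios at the two extreme scales,
    with opposite signs; the derivative of [phi] contributes the layers in between. *)
Lemma radial_field_div P z : @Grass R n m P ->
  expR (- 2) / 2 ^+ m.+1 * s i ^- m * (phi z * \1_(eball y (s i)) z)
  - 4 * m%:R * s J ^- m * (phi z * \1_(eball y (s J)) z)
  - D * 2 ^+ p * layers z <= mxdot P (jacobian radial_field z).
Proof.
move=> GP.
have dw : differentiable radial_weight z.
  by apply: smooth_differentiable; exact: radial_weight_smooth.
rewrite (mxdot_radial y GP dw).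
set w := (z - y) *m P; set q := dot (z - y) (z - y).
have q0 : 0 <= q by exact: dot_ge0.
have dq : differentiable (fun z => dot (z - y) (z - y)) z.
  exact: differentiable_sqdist.
have dp := is_derive_profile p (s_gt0 i) (s_gt0 J) q0.
have -> : 'D_w radial_weight z = phi z * (2 * dot w (z - y) * dprofile p (s i) (s J) q)
    + profile p (s i) (s J) q * 'D_w phi z.
  rewrite deriveM; last 2 first.
  - by apply: diff_derivable; exact: smooth_differentiable.
  - by apply: diff_derivable; apply: smooth_differentiable; exact: profile_sqdist_smooth.
  congr (_ + _); rewrite /GRing.scale /=; congr (_ * _).
  by rewrite -derive_sqdist (derive_comp_real w dq dp).
have /andP[w0 w1] := Grass_dot (z - y) GP.
have /andP[f0 f1] := phi01 z.
have pi := profile_ineq p (s_gt0 i) (s_gt0 J) s2 (introT andP (conj w0 w1)).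
have ball_sq j : (q <= s j ^+ 2)%R%:R = \1_(eball y (s j)) z :> R.
  rewrite indic_eball; congr (_%:R); congr nat_of_bool.
  by rewrite /q -sqr_enorm ler_sqr ?nnegrE ?enorm_ge0// ltW.
rewrite !ball_sq in pi.
have p0 : 0 <= profile p (s i) (s J) q by exact: profile_ge0.
have E : - (D * 2 ^+ p * layers z) <= profile p (s i) (s J) q * 'D_w phi z.
  rewrite lerNl -mulrN.
  apply: (@le_trans _ _ (profile p (s i) (s J) q * (D * enorm (z - y) * \1_(eball x r) z))).
    apply: ler_wpM2l => //.
    apply: (le_trans (ler_norm _)); rewrite normrN.
    apply: (le_trans (dphi z w)); apply: ler_wpM2r; first by rewrite indicE.
    by apply: ler_wpM2l => //; exact: Grass_enorm_le GP.
  rewrite layersE; set I := \1__ z; set S := \sum_(_ <= _ < _) _.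
  rewrite [leLHS](_ : _ = D * (profile p (s i) (s J) q * enorm (z - y)) * I); last by ring.
  rewrite [leRHS](_ : _ = D * (2 ^+ p * S) * I); last by set X := 2 ^+ p; ring.
  rewrite ler_wpM2r ?/I ?indicE// ler_wpM2l//.
  by rewrite /q -sqr_enorm profile_dist_le ?enorm_ge0.
have F := ler_wpM2l f0 pi.
rewrite /radial_weight -/q; move: E F; set L := layers z.
by move: (\1__ _ : R) (\1__ _ : R) => a b; lra.
Qed.

End radial_field.

(** * Outer measures and integration *)

Section caratheodory_facts.
Context {R : realType}.
Local Open Scope ereal_scope.

Lemma null_caratheodory (T : Type) (mu : {outer_measure set T -> \bar R}) A :
  mu A = 0 -> mu.-caratheodory A.
Proof.
move=> A0; apply: le_caratheodory_measurable => X.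
have -> : mu (X `&` A) = 0.
  apply/eqP; rewrite eq_le outer_measure_ge0 andbT -A0.
  by apply/le_outer_measure => x [].
by rewrite add0e; apply/le_outer_measure => x [].
Qed.

Lemma orestr_caratheodory (T : Type) (mu : {outer_measure set T -> \bar R}) A B :
  mu.-caratheodory B -> (orestr mu A).-caratheodory B.
Proof. by move=> cB X; rewrite /orestr !setIA; exact: cB. Qed.

Lemma outer_measure_null_sub (T : Type) (mu : {outer_measure set T -> \bar R}) A B :
  A `<=` B -> mu B = 0 -> mu A = 0.
Proof.
move=> AB B0; apply/eqP; rewrite eq_le outer_measure_ge0 andbT -B0.
exact: le_outer_measure.
Qed.

Lemma outer_measureU0 (T : Type) (mu : {outer_measure set T -> \bar R}) A B :
  mu B = 0 -> mu (A `|` B) = mu A.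
Proof.
move=> B0; apply/eqP; rewrite eq_le; apply/andP; split.
  by rewrite (le_trans (outer_measureU2 _ _ _))// B0 adde0.
by apply/le_outer_measure => x; left.
Qed.

Lemma outer_measureI_null (T : Type) (mu : {outer_measure set T -> \bar R}) X A :
  mu (~` X) = 0 -> mu (A `&` X) = mu A.
Proof.
move=> X0; apply/eqP; rewrite eq_le; apply/andP; split.
  by apply: le_outer_measure => x [].
rewrite -[leRHS](outer_measureU0 _ X0).
by apply: le_outer_measure => x Ax; have [Xx|nXx] := pselect (X x); [left|right].
Qed.

(** [oint] is integration with respect to this measure. *)
Definition cara_measure (T : pointedType) (mu : {outer_measure set T -> \bar R}) :
  {measure set (caratheodory_type mu) -> \bar R} := mu.

Definition cmeas (T : pointedType) (mu : {outer_measure set T -> \bar R}) (f : T -> R) : Prop :=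
  @measurable_fun _ _ (caratheodory_type mu) R setT f.

Lemma caratheodory_fun (T : pointedType) (mu : {outer_measure set T -> \bar R})
    (f : T -> R) :
  (forall O, open O -> mu.-caratheodory (f @^-1` O)) ->
  cmeas mu f.
Proof.
move=> H; apply: (measurability _ (RGenOpens.measurableE R)).
move=> _ [_ [a [b ->]] <-]; rewrite setTI; apply: H; exact: interval_open.
Qed.



End caratheodory_facts.

Section integral_restriction.
Context {R : realType} {T : pointedType}.
Variable mu : {outer_measure set T -> \bar R}.
Local Open Scope ereal_scope.

Lemma ge0_integral_orestr A (f : T -> R) : mu.-caratheodory A ->
  (forall x, 0 <= f x)%R -> cmeas mu f ->
  \int[cara_measure (orestr mu A)]_x (f x)%:E = \int[cara_measure mu]_(x in A) (f x)%:E.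
Proof.
move=> cA f0 mf.
pose T1 := caratheodory_type (orestr mu A); pose T2 := caratheodory_type mu.
have mi : measurable_fun (setT : set T1) (id : T1 -> T2).
  by move=> _ B mB; rewrite setTI; exact: orestr_caratheodory.
pose nu0 : {measure set T2 -> \bar R} :=
  pushforward (cara_measure (orestr mu A)) (id : T1 -> T2).
pose nu := nu0 mi.
have mA : measurable (A : set T2) by [].
have mf' : measurable_fun setT (EFin \o (f : T2 -> R)) by exact/measurable_EFinP.
have nA : nu (~` A) = 0 by rewrite /nu /nu0 /= /pushforward /orestr setICr outer_measure0.
transitivity (\int[nu]_x (f x)%:E).
  by rewrite /nu /nu0 ge0_integral_pushforward//= => y _; rewrite lee_fin.
rewrite (ge0_negligible_integral (measurableC mA))// ?setTD ?setCK; last first.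
  by move=> x _; rewrite lee_fin.
apply: (eq_measure_integral (cara_measure mu)) => B mB BA.
by rewrite /nu /nu0 /= /pushforward /= /orestr setIidr.
Qed.

(** The sigma-algebra of a restricted outer measure is larger, but the integral
    of a function measurable for the original one does not see it. *)
Lemma integral_orestr A (f : T -> R) : mu.-caratheodory A -> cmeas mu f ->
  \int[cara_measure (orestr mu A)]_x (f x)%:E = \int[cara_measure mu]_(x in A) (f x)%:E.
Proof.
move=> cA mf; rewrite integralE [RHS]integralE.
have P := ge0_integral_orestr cA (funrpos_ge0 f) (measurable_funrpos mf).
have N := ge0_integral_orestr cA (funrneg_ge0 f) (measurable_funrneg mf).
rewrite -[fun x => (f x)%:E]/(EFin \o f) funerpos funerneg.
by congr (_ - _); [exact: P|exact: N].
Qed.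

End integral_restriction.

(** * Radon measures *)

Section radon_facts.
Context {R : realType} {T : normedModType R}.
Variables (X : set T) (mu : {outer_measure set T -> \bar R}).
Hypothesis rmu : radon X mu.
Local Open Scope ereal_scope.

Lemma radon_null : mu (~` X) = 0. Proof. by case: rmu. Qed.

Lemma radonI A : mu (X `&` A) = mu A.
Proof. by rewrite setIC outer_measureI_null// radon_null. Qed.

Lemma radon_compact K : compact K -> K `<=` X -> mu K < +oo.
Proof. by case: rmu => _ + _ _; apply. Qed.

Lemma radon_open O : open O -> mu.-caratheodory O.
Proof.
move=> oO; have [_ _ H _] := rmu.
have -> : O = (X `&` O) `|` (O `&` ~` X).
  by apply/seteqP; split=> [x Ox|x [[]|[]]//]; have [|] := pselect (X x); [left|right].
apply: caratheodory_measurable_setU; first by apply: (H _ _).1; exists O.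
by apply/null_caratheodory/(outer_measure_null_sub _ radon_null) => x [].
Qed.

Lemma radon_closed C : closed C -> mu.-caratheodory C.
Proof.
by move=> cC; rewrite -(setCK C); apply: caratheodory_measurable_setC; apply: radon_open; exact: closed_openC.
Qed.

Lemma compact_cara K : compact K -> mu.-caratheodory K.
Proof. by move=> /(compact_closed (@norm_hausdorff _ _))/radon_closed. Qed.

Lemma radon_cmeas (f : T -> R) : continuous f -> cmeas mu f.
Proof. by move=> /continuousP cf; apply: caratheodory_fun => O oO; exact/radon_open/cf. Qed.

Lemma radon_outer A (e : R) : (0 < e)%R -> mu A < +oo ->
  exists O, [/\ open O, A `&` X `<=` O & mu O <= mu A + e%:E].
Proof.
move=> e0 Aoo; have [_ _ _ /(_ (A `&` X) (@subIsetr _ _ _)) E] := rmu.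
have AX : mu (A `&` X) = mu A by rewrite setIC radonI.
have fA : mu (A `&` X) \is a fin_num by rewrite AX ge0_fin_numE.
have := @lb_ereal_inf_adherent R [set mu G | G in [set G | relopen X G /\ A `&` X `<=` G]] e e0.
rewrite -E => /(_ fA) [y0 [G [[ O oO ->] AG] <-] h].
exists O; split => //; first by move=> x /AG[].
by rewrite -radonI -AX ltW.
Qed.

Lemma radon_inner G (e : R) : (0 < e)%R -> open G -> mu G < +oo ->
  exists K, [/\ compact K, K `<=` X `&` G & mu G <= mu K + e%:E].
Proof.
move=> e0 oG Goo; have [_ _ H _] := rmu.
have [_ E] := H (X `&` G) (ex_intro2 _ _ G oG erefl).
have fG : mu (X `&` G) \is a fin_num by rewrite radonI ge0_fin_numE.
have := @ub_ereal_sup_adherent R [set mu K | K in [set K | compact K /\ K `<=` X `&` G]] e e0.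
rewrite -E => /(_ fG) [y0 [K [cK KG] <-] h].
exists K; split => //; rewrite -radonI -leeBlDr//; exact: ltW.
Qed.

(** By inner regularity it suffices to treat compact sets, and these are covered by
    finitely many null neighbourhoods. *)
Lemma radon_locally_null G : open G ->
  (forall x, X x -> G x -> exists2 O, nbhs x O & mu O = 0) -> mu G = 0.
Proof.
move=> oG H; have [_ _ Hr _] := rmu.
have [_ E] := Hr (X `&` G) (ex_intro2 _ _ G oG erefl).
apply/eqP; rewrite eq_le outer_measure_ge0 andbT -radonI E.
apply: ge_ereal_sup => _ [K [cK KG] <-].
rewrite le_eqVlt; apply/orP; left; apply/eqP.
apply: (@compact_ind _ K (fun K => mu K = 0) cK).
- exact: outer_measure0.
- by move=> A B; exact: outer_measure_null_sub.
- by move=> A B A0 B0; rewrite outer_measureU0.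
- by move=> x /KG[Xx Gx]; exact: H.
Qed.

Lemma sptP x : spt X mu x <-> X x /\ forall O, nbhs x O -> mu O <> 0.
Proof.
split=> [[Xx nG]|[Xx H]].
  split => // O; rewrite nbhsE => -[ O' [oO' O'x] OO'] O0; apply: nG.
  exists (X `&` O') => //; split; first by exists O'.
  by rewrite radonI; exact: outer_measure_null_sub O0.
split => // -[_ [[ O oO ->] O0] [_ Ox]].
by apply: (H O); [exact: open_nbhs_nbhs|rewrite -radonI].
Qed.

Lemma spt_sub : spt X mu `<=` X. Proof. by move=> x []. Qed.

Lemma spt_complement_null : mu (~` spt X mu) = 0.
Proof.
have [_ _ H _] := rmu.
pose F := [set G | relopen X G /\ mu G = 0].
have : exists2 O, open O & \bigcup_(G in F) G = X `&` O.
  exists (\bigcup_(O in [set O | open O /\ mu O = 0]) O).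
    by apply: bigcup_open => O [].
  apply/seteqP; split=> x.
    move=> [_ [[ O oO ->] O0] [Xx Ox]]; split => //; exists O => //.
    by split => //; rewrite -radonI.
  move=> [Xx [ O [oO O0] Ox]]; exists (X `&` O) => //; split; first by exists O.
  by rewrite radonI.
move=> [ O oO E].
have O0 : mu O = 0.
  apply: radon_locally_null => // x Xx Ox.
  have : (X `&` O) x by [].
  rewrite -E => -[_ [[ O' oO' ->] O'0] [_ O'x]].
  by exists O'; [exact: open_nbhs_nbhs|rewrite -radonI].
apply: (@outer_measure_null_sub _ _ _ _ (~` X `|` O)).
  move=> x; rewrite /spt => nx; have [Xx|] := pselect (X x); last by left.
  right; apply: contrapT => nOx; apply: nx; split => //.
  by rewrite -/F E => -[].
by rewrite outer_measureU0// radon_null.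
Qed.

End radon_facts.

Section bounded_finite.
Context {R : realType} {T : pointedType}.
Variable mu : {outer_measure set T -> \bar R}.
Local Open Scope ereal_scope.
Implicit Types f g : T -> R.

(** Essentially bounded functions, essentially supported in a set of finite
    measure. *)
Definition bfin f := cmeas mu f /\
  exists Q M, [/\ mu.-caratheodory Q, mu Q < +oo, (0 <= M)%R &
    mu [set x | ~ (`|f x| <= M * \1_Q x)%R] = 0].

Lemma bfinI X f Q M : cmeas mu f -> mu (~` X) = 0 -> mu.-caratheodory Q ->
  mu Q < +oo -> (0 <= M)%R -> (forall x, X x -> (`|f x| <= M * \1_Q x)%R) -> bfin f.
Proof.
move=> mf X0 cQ Qoo M0 H; split => //; exists Q, M; split => //.
by apply: (outer_measure_null_sub _ X0) => x /= nx Xx; apply/nx/H.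
Qed.

Lemma bfin_integrable D f : mu.-caratheodory D -> bfin f ->
  (cara_measure mu).-integrable D (EFin \o f).
Proof.
move=> cD [mf [Q [M [cQ Qoo M0 N0]]]].
have mD : measurable (D : set (caratheodory_type mu)) by [].
have mQ : measurable (Q : set (caratheodory_type mu)) by [].
have mf' : measurable_fun (D : set (caratheodory_type mu)) f by exact: measurable_funTS.
have mI : measurable_fun (D : set (caratheodory_type mu)) (fun x => M * \1_Q x)%R.
  apply: measurable_funM; first exact: measurable_cst.
  exact: (@measurable_indic _ (caratheodory_type mu) R D Q).
apply/integrableP; split; first exact/measurable_EFinP.
apply: (@le_lt_trans _ _ (\int[cara_measure mu]_(x in D) (M * \1_Q x)%:E)).
  apply: ae_ge0_le_integral => //.
  - by apply/measurable_EFinP/measurableT_comp.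
  - by move=> x _; rewrite lee_fin mulr_ge0// indicE.
  - exact/measurable_EFinP.
  exists [set x | ~ (`|f x| <= M * \1_Q x)%R]; split => //.
    exact: null_caratheodory.
  by move=> x /= nx h; apply: nx => _; rewrite lee_fin.
under eq_integral do rewrite EFinM.
rewrite ge0_integralZl//; last first.
  apply/measurable_EFinP; exact: (@measurable_indic _ (caratheodory_type mu) R D Q).
rewrite integral_indic// lte_mul_pinfty//.
by apply: le_lt_trans Qoo; apply: le_outer_measure => x [].
Qed.

Lemma bfinD f g : bfin f -> bfin g -> bfin (fun x => f x + g x)%R.
Proof.
move=> [mf [Q [M [cQ Qoo M0 N0]]]] [mg [Q' [M' [cQ' Q'oo M'0 N'0]]]].
split; first exact: measurable_funD.
exists (Q `|` Q'), (M + M')%R; split.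
- exact: caratheodory_measurable_setU.
- by rewrite (le_lt_trans (outer_measureU2 _ _ _))// lte_add_pinfty.
- exact: addr_ge0.
apply: (@outer_measure_null_sub _ _ _ _ ([set x | ~ (`|f x| <= M * \1_Q x)%R] `|`
   [set x | ~ (`|g x| <= M' * \1_Q' x)%R])); last by rewrite outer_measureU0.
move=> x /= nx; apply: contrapT => /not_orP[/contrapT h /contrapT h']; apply: nx.
rewrite (le_trans (ler_normD _ _))// mulrDl lerD//.
  apply: (le_trans h); apply: ler_wpM2l => //; rewrite !indicE ler_nat.
  by case: (boolP (x \in Q)) => // xQ; rewrite in_setU xQ.
apply: (le_trans h'); apply: ler_wpM2l => //; rewrite !indicE ler_nat.
by case: (boolP (x \in Q')) => // xQ; rewrite in_setU xQ orbT.
Qed.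

Lemma bfinM f g (N : R) : cmeas mu g -> (0 <= N)%R -> (forall x, `|g x| <= N)%R ->
  bfin f -> bfin (fun x => g x * f x)%R.
Proof.
move=> mg N0 gN [mf [Q [M [cQ Qoo M0 Z]]]].
split; first exact: measurable_funM.
exists Q, (N * M)%R; split => //; first exact: mulr_ge0.
apply: outer_measure_null_sub Z => x /= nx h; apply: nx.
by rewrite normrM -mulrA ler_pM.
Qed.

Lemma bfinZ f (c : R) : bfin f -> bfin (fun x => c * f x)%R.
Proof. by apply: (@bfinM f (cst c) `|c|) => //; exact: measurable_cst. Qed.

Lemma bfin_indicM f A : mu.-caratheodory A -> bfin f -> bfin (fun x => \1_A x * f x)%R.
Proof.
move=> cA; apply: (@bfinM f (\1_A) 1) => //; last first.
  by move=> x; rewrite indicE; case: (x \in A); rewrite ?normr1 ?normr0.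
have mA : measurable (A : set (caratheodory_type mu)) by [].
exact: (@measurable_indic _ (caratheodory_type mu) R setT A).
Qed.

Lemma bfin_sum I (s : seq I) (F : I -> T -> R) : (forall i, bfin (F i)) ->
  bfin (fun x => \sum_(i <- s) F i x)%R.
Proof.
move=> H; elim: s => [|i s IH].
  have -> : (fun x => \sum_(i <- [::]) F i x)%R = (fun _ : T => 0%R).
    by apply/funext => x; rewrite big_nil.
  split; first exact: (@measurable_cst _ _ (caratheodory_type mu) _ setT).
  exists set0, 0%R; split => //.
  - exact: caratheodory_measurable_set0.
  - by rewrite outer_measure0.
  - rewrite (_ : [set _ | _] = set0) ?outer_measure0//.
    by apply/seteqP; split => // x /=; rewrite normr0 mul0r lexx.
have -> : (fun x => \sum_(j <- i :: s) F j x)%R = (fun x => F i x + \sum_(j <- s) F j x)%R.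
  by apply/funext => x; rewrite big_cons.
exact: bfinD.
Qed.

End bounded_finite.

(** * The weight of a varifold *)

Section exhaustion.
Context {R : realType} {n : nat}.

Lemma compact_exhaustion (U : set 'rV[R]_n) : open U ->
  exists K : nat -> set 'rV[R]_n, (forall k, compact (K k) /\ K k `<=` U) /\
    U `<=` \bigcup_k K k.
Proof.
move=> oU; pose B k := \bigcup_(y in ~` U) oball y (k.+1%:R^-1 : R).
exists (fun k => eball 0 k%:R `&` ~` B k); split.
  move=> k; split; last first.
    move=> x [_ nB]; apply: contrapT => nUx; apply: nB; exists x => //.
    by rewrite /oball /= subrr enorm0 invr_gt0.
  apply: compact_closedI; first exact: eball_compact.
  by apply: open_closedC; apply: bigcup_open => y _; exact: oball_open.
move=> x Ux.
have [r r0 rU] : exists2 r, 0 < r & eball x r `<=` U.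
  by apply: nbhs_eball; exact: open_nbhs_nbhs.
have [k kr] : exists k : nat, Num.max r^-1 (enorm x) <= k%:R.
  exists (Num.trunc (Num.max r^-1 (enorm x))).+1.
  exact/ltW/truncnS_gt.
move: kr; rewrite ge_max => /andP[kr kx].
exists k => //; split; first by rewrite /eball /= subr0.
move=> [y nUy /=]; rewrite /oball /= => xy; apply: nUy; apply: rU.
rewrite /eball /= enormB (le_trans (ltW xy))//.
rewrite -[leRHS]invrK lef_pV2 ?posrE ?invr_gt0//.
by rewrite (le_trans kr)// ler_nat.
Qed.

End exhaustion.

Section caratheodory_cover.
Context {R : realType} {T : pointedType}.
Local Open Scope ereal_scope.

Lemma caratheodory_cover (mu : {outer_measure set T -> \bar R}) X (K : nat -> set T) A :
  mu (~` X) = 0 -> X `<=` \bigcup_k K k ->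
  (forall k, mu.-caratheodory (A `&` K k)) -> mu.-caratheodory A.
Proof.
move=> X0 XK H.
have -> : A = \bigcup_k (A `&` K k) `|` (A `&` ~` X `\` \bigcup_k (A `&` K k)).
  apply/seteqP; split=> x.
    move=> Ax; have [|nx] := pselect ((\bigcup_k (A `&` K k)) x); [by left|right].
    split => //; split => // Xx; apply: nx; have [k _ Kx] := XK _ Xx.
    by exists k.
  by move=> [[k _ []]|[[]]].
apply: caratheodory_measurable_setU; first exact: caratheodory_measurable_bigcup.
by apply/null_caratheodory/(outer_measure_null_sub _ X0) => x [[]].
Qed.

(** Where both measures are finite, the splitting inequalities of [mu] and of [nu] point
    the same way, so that equality for the sum forces equality for each. *)
Lemma caratheodory_addl (mu nu : {outer_measure set T -> \bar R}) X (K : nat -> set T) A :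
  mu (~` X) = 0 -> X `<=` \bigcup_k K k ->
  (forall k, mu.-caratheodory (K k)) ->
  (forall k, mu (K k) < +oo) -> (forall k, nu (K k) < +oo) ->
  (fun B => mu B + nu B).-caratheodory A -> mu.-caratheodory A.
Proof.
move=> X0 XK cK muK nuK cA; apply: (caratheodory_cover X0 XK) => k.
apply: le_caratheodory_measurable => Y.
rewrite (cK k Y).
have fin (m : {outer_measure set T -> \bar R}) Z : m (K k) < +oo -> Z `<=` K k ->
    m Z \is a fin_num.
  move=> mK ZK; rewrite ge0_fin_numE//.
  by apply: le_lt_trans mK; exact: le_outer_measure.
pose Z := Y `&` K k.
have ZK W : Z `&` W `<=` K k by move=> x [[]].
have split_mu : mu (Z `&` A) + mu (Z `&` ~` A) <= mu Z.
  have := cA Z; rewrite /=.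
  have := outer_measureU2 nu (Z `&` A) (Z `&` ~` A).
  rewrite -setIUr setUv setIT.
  have f1 := fin nu _ (nuK k) (ZK A); have f2 := fin nu _ (nuK k) (ZK (~` A)).
  have f3 := fin mu _ (muK k) (ZK A); have f4 := fin mu _ (muK k) (ZK (~` A)).
  have f5 : nu Z \is a fin_num by apply: (fin nu _ (nuK k)) => x [].
  have f6 : mu Z \is a fin_num by apply: (fin mu _ (muK k)) => x [].
  move: f1 f2 f3 f4 f5 f6.
  move: (nu (Z `&` A)) (nu (Z `&` ~` A)) (mu (Z `&` A)) (mu (Z `&` ~` A)) (nu Z) (mu Z).
  move=> [a||] [b||] [c||] [d||] [e||] [f||]//= _ _ _ _ _ _.
  by rewrite -!EFinD !lee_fin => h [] h'; lra.
have -> : Y `&` (A `&` K k) = Z `&` A by rewrite /Z setIAC setIA.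
rewrite -/Z.
apply: (@le_trans _ _ (mu (Z `&` A) + (mu (Z `&` ~` A) + mu (Y `&` ~` K k)))).
  rewrite leeD2l//.
  apply: le_trans (outer_measureU2 _ _ _); apply: le_outer_measure => x [Yx nx].
  have [Kx|nKx] := pselect (K k x); [left|by right].
  by split => // Ax; apply: nx.
by rewrite addeA leeD2r.
Qed.

End caratheodory_cover.

Section weight_measure.
Context {R : realType} {n : nat} (m : nat).
Variable U : set 'rV[R]_n.
Variable V : {outer_measure set ('rV[R]_n * 'M[R]_n)%type -> \bar R}.
Local Notation G := (@Grass R n m).
Hypotheses (oU : open U) (vV : varifold U m V).
Local Open Scope ereal_scope.

Lemma varifold_null : V (~` (U `*` G)) = 0. Proof. by case: vV. Qed.

Lemma weight_cyl A : weight m V A = V (fst @^-1` A).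
Proof.
rewrite /weight /= /ocyl -[RHS](outer_measureI_null _ varifold_null).
apply/eqP; rewrite eq_le; apply/andP; split; last first.
  by apply: le_outer_measure => -[x P] [/= Ax [_ GP]].
rewrite -[leLHS](outer_measureI_null _ varifold_null).
by apply: le_outer_measure => -[x P] [[/= Ax _]].
Qed.

Lemma weight_cara A : V.-caratheodory (fst @^-1` A) -> (weight m V).-caratheodory A.
Proof. by move=> cA Y; rewrite !weight_cyl [LHS]cA. Qed.

Lemma open_cyl (O : set 'rV[R]_n) : open O -> open (fst @^-1` O : set ('rV[R]_n * 'M[R]_n)).
Proof. by move=> oO; apply: open_comp => // z _; exact: cvg_fst. Qed.

(** Compactness of the Grassmannian enters twice: cylinders over compact sets are
    compact, and, by the tube lemma, open neighbourhoods of cylinders contain open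
    cylinders. *)
Lemma radon_weight : radon U (weight m V).
Proof.
have [V0 Vc Vo Vout] := vV; split.
- by rewrite weight_cyl; apply: (outer_measure_null_sub _ V0) => -[x P] /= nU [/nU].
- move=> K cK KU; apply: Vc; first exact: (compact_setX cK (@Grass_compact _ _ m)).
  by move=> [x P] [/= /KU].
- move=> _ [ O oO ->]; have oUO : open (U `&` O) by exact: openI.
  split; first by apply/weight_cara/(radon_open vV)/open_cyl.
  apply/eqP; rewrite eq_le; apply/andP; split; last first.
    by apply: ge_ereal_sup => _ [K [cK KO] <-]; exact: le_outer_measure.
  have rel : relopen (U `*` G) ((U `&` O) `*` G).
    exists (fst @^-1` O); first exact: open_cyl.
    by apply/seteqP; split=> -[x P] /= => [[[]]|[[]]].
  rewrite [leLHS](Vo _ rel).2; apply: ge_ereal_sup => _ [K' [cK' K'O] <-].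
  apply: (@le_trans _ _ (weight m V (fst @` K'))).
    by apply: le_outer_measure => -[x P] K'x; split => /=; [exists (x, P)|exact: (K'O _ K'x).2].
  apply: ereal_sup_ubound; exists (fst @` K') => //; split.
    apply: continuous_compact => //; apply: continuous_subspaceT => z; exact: cvg_fst.
  by move=> _ [[x P] /K'O[/= UOx _] <-].
- move=> A AU; apply/eqP; rewrite eq_le; apply/andP; split.
    by apply: le_ereal_inf_tmp => _ [ O [_ AO] <-]; exact: le_outer_measure.
  have AGU : A `*` G `<=` U `*` G by move=> [x P] [/= /AU].
  rewrite [leRHS](Vout _ AGU); apply: le_ereal_inf_tmp => _ [W [[W0 oW0 ->] AW] <-].
  pose A' := [set x | forall P, G P -> W0 (x, P)].
  have oA' : open A'.
    rewrite openE => x A'x; rewrite /interior.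
    have cG : near_covering G by exact/compact_near_coveringP/Grass_compact.
    have := cG _ (nbhs x) (fun x P => W0 (x, P)) _.
    apply => P GP.
    have : nbhs (x, P) W0 by apply: open_nbhs_nbhs; split => //; exact: A'x.
    move=> [[B1 B2] [/= B1x B2P] B12]; exists (B2, B1) => //= -[Q y] /= [BQ By].
    by apply: B12.
  apply: (@le_trans _ _ (weight m V (U `&` A'))); last first.
    by apply: le_outer_measure => -[x P] [/= [Ux A'x] GP]; split => //; exact: A'x.
  apply: ereal_inf_lbound; exists (U `&` A') => //; split; first by exists A'.
  by move=> x Ax; split; [exact: AU|move=> P GP; apply: (AW (x, P) _).2].
Qed.

Lemma weight_radon_hull (A : set 'rV[R]_n) : weight m V A < +oo -> exists H : set 'rV[R]_n,
  [/\ A `&` U `<=` H, V.-caratheodory (fst @^-1` H) & weight m V H = weight m V A].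
Proof.
move=> Aoo; have rw := radon_weight.
have /choice[ O OP] : forall k, exists O, [/\ open O, A `&` U `<=` O &
    weight m V O <= weight m V A + (k.+1%:R^-1 : R)%:E].
  by move=> k; apply: (radon_outer rw) => //; rewrite invr_gt0.
exists (\bigcap_k O k); split.
- by move=> x Ax k _; by have [_ + _] := OP k; apply.
- rewrite preimage_bigcap -[\bigcap_k _]setCK; apply: caratheodory_measurable_setC.
  rewrite setC_bigcap; apply: caratheodory_measurable_bigcup => k.
  apply: caratheodory_measurable_setC; apply: (radon_open vV); apply: open_cyl.
  by have [] := OP k.
apply/eqP; rewrite eq_le; apply/andP; split.
  apply/lee_addgt0Pr => e e0.
  have [k ke] : exists k : nat, (k.+1%:R^-1 < e)%R.
    exists (Num.trunc e^-1); rewrite -[ltRHS]invrK ltf_pV2 ?posrE ?invr_gt0//.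
    exact: truncnS_gt.
  have [_ _ h] := OP k.
  apply: (@le_trans _ _ (weight m V (O k))).
    by apply: le_outer_measure => x; apply.
  by apply: (le_trans h); rewrite leeD2l// lee_fin ltW.
rewrite -(radonI rw) setIC; apply: le_outer_measure => x Ax k _.
by have [_ + _] := OP k; apply.
Qed.

(** Cylinders over measurable sets are measurable: up to a null set such a set
    is locally a countable intersection of open sets. *)
Lemma cyl_cara A : (weight m V).-caratheodory A -> V.-caratheodory (fst @^-1` A).
Proof.
move=> cA; have rw := radon_weight.
have [K [KP UK]] := compact_exhaustion oU.
have X0 : V (~` (fst @^-1` U)) = 0.
  by rewrite preimage_setC -weight_cyl (radon_null rw).
apply: (@caratheodory_cover _ _ _ _ (fun k => fst @^-1` K k) _ X0).
  by move=> [x P] /= /UK[k _ Kx]; exists k.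
move=> k; have [cK KU] := KP k.
rewrite -preimage_setI.
have cAK : (weight m V).-caratheodory (A `&` K k).
  by apply: caratheodory_measurable_setI => //; exact: (compact_cara rw cK).
have AKoo : weight m V (A `&` K k) < +oo.
  by apply: le_lt_trans (radon_compact rw cK KU); apply: le_outer_measure => x [].
have [H [AH cH HE]] := weight_radon_hull AKoo.
have AKH : A `&` K k `<=` H by move=> x [Ax Kx]; apply: AH; split => //; exact: KU.
have H0 : weight m V (H `\` (A `&` K k)) = 0.
  have := cAK H; rewrite setIC (setIidl AKH) HE.
  have : weight m V (A `&` K k) \is a fin_num by rewrite ge0_fin_numE.
  have := outer_measure_ge0 (weight m V) (H `&` ~` (A `&` K k)); rewrite setDE.
  move: (weight m V _) (weight m V _) => [a||] [b||]//= a0 _ [] h.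
  by congr EFin; move: h; lra.
have -> : fst @^-1` (A `&` K k) = fst @^-1` H `\` fst @^-1` (H `\` (A `&` K k))
    :> set ('rV[R]_n * 'M[R]_n).
  apply/seteqP; split=> -[x P] /=.
    by move=> h; split; [exact: AKH|case].
  by move=> [Hx nh]; apply: contrapT => nA; apply: nh.
apply: caratheodory_measurable_setD => //; apply: null_caratheodory.
by rewrite -weight_cyl.
Qed.

End weight_measure.

(** * The first variation as an integral *)

Lemma caratheodory_setT {R : realType} {T : Type} (mu : {outer_measure set T -> \bar R}) :
  mu.-caratheodory setT.
Proof. by rewrite -setC0; apply/caratheodory_measurable_setC/caratheodory_measurable_set0. Qed.

Section first_variation.
Context {R : realType} {n : nat} (m : nat).
Variable U : set 'rV[R]_n.
Variable V : {outer_measure set ('rV[R]_n * 'M[R]_n)%type -> \bar R}.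
Local Notation G := (@Grass R n m).
Hypotheses (oU : open U) (vV : varifold U m V).
Implicit Types th : 'rV[R]_n -> 'rV[R]_n.

Definition tangential_div th (z : 'rV[R]_n * 'M[R]_n) : R :=
  mxdot z.2 (jacobian th z.1).

Lemma derive_off_spt th x v : ~ fun_spt th x -> 'D_v th x = 0.
Proof.
move=> nx; rewrite (near_eq_derive (g := cst 0)) ?derive_cst//.
have oC : open (~` fun_spt th) by apply: closed_openC; exact: closed_closure.
by apply: filterS (open_nbhs_nbhs (conj oC nx)) => y /fun_spt0.
Qed.

Lemma tangential_divE th z : smooth th -> tangential_div th z =
  \sum_i \sum_j z.2 j i * 'D_(delta_mx ord0 j) th z.1 ord0 i.
Proof. by move=> sth; rewrite /tangential_div mxdot_jacobian//; exact: smooth_differentiable. Qed.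

Lemma tangential_div_local th th' z : (\forall x \near z.1, th x = th' x) ->
  smooth th -> smooth th' -> tangential_div th z = tangential_div th' z.
Proof.
move=> h s s'; rewrite !tangential_divE//.
by apply: eq_bigr => i _; apply: eq_bigr => j _; rewrite (near_eq_derive _ h).
Qed.

Lemma tangential_div_off_spt th z : smooth th -> ~ fun_spt th z.1 -> tangential_div th z = 0.
Proof.
move=> s nz; rewrite tangential_divE// big1// => i _; rewrite big1// => j _.
by rewrite derive_off_spt// mxE mulr0.
Qed.

Lemma tangential_div_bfin th : test_fun U th -> bfin V (tangential_div th).
Proof.
move=> [s c sU].
have -> : tangential_div th = fun z => \sum_(i <- enum 'I_n) \sum_(j <- enum 'I_n)
    z.2 j i * 'D_(delta_mx ord0 j) th z.1 ord0 i.
  apply/funext => z; rewrite tangential_divE// big_enum; apply: eq_bigr => i _.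
  by rewrite big_enum.
apply: bfin_sum => i; apply: bfin_sum => j.
have cD : continuous (fun x => 'D_(delta_mx ord0 j) th x ord0 i).
  have [_ /(_ (delta_mx ord0 j))] := s 1%N.
  by move=> /(@Ck_mx _ _ 0)/(_ i).
have [M [_ HM]] : bounded_set ((fun x => 'D_(delta_mx ord0 j) th x ord0 i) @` fun_spt th).
  by apply/compact_bounded/continuous_compact => //; exact: continuous_subspaceT.
have M1 : M < `|M| + 1 by rewrite (le_lt_trans (ler_norm _))// ltrDl.
apply: (@bfinI _ _ _ (U `*` G) _ (fst @^-1` fun_spt th) (`|M| + 1)).
- apply: (radon_cmeas vV) => z; apply: cvgM.
    apply: (@cvg_comp _ _ _ snd (fun P : 'M[R]_n => P j i) (nbhs z) (nbhs z.2)).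
      exact: cvg_snd.
    exact: coord_continuous.
  apply: (@cvg_comp _ _ _ fst (fun x => 'D_(delta_mx ord0 j) th x ord0 i) (nbhs z) (nbhs z.1)).
    exact: cvg_fst.
  exact: cD.
- exact: varifold_null vV.
- apply: (cyl_cara oU vV); apply: (radon_closed (radon_weight oU vV)).
  exact: closed_closure.
- rewrite -(weight_cyl vV); apply: (radon_compact (radon_weight oU vV)) => //.
- by rewrite addr_ge0.
move=> [x P] [/= Ux GP]; rewrite indicE.
have [xs|xs] := boolP (_ \in _).
  rewrite mulr1 normrM -[leRHS]mul1r ler_pM//; first exact: Grass_coord_le GP.
  apply: (HM _ M1); exists x => //; exact: (set_mem xs).
rewrite mulr0 derive_off_spt ?mxE ?mulr0 ?normr0//.
by move=> xs'; move: xs; rewrite mem_set.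
Qed.

Lemma tangential_divD th th' z : smooth th -> smooth th' ->
  tangential_div (fun x => th x + th' x) z = tangential_div th z + tangential_div th' z.
Proof.
move=> s s'; rewrite !tangential_divE//; last by move=> k; exact: Ck_add.
rewrite -big_split; apply: eq_bigr => i _; rewrite -big_split; apply: eq_bigr => j _.
rewrite /= -mulrDr deriveD ?mxE//; apply: diff_derivable; exact: smooth_differentiable.
Qed.

Lemma tangential_divZ (a : R) th z : smooth th ->
  tangential_div (fun x => a *: th x) z = a * tangential_div th z.
Proof.
move=> s; rewrite !tangential_divE//; last first.
  by move=> k; apply: Ck_scalev => //; exact: Ck_cst.
rewrite mulr_sumr; apply: eq_bigr => i _; rewrite mulr_sumr; apply: eq_bigr => j _.
rewrite mulrCA deriveZ ?mxE//; apply: diff_derivable; exact: smooth_differentiable.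
Qed.

Lemma cyl_grass_cara E : (weight m V).-caratheodory E -> V.-caratheodory (E `*` G).
Proof.
move=> cE; have -> : E `*` G = fst @^-1` E `&` snd @^-1` G by [].
apply: caratheodory_measurable_setI; first exact: (cyl_cara oU vV).
apply: (radon_closed vV); apply: preimage_closed; first by move=> z _; exact: cvg_snd.
by apply: compact_closed; [exact: norm_hausdorff|exact: Grass_compact].
Qed.

Lemma first_var_vrestr E th : (weight m V).-caratheodory E -> test_fun U th ->
  first_var (vrestr m V E) th =
  Rintegral (cara_measure V) (E `*` G) (tangential_div th).
Proof.
move=> cE tth; congr fine.
rewrite -[RHS]integral_orestr//; first exact: cyl_grass_cara.
by have [] := tangential_div_bfin tth.
Qed.

Lemma first_varE th : first_var V th = Rintegral (cara_measure V) setT (tangential_div th).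
Proof. by []. Qed.

Lemma first_varD th th' : test_fun U th -> test_fun U th' ->
  first_var V (fun x => th x + th' x) = first_var V th + first_var V th'.
Proof.
move=> t t'; rewrite !first_varE -RintegralD//; last 2 first.
- by apply: bfin_integrable; [exact: caratheodory_setT|exact: tangential_div_bfin].
- by apply: bfin_integrable; [exact: caratheodory_setT|exact: tangential_div_bfin].
have [[s _ _] [s' _ _]] := (t, t').
by congr Rintegral; apply/funext => z; exact: tangential_divD.
Qed.

Lemma first_varZ (a : R) th : test_fun U th ->
  first_var V (fun x => a *: th x) = a * first_var V th.
Proof.
move=> t; rewrite !first_varE -RintegralZl//; last first.
  by apply: bfin_integrable; [exact: caratheodory_setT|exact: tangential_div_bfin].
have [s _ _] := t.
by congr Rintegral; apply/funext => z; exact: tangential_divZ.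
Qed.

End first_variation.

(** * Existence of the variation measure *)

Section variation_existence.
Context {R : realType} {n : nat}.
Variables (U : set 'rV[R]_n) (S : ('rV[R]_n -> 'rV[R]_n) -> R).
Hypothesis oU : open U.
Hypothesis SD : forall th th', test_fun U th -> test_fun U th' ->
  S (fun x => th x + th' x) = S th + S th'.
Hypothesis SZ : forall a th, test_fun U th -> S (fun x => a *: th x) = a * S th.
Local Open Scope ereal_scope.
Implicit Types (A B G H : set 'rV[R]_n) (th : 'rV[R]_n -> 'rV[R]_n).

Definition unit_test G th :=
  [/\ test_fun U th, fun_spt th `<=` G & forall x, (enorm (th x) <= 1)%R].

Definition var_open G : \bar R := ereal_sup [set (S th)%:E | th in unit_test G].

Let S0 : S (cst 0%R) = 0%R.
Proof.
have := SZ 0 (test_fun0 U); rewrite mul0r => <-.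
by congr S; apply/funext => x; rewrite scale0r.
Qed.

Let unit_test0 G : unit_test G (cst 0%R).
Proof.
split; [exact: test_fun0| |by move=> x; rewrite enorm0 ler01].
rewrite /fun_spt (_ : [set _ | _] = set0) ?closure0//.
by apply/seteqP; split => // z /=; rewrite eqxx.
Qed.

Lemma var_open_ge0 G : 0 <= var_open G.
Proof. by apply: ereal_sup_ubound; exists (cst 0%R); rewrite ?S0. Qed.

Lemma var_open_le G H : G `<=` H -> var_open G <= var_open H.
Proof.
move=> GH; apply: le_ereal_sup => _ [th [t sG t1] <-].
by exists th => //; split => //; exact: subset_trans GH.
Qed.

(** Subadditivity: a smooth cutoff splits a test field along two open sets
    that cover its support. *)
Lemma var_openU G H : open G -> open H ->
  var_open (G `|` H) <= var_open G + var_open H.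
Proof.
move=> oG oH; apply: ge_ereal_sup => _ [th [t sGH t1] <-].
have [sth cth thU] := t.
have cK : compact (fun_spt th `\` H).
  rewrite setDE; apply: compact_closedI => //; exact: open_closedC.
have KG : fun_spt th `\` H `<=` G by move=> x [/sGH[]].
have [psi [spsi psi01 [N [oN KN N1]] cpsi psiG]] := smooth_urysohn cK oG KG.
have s1 : smooth (fun x => 1 - psi x)%R.
  move=> k; rewrite (_ : (fun x => _) = (fun z => cst 1 z + (-1) * psi z)%R).
    by apply: Ck_add; [exact: Ck_cst|apply: Ck_mul; [exact: Ck_cst|exact: spsi]].
  by apply/funext => z; rewrite mulN1r.
have t2 := test_fun_mul spsi t; have t3 := test_fun_mul s1 t.
have -> : S th = (S (fun x => psi x *: th x) + S (fun x => (1 - psi x) *: th x))%R.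
  rewrite -SD//; congr S; apply/funext => x.
  by rewrite -scalerDl addrC subrK scale1r.
rewrite EFinD leeD//; apply: ereal_sup_ubound.
  exists (fun x => psi x *: th x)%R => //; split => //.
    apply: subset_trans psiG; apply: closure_subset => x /=.
    by apply: contraNN => /eqP ->; rewrite scale0r.
  move=> x; have /andP[p0 p1] := psi01 x.
  by rewrite enormZ ger0_norm// mulr_ile1 ?enorm_ge0.
exists (fun x => (1 - psi x) *: th x)%R => //; split => //.
  move=> x xs; apply: contrapT => nHx.
  have sx : fun_spt th x.
    by apply: (fun_spt_sub _ xs) => y ->; rewrite scaler0.
  have Nx : N x by apply: KN.
  have cN : closed (~` N) by exact: open_closedC.
  suff : (~` N) x by [].
  rewrite (closure_id (~` N)).1//; apply: closure_subset xs => y /=.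
  by apply: contraPnot => /N1 ->; rewrite subrr scale0r; exact/negP/negPn.
move=> x; have /andP[p0 p1] := psi01 x.
by rewrite enormZ ger0_norm ?subr_ge0// mulr_ile1 ?enorm_ge0 ?subr_ge0// gerBl.
Qed.

Lemma var_open_bigU (F : nat -> set 'rV[R]_n) N : (forall k, open (F k)) ->
  var_open (\bigcup_(k in `I_N) F k) <= \sum_(0 <= k < N) var_open (F k).
Proof.
move=> oF; elim: N => [|N IH].
  rewrite big_geq//; apply: ge_ereal_sup => _ [th [t s _] <-].
  have -> : th = cst 0%R; last by rewrite S0.
  apply/funext => x; apply: fun_spt0 => /s[]//.
rewrite big_nat_recr//= bigcup_mkord big_ord_recr /= -bigcup_mkord.
apply: (le_trans (var_openU _ (oF N))); first by apply: bigcup_open => k _.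
by rewrite leeD2r.
Qed.

Lemma var_open_bigcup (F : nat -> set 'rV[R]_n) : (forall k, open (F k)) ->
  var_open (\bigcup_k F k) <= \sum_(0 <= k <oo) var_open (F k).
Proof.
move=> oF; apply: ge_ereal_sup => _ [th [t s t1] <-].
have [sth cth thU] := t.
have [N HN] : exists N, fun_spt th `<=` \bigcup_(k in `I_N) F k.
  apply: (@compact_ind _ (fun_spt th) (fun K => exists N, K `<=` \bigcup_(k in `I_N) F k)) => //.
  - by exists 0%N.
  - by move=> A B AB [N BN]; exists N; exact: subset_trans BN.
  - move=> A B [N AN] [M BM]; exists (N + M)%N => x [/AN|/BM] [k /= kN Fk]; exists k => //=.
      by rewrite ltn_addr.
    by rewrite ltn_addl.
  - move=> x /s[k _ Fkx]; exists (F k); first exact: open_nbhs_nbhs.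
    by exists k.+1 => y Fky; exists k => /=.
apply: (@le_trans _ _ (var_open (\bigcup_(k in `I_N) F k))).
  by apply: ereal_sup_ubound; exists th.
apply: (le_trans (var_open_bigU _ oF)).
by apply: nneseries_lim_ge => k _ _; exact: var_open_ge0.
Qed.

(** The total variation as an outer measure: the supremum formula on open sets,
    extended to all sets by outer regularity. *)
Definition ovar A : \bar R :=
  ereal_inf [set var_open G | G in [set G | [/\ open G, G `<=` U & A `&` U `<=` G]]].

Lemma ovar_open G : open G -> G `<=` U -> ovar G = var_open G.
Proof.
move=> oG GU; apply/eqP; rewrite eq_le; apply/andP; split.
  by apply: ereal_inf_lbound; exists G => //; split => // x [].
apply: le_ereal_inf_tmp => _ [H [oH HU GH] <-]; apply: var_open_le => x Gx.
by apply: GH; split => //; exact: GU.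
Qed.

Let ovar_ge0 A : 0 <= ovar A.
Proof. by apply: le_ereal_inf_tmp => _ [G _ <-]; exact: var_open_ge0. Qed.

Let ovar0 : ovar set0 = 0.
Proof.
rewrite ovar_open; [|exact: open0|exact: sub0set].
apply/eqP; rewrite eq_le var_open_ge0 andbT; apply: ge_ereal_sup => _ [th [t s _] <-].
have -> : th = cst 0%R; last by rewrite S0.
by apply/funext => x; apply: fun_spt0 => /s.
Qed.

Let ovar_le : {homo ovar : A B / A `<=` B >-> A <= B}.
Proof.
move=> A B AB; apply: ereal_inf_le_tmp => _ [G [oG GU BG] <-].
by exists G => //; split => // x [/AB Bx Ux]; exact: BG.
Qed.

Let ovar_sub : sigma_subadditive ovar.
Proof.
move=> F.
have [[k Fk]|nF] := pselect (exists k, ovar (F k) = +oo).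
  by rewrite (nneseries_pinfty (k := k))// ?leey// => *; exact: ovar_ge0.
have fF k : ovar (F k) \is a fin_num.
  rewrite ge0_fin_numE// lt_neqAle leey andbT; apply/eqP => h; apply: nF.
  by exists k.
apply/lee_addgt0Pr => e e0.
have e1 k : (0 < e / (2 ^ k.+1)%:R)%R by rewrite divr_gt0// ltr0n expn_gt0.
have /choice[G GP] : forall k, exists G, [/\ open G, G `<=` U, F k `&` U `<=` G &
    var_open G <= ovar (F k) + (e / (2 ^ k.+1)%:R)%:E].
  move=> k; have := lb_ereal_inf_adherent (e1 k) (fF k).
  by move=> [_ [G [oG GU FG] <-] /ltW h]; exists G.
apply: (@le_trans _ _ (var_open (\bigcup_k G k))).
  apply: ereal_inf_lbound; exists (\bigcup_k G k) => //; split.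
  - by apply: bigcup_open => k _; have [] := GP k.
  - by move=> x [k _ Gx]; have [_ + _ _] := GP k; apply.
  - move=> x [[k _ Fx] Ux]; exists k => //; have [_ _ + _] := GP k; exact.
apply: le_trans (var_open_bigcup _) _; first by move=> k; have [] := GP k.
apply: (@le_trans _ _ (\sum_(0 <= k <oo) (ovar (F k) + (e / (2 ^ k.+1)%:R)%:E))).
  apply: lee_nneseries => k _; first by move=> _; exact: var_open_ge0.
  by have [] := GP k.
by apply: epsilon_trick => //; exact: ltW.
Qed.

HB.instance Definition _ := isOuterMeasure.Build R _ ovar ovar0 ovar_ge0 ovar_le ovar_sub.

Definition ovar_measure : {outer_measure set 'rV[R]_n -> \bar R} := ovar.

Lemma ovar_cara O : open O -> ovar_measure.-caratheodory O.
Proof.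
move=> oO; apply: le_caratheodory_measurable => A /=.
apply: le_ereal_inf_tmp => _ [G [oG GU AG] <-].
apply: (@le_trans _ _ (var_open (G `&` O) + ovar (A `&` ~` O))).
  rewrite leeD2r//; apply: ereal_inf_lbound; exists (G `&` O) => //; split.
  - exact: openI.
  - by move=> x [/GU].
  - by move=> x [[Ax Ox] Ux]; split => //; exact: AG.
have [->|finA] := eqVneq (var_open G) +oo; first exact: leey.
have finB : ovar (A `&` ~` O) \is a fin_num.
  rewrite ge0_fin_numE ?ovar_ge0// (@le_lt_trans _ _ (var_open G))//; last first.
    by rewrite lt_neqAle finA leey.
  by apply: ereal_inf_lbound; exists G => //; split => // x [[Ax _] Ux]; exact: AG.
rewrite -leeBrDr//; apply: ge_ereal_sup => _ [th [t s t1] <-].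
have [sth cth thU] := t.
rewrite leeBrDr// -leeBrDl//.
have cK : closed (fun_spt th) by exact: closed_closure.
have oGK : open (G `\` fun_spt th) by rewrite setDE; apply: openI => //; exact: closed_openC.
apply: (@le_trans _ _ (var_open (G `\` fun_spt th))).
  apply: ereal_inf_lbound; exists (G `\` fun_spt th) => //; split => //.
    by move=> x [/GU].
  by move=> x [[Ax nOx] Ux]; split; [exact: AG|move=> /s[_]].
apply: ge_ereal_sup => _ [ps [t' s' t1'] <-].
rewrite leeBrDl// -EFinD -SD//; apply: ereal_sup_ubound.
exists (fun x => th x + ps x)%R => //; split.
- exact: test_fun_add.
- have h : fun_spt (fun x => th x + ps x)%R `<=` fun_spt th `|` fun_spt ps.
    rewrite /fun_spt -closureU; apply: closure_subset => x /=.
    by apply: contraPP => /not_orP[/negP/negPn/eqP -> /negP/negPn/eqP ->]; rewrite addr0 eqxx.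
  by move=> x /h[/s[]|/s'[]].
move=> x; have [xs|xs] := pselect (fun_spt ps x).
  have /fun_spt0 -> : ~ fun_spt th x by have [] := s' _ xs.
  by rewrite add0r.
by rewrite (fun_spt0 xs) addr0.
Qed.

Lemma ovar_regular : borel_regular U ovar_measure.
Proof.
split.
- rewrite /= (_ : ovar (~` U) = 0)//; apply/eqP; rewrite eq_le ovar_ge0 andbT -ovar0.
  rewrite /ovar; apply: ereal_inf_le_tmp => _ [G [oG GU _] <-]; exists G => //; split => //.
  by move=> x [].
- by move=> _ [ O oO ->]; apply: ovar_cara; exact: openI.
move=> A AU; have [Aoo|Aoo] := eqVneq (ovar A) +oo.
  exists U; split => //; first by apply: sub_sigma_algebra.
  apply/eqP; rewrite /= Aoo eq_le leey /= -Aoo; exact: ovar_le.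
have fA : ovar A \is a fin_num by rewrite ge0_fin_numE// lt_neqAle Aoo leey.
have /choice[G GP] : forall k, exists G, [/\ open G, G `<=` U, A `<=` G &
    var_open G <= ovar A + (k.+1%:R^-1 : R)%:E].
  move=> k; have k0 : (0 < k.+1%:R^-1 :> R)%R by rewrite invr_gt0.
  have := lb_ereal_inf_adherent k0 fA.
  move=> [_ [G [oG GU FG] <-] /ltW h]; exists G; split => // x Ax.
  by apply: FG; split => //; exact: AU.
exists (\bigcap_k G k); split.
- rewrite -[\bigcap_k _]setCK; rewrite setC_bigcap.
  have sA := @smallest_sigma_algebra _ setT [set O : set 'rV[R]_n | open O].
  have [_ sC sU] := sA.
  have bG k : borel (~` G k).
    rewrite -setTD; apply: (sC (G k) _).
    by apply: (@sub_sigma_algebra _ setT [set O : set 'rV[R]_n | open O]); have [] := GP k.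
  by rewrite -setTD; exact: (sC _ (sU _ bG)).
- by move=> x Ax k _; have [_ _ + _] := GP k; apply.
- by move=> x /(_ 0%N Logic.I); have [_ + _ _] := GP 0%N; apply.
apply/eqP; rewrite eq_le; apply/andP; split; last first.
  by apply: ovar_le => x Ax k _; have [_ _ + _] := GP k; apply.
apply/lee_addgt0Pr => e e0.
have [k ke] : exists k : nat, (k.+1%:R^-1 < e)%R.
  exists (Num.trunc e^-1); rewrite -[ltRHS]invrK ltf_pV2 ?posrE ?invr_gt0//.
  exact: truncnS_gt.
have [oG GU _ h] := GP k.
apply: (@le_trans _ _ (ovar (G k))); first by apply: ovar_le => x; apply.
by rewrite ovar_open// (le_trans h)// leeD2l// lee_fin ltW.
Qed.

Lemma ovar_is_variation : is_variation U S ovar_measure.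
Proof.
split; [exact: ovar_regular|by move=> G oG GU; exact: ovar_open|].
move=> nu [nU nO nR] nuG A /=; apply: le_ereal_inf_tmp => _ [G [oG GU AG] <-].
have <- : nu (A `&` U) = nu A by exact: outer_measureI_null.
rewrite (le_trans (le_outer_measure nu _ _ AG))//.
by rewrite nuG.
Qed.

Lemma variationP : is_variation U S (Defs.variation U S).
Proof. exact: (xgetPex _ (ex_intro _ _ ovar_is_variation)). Qed.

Lemma variation_open G : open G -> G `<=` U -> Defs.variation U S G = var_open G.
Proof. by have [_ H _] := variationP; exact: H. Qed.

Lemma le_variation G th : open G -> G `<=` U -> unit_test G th ->
  (S th)%:E <= Defs.variation U S G.
Proof.
by move=> oG GU t; rewrite variation_open//; apply: ereal_sup_ubound; exists th.
Qed.

End variation_existence.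

(** * Integrals of bounded functions *)

Lemma Rintegral_indicM {R : realType} {T : pointedType} (mu : {outer_measure set T -> \bar R})
    (A : set T) : mu.-caratheodory A ->
  Rintegral (cara_measure mu) setT (\1_A) = fine (mu A).
Proof.
move=> cA; congr fine; rewrite integral_indic ?setIT//.
Qed.

Lemma indic_bfin {R : realType} {T : pointedType} (mu : {outer_measure set T -> \bar R})
    (A : set T) : mu.-caratheodory A -> (mu A < +oo)%E -> bfin mu (\1_A).
Proof.
move=> cA Aoo; split; first exact: (@measurable_indic _ (caratheodory_type mu) R setT A).
exists A, 1; split => //; rewrite (_ : [set _ | _] = set0) ?outer_measure0//.
apply/seteqP; split => // x /=; rewrite mul1r indicE.
by case: (x \in A); rewrite ?normr1 ?normr0 lexx.
Qed.

Section real_integral.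
Context {R : realType} {T : pointedType}.
Variable mu : {outer_measure set T -> \bar R}.
Local Notation I := (Rintegral (cara_measure mu) setT).
Let cT : mu.-caratheodory setT := caratheodory_setT mu.

Lemma RintD f g : bfin mu f -> bfin mu g -> I (fun x => f x + g x) = I f + I g.
Proof. by move=> bf bg; rewrite RintegralD//; exact: bfin_integrable. Qed.

Lemma RintZ (c : R) f : bfin mu f -> I (fun x => c * f x) = c * I f.
Proof. by move=> bf; rewrite RintegralZl//; exact: bfin_integrable. Qed.

Lemma Rint_le f g : bfin mu f -> bfin mu g -> (forall x, f x <= g x) -> I f <= I g.
Proof. by move=> bf bg fg; apply: le_Rintegral => //; exact: bfin_integrable. Qed.

Lemma Rint_sum J (s : seq J) (F : J -> T -> R) : (forall j, bfin mu (F j)) ->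
  I (fun x => \sum_(j <- s) F j x) = \sum_(j <- s) I (F j).
Proof.
move=> H; elim: s => [|j s IH].
  rewrite big_nil; under eq_Rintegral do rewrite big_nil.
  by rewrite Rintegral_cst// mul0r.
rewrite big_cons -IH -RintD//; last exact: bfin_sum.
by congr Rintegral; apply/funext => x; rewrite big_cons.
Qed.

End real_integral.

(** Summing the dyadic thresholds below [a] recovers [a] up to a factor. *)
Lemma dyadic_sum_le {R : realType} N (a : R) : 0 <= a ->
  \sum_(0 <= i < N) 2 ^- i * (2 ^- i < a)%R%:R <= 2 * a.
Proof.
have geo k : \sum_(0 <= i < k) 2 ^- i <= 2 :> R.
  suff -> : \sum_(0 <= i < k) 2 ^- i = 2 - 2 * 2 ^- k :> R.
    by rewrite gerBl mulr_ge0// invr_ge0 exprn_ge0.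
  elim: k => [|k IH]; first by rewrite big_geq// expr0 invr1 mulr1 subrr.
  rewrite big_nat_recr//= IH exprS invfM; set X := 2 ^- k; lra.
elim: N a => [|N IH] a a0; first by rewrite big_geq// mulr_ge0.
have [a1|a1] := ltP 1 a.
  apply: (@le_trans _ _ (\sum_(0 <= i < N.+1) 2 ^- i)); last first.
    by rewrite (le_trans (geo _))// ler_peMr// ltW.
  apply: ler_sum => i _; rewrite ler_piMr ?invr_ge0 ?exprn_ge0//.
  by case: (_ < _)%R; rewrite ?ler01.
rewrite big_nat_recl//= expr0 invr1 ltNge a1 mulr0 add0r.
have -> : \sum_(0 <= i < N) 2 ^- i.+1 * (2 ^- i.+1 < a)%R%:R =
    2^-1 * \sum_(0 <= i < N) 2 ^- i * (2 ^- i < 2 * a)%R%:R :> R.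
  rewrite mulr_sumr; apply: eq_bigr => i _; rewrite mulrA exprS invfM; congr (_ * _).
  by rewrite ltr_pdivrMl.
rewrite ler_pdivrMl// (le_trans (IH _ _)) ?mulr_ge0//.
Qed.

Section vector_L1.
Context {R : realType} {n : nat}.
Variables (U : set 'rV[R]_n) (mu : {outer_measure set 'rV[R]_n -> \bar R}).
Hypothesis rmu : radon U mu.
Local Notation I f := (Rintegral (cara_measure mu) setT (fun x => enorm (f x))).

Lemma omeasurable_coord f i : omeasurable mu f ->
  cmeas mu (fun x : 'rV[R]_n => (f x : 'rV[R]_n) ord0 i).
Proof.
move=> mf; apply: caratheodory_fun => O oO; apply: (mf [set u | O (u ord0 i)]).
apply: (@open_comp _ _ (fun u : 'rV[R]_n => u ord0 i)) => // u _; exact: coord_continuous.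
Qed.

Lemma cmeas_enormB (f g : 'rV[R]_n -> 'rV[R]_n) : omeasurable mu f -> omeasurable mu g ->
  cmeas mu (fun x => enorm (f x - g x)).
Proof.
move=> mf mg; rewrite /cmeas /enorm.
have ms : measurable_fun [set: R] (@Num.sqrt R).
  by apply: continuous_measurable_fun; exact: sqrt_continuous.
apply: (measurableT_comp ms).
rewrite /dot; apply: (@measurable_sum _ (caratheodory_type mu)) => i.
have mi : cmeas mu (fun x => (f x - g x) ord0 i).
  rewrite (_ : (fun x => _) = (fun x => f x ord0 i - g x ord0 i)); last first.
    by apply/funext => x; rewrite !mxE.
  by apply: measurable_funB; exact: omeasurable_coord.
exact: measurable_funM.
Qed.

Lemma omeasurable_cst (w : 'rV[R]_n) : omeasurable mu (fun _ : 'rV[R]_n => w).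
Proof.
move=> O _; have [Ow|nOw] := pselect (O w).
  rewrite (_ : _ @^-1` _ = setT); first exact: caratheodory_setT.
  by apply/seteqP; split=> x /=.
rewrite (_ : _ @^-1` _ = set0); first exact: caratheodory_measurable_set0.
by apply/seteqP; split => // x /nOw.
Qed.

Lemma cmeas_enorm f : omeasurable mu f -> cmeas mu (fun x => enorm (f x : 'rV[R]_n)).
Proof.
move=> mf; have := cmeas_enormB mf (omeasurable_cst 0).
by congr (cmeas mu _); apply/funext => x; rewrite subr0.
Qed.

Lemma L1_integrable f : L1 mu f ->
  (cara_measure mu).-integrable setT (EFin \o (fun x => enorm (f x))).
Proof.
move=> [mf foo]; apply/integrableP; split.
  by apply/measurable_EFinP; exact: cmeas_enorm.
apply: le_lt_trans foo; rewrite le_eqVlt; apply/orP; left; apply/eqP.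
by apply: eq_integral => x _ /=; rewrite ger0_norm ?enorm_ge0.
Qed.

Lemma L1B_integrable f g : L1 mu f -> L1 mu g ->
  (cara_measure mu).-integrable setT (EFin \o (fun x => enorm (f x - g x))).
Proof.
move=> Lf Lg; apply: (@le_integrable _ _ _ (cara_measure mu) setT measurableT _
   (EFin \o (fun x => enorm (f x) + enorm (g x)))).
- by apply/measurable_EFinP; apply: cmeas_enormB; [case: Lf|case: Lg].
- move=> x _ /=; rewrite lee_fin !ger0_norm ?addr_ge0 ?enorm_ge0//.
  by rewrite (le_trans (enormD _ _))// enormN.
- rewrite (_ : EFin \o _ = (EFin \o (fun x => enorm (f x))) \+ (EFin \o (fun x => enorm (g x))))%E//.
  by apply: integrableD => //; exact: L1_integrable.
Qed.

Lemma enormI_le f g h : L1 mu f -> L1 mu g -> L1 mu h ->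
  I (fun x => f x - h x) <= I (fun x => f x - g x) + I (fun x => g x - h x).
Proof.
move=> Lf Lg Lh; rewrite -RintegralD//; last 2 first.
- exact: L1B_integrable.
- exact: L1B_integrable.
apply: le_Rintegral => //.
- exact: L1B_integrable.
- rewrite (_ : EFin \o _ = (EFin \o (fun x => enorm (f x - g x))) \+ (EFin \o (fun x => enorm (g x - h x))))%E//.
  by apply: integrableD => //; exact: L1B_integrable.
- by move=> x _; exact: edist_tri.
Qed.

Lemma test_bfin th : test_fun U th -> bfin mu (fun x => enorm (th x)).
Proof.
move=> t; have [s c sU] := t; have [M M0 HM] := test_fun_bounded t.
apply: (@bfinI _ _ _ setT _ (fun_spt th) M).
- apply: (radon_cmeas rmu) => x.
  apply: (@continuous_comp _ _ _ th (@enorm R n)); last exact: enorm_continuous.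
  exact: smooth_continuous.
- by rewrite setCT outer_measure0.
- by apply: (radon_closed rmu); exact: closed_closure.
- exact: (radon_compact rmu).
- exact: ltW.
move=> x _; rewrite ger0_norm ?enorm_ge0// indicE.
have [xs|xs] := boolP (_ \in _); first by rewrite mulr1.
by rewrite mulr0 fun_spt0 ?enorm0// => xs'; move: xs; rewrite mem_set.
Qed.

Lemma bfin_lt (f : 'rV[R]_n -> R) : bfin mu f -> (forall x, 0 <= f x) ->
  (oint mu setT (fun x => (f x)%:E) < +oo)%E.
Proof.
move=> bf f0.
have /integrableP[_] := bfin_integrable (caratheodory_setT mu) bf.
apply: le_lt_trans; rewrite le_eqVlt; apply/orP; left; apply/eqP.
by apply: eq_integral => x _ /=; rewrite ger0_norm.
Qed.

Lemma test_L1 th : test_fun U th -> L1 mu th.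
Proof.
move=> t; split.
  move=> O oO; apply: (radon_open rmu); apply: open_comp => // x _.
  by have [s _ _] := t; exact: smooth_continuous.
by apply: bfin_lt => [|x]; [exact: test_bfin|exact: enorm_ge0].
Qed.

Lemma patch_L1 A th : mu.-caratheodory A -> test_fun U th ->
  L1 mu (patch (fun=> 0) A th).
Proof.
move=> cA t; split.
  move=> O oO.
  have cth : mu.-caratheodory (th @^-1` O) by have [H _] := test_L1 t; exact: H.
  have -> : patch (fun=> 0) A th @^-1` O =
     (A `&` th @^-1` O) `|` (~` A `&` (fun=> 0 : 'rV[R]_n) @^-1` O).
    apply/seteqP; split=> x; rewrite /preimage /= /patch.
      by case: (boolP (x \in A)) => [/set_mem|/negP nA] Ax; [left|right; split => // /mem_set].
    by move=> [[/mem_set -> //]|[nA]]; rewrite memNset.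
  apply: caratheodory_measurable_setU; first exact: caratheodory_measurable_setI.
  apply: caratheodory_measurable_setI; first exact: caratheodory_measurable_setC.
  exact: (@omeasurable_cst 0 O oO).
have := bfin_indicM cA (test_bfin t) => /bfin_lt.
have E x : enorm (patch (fun=> 0) A th x) = \1_A x * enorm (th x).
  rewrite /patch indicE; case: (x \in A); first by rewrite mul1r.
  by rewrite enorm0 mul0r.
under [X in _ -> (X < _)%E]eq_integral do rewrite E.
by apply => x; rewrite mulr_ge0 ?enorm_ge0// indicE.
Qed.

End vector_L1.

(** * Bounding a functional by its variation measure *)

Section functional_bound.
Context {R : realType} {n : nat}.
Variables (U : set 'rV[R]_n) (S : ('rV[R]_n -> 'rV[R]_n) -> R).
Hypothesis oU : open U.
Hypothesis SD : forall th th', test_fun U th -> test_fun U th' ->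
  S (fun x => th x + th' x) = S th + S th'.
Hypothesis SZ : forall a th, test_fun U th -> S (fun x => a *: th x) = a * S th.
Local Notation var := (Defs.variation U S).
Hypothesis rvar : radon U var.
Local Notation I := (Rintegral (cara_measure var) setT).
Implicit Types (th : 'rV[R]_n -> 'rV[R]_n).

Lemma functional_le_sup G th c : open G -> G `<=` U -> (var G < +oo)%E -> 0 < c ->
  test_fun U th -> fun_spt th `<=` G -> (forall x, enorm (th x) <= c) ->
  `|S th| <= c * fine (var G).
Proof.
move=> oG GU Goo c0 t sG tc.
have fG : (var G) \is a fin_num by rewrite ge0_fin_numE ?outer_measure_ge0.
have H a : `|a| = 1 -> a * S th <= c * fine (var G).
  move=> a1; rewrite -ler_pdivrMl// mulrA -SZ//.
  rewrite -lee_fin fineK//; apply: (le_variation oU SD SZ) => //; split.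
  - exact: test_fun_scale.
  - by apply: subset_trans sG; apply: fun_spt_sub => x ->; rewrite scaler0.
  - by move=> x; rewrite enormZ normrM a1 mulr1 gtr0_norm ?invr_gt0// ler_pdivrMl// mulr1.
rewrite ler_norml; apply/andP; split.
  by have := H (-1); rewrite normrN1 mulN1r => /(_ erefl); rewrite lerNl.
by have := H 1; rewrite normr1 mul1r; apply.
Qed.

(** The functional is controlled by the integral of the length of the field;
    decomposing the field into dyadic layers of its length costs a constant
    factor only. *)
Lemma functional_le_integral th : test_fun U th ->
  `|S th| <= 16 * I (fun x => enorm (th x)).
Proof.
move=> t; have [sth cth thU] := t; have [M M0 HM] := test_fun_bounded t.
have [psi [_ _ [ O [oO KO O1]] cpsi psiU]] := smooth_urysohn cth oU thU.
have OU : O `<=` U.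
  move=> x Ox; apply: psiU; apply: subset_closure; rewrite /= O1//; exact: oner_neq0.
have Ooo : (var O < +oo)%E.
  apply: le_lt_trans (radon_compact rvar cpsi psiU); apply: le_outer_measure => x Ox.
  by apply: subset_closure; rewrite /= O1//; exact: oner_neq0.
pose r i := M * 2 ^- i : R.
have r0 i : 0 < r i by rewrite mulr_gt0// invr_gt0 exprn_gt0.
have rS i : r i = 2 * r i.+1 by rewrite /r exprS; field; rewrite expf_neq0.
pose tau i x := plateau (((r i)^-1 ^+ 2 * dot (th x) (th x) - 1) / 3).
have tau01 i x : 0 <= tau i x <= 1 by exact: plateau_itv.
have tau0 i x : enorm (th x) <= r i -> tau i x = 0.
  move=> h; apply: plateau0; rewrite pmulr_lle0 ?invr_gt0// subr_le0 -sqr_enorm -exprMn.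
  have h1 : 0 <= (r i)^-1 * enorm (th x) by rewrite mulr_ge0 ?enorm_ge0// invr_ge0 ltW.
  by rewrite exprn_ile1// ler_pdivrMl// mulr1.
have tau1 i x : 2 * r i <= enorm (th x) -> tau i x = 1.
  move=> h; apply: plateau1; rewrite ler_pdivlMr// mul1r lerBrDl -sqr_enorm -exprMn.
  have h2 : 2 <= (r i)^-1 * enorm (th x) by rewrite ler_pdivlMl// mulrC.
  have : 2 ^+ 2 <= ((r i)^-1 * enorm (th x)) ^+ 2.
    by rewrite lerXn2r ?nnegrE// (le_trans _ h2).
  by rewrite expr2; lra.
have stau i : smooth (tau i).
  move=> k; apply: Ck_plateau; apply: Ck_mul; last exact: Ck_cst.
  apply: Ck_add; last exact: Ck_cst.
  by apply: Ck_mul; [exact: Ck_cst|apply: Ck_dot; exact: sth].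
have sN k (h : 'rV[R]_n -> R) : Ck k h -> Ck k (fun x => - h x).
  move=> hk; rewrite (_ : (fun x => _) = (fun x => -1 * h x)).
    by apply: Ck_mul => //; exact: Ck_cst.
  by apply/funext => x; rewrite mulN1r.
pose om i x := (tau i.+1 x - tau i x) *: th x.
have tom i : test_fun U (om i).
  by apply: test_fun_mul => // k; apply: Ck_add; [exact: stau|exact/sN/stau].
pose rem N x := (1 - tau N x) *: th x.
have trem N : test_fun U (rem N).
  by apply: test_fun_mul => // k; apply: Ck_add; [exact: Ck_cst|exact/sN/stau].
have Sdec N : S th = \sum_(0 <= i < N) S (om i) + S (rem N).
  elim: N => [|N ->].
    rewrite big_geq// add0r; congr S; apply/funext => x.
    by rewrite /rem tau0 ?subr0 ?scale1r// /r expr0 invr1 mulr1.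
  rewrite big_nat_recr//= -addrA -SD//; congr (_ + S _); apply/funext => x.
  by rewrite /rem /om -scalerDl; congr (_ *: _); ring.
pose G i := O `&` [set x | r i.+2 < enorm (th x)].
have cth' : continuous (fun x => enorm (th x)).
  move=> x; apply: (@continuous_comp _ _ _ th (@enorm R n)); last exact: enorm_continuous.
  exact: smooth_continuous.
have oG i : open (G i).
  apply: openI => //; apply: (@open_comp _ _ (fun x => enorm (th x)) [set s | r i.+2 < s]).
    by move=> x _; exact: cth'.
  exact: open_gt.
have GO i : G i `<=` O by move=> x [].
have Goo i : (var (G i) < +oo)%E by apply: le_lt_trans Ooo; exact: le_outer_measure.
have cG i : var.-caratheodory (G i) by exact: (radon_open rvar).
have om_le i : `|S (om i)| <= 2 * r i * fine (var (G i)).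
  apply: functional_le_sup => //; first exact: subset_trans OU.
  - by rewrite mulr_gt0.
  - have h : fun_spt (om i) `<=` fun_spt th `&` [set x | r i.+1 <= enorm (th x)].
      have cl : closed (fun_spt th `&` [set x | r i.+1 <= enorm (th x)]).
        apply: closedI; first exact: closed_closure.
        apply: (@preimage_closed _ _ (fun x => enorm (th x)) [set s | r i.+1 <= s]).
          by move=> x _; exact: cth'.
        exact: closed_ge.
      rewrite [X in _ `<=` X](closure_id _).1//; apply: closure_subset => x /= omx; split.
        apply: subset_closure => /=; apply: contraNN omx => /eqP h.
        by rewrite /om h scaler0.
      rewrite leNgt; apply/negP => h; move: omx; rewrite /om !tau0 ?subrr ?scale0r ?eqxx//.
        by rewrite rS (le_trans (ltW h))// ler_peMl ?ler1n// ltW.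
      exact: ltW.
    move=> x /h[xs xr]; split; first exact: KO.
    by rewrite /= (lt_le_trans _ xr)// (rS i.+1) ltr_pMl// ltr1n.
  - move=> x; rewrite /om enormZ.
    have [h|h] := leP (2 * r i) (enorm (th x)).
      have h' : 2 * r i.+1 <= enorm (th x).
        by rewrite -rS (le_trans _ h)// ler_peMl ?ler1n// ltW.
      by rewrite (tau1 _ _ h) (tau1 _ _ h') subrr normr0 mul0r mulr_ge0// ltW.
    rewrite -[leRHS]mul1r ler_pM ?enorm_ge0 ?(ltW h)//.
    have /andP[a0 a1] := tau01 i.+1 x; have /andP[b0 b1] := tau01 i x.
    by rewrite ler_norml; apply/andP; split; lra.
have layer_sum N : \sum_(0 <= i < N) 2 * r i * fine (var (G i)) <= 16 * I (fun x => enorm (th x)).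
  pose F i x := (2 * r i) * \1_(G i) x : R.
  have bF i : bfin var (F i) by apply: bfinZ; exact: indic_bfin.
  have -> : \sum_(0 <= i < N) 2 * r i * fine (var (G i)) = I (fun x => \sum_(0 <= i < N) F i x).
    rewrite Rint_sum//; apply: eq_bigr => i _; rewrite RintZ ?Rintegral_indicM//.
    exact: indic_bfin.
  rewrite -RintZ; last exact: (test_bfin rvar).
  apply: Rint_le; first exact: bfin_sum.
    by apply: bfinZ; exact: (test_bfin rvar).
  move=> x; have a0 : 0 <= 4 * enorm (th x) / M by rewrite divr_ge0 ?mulr_ge0 ?enorm_ge0 ?ltW.
  apply: (@le_trans _ _ (2 * M * \sum_(0 <= i < N) 2 ^- i * (2 ^- i < 4 * enorm (th x) / M)%R%:R)).
    rewrite mulr_sumr; apply: ler_sum => i _; rewrite /F /r mulrA -mulrA.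
    rewrite ler_wpM2l ?mulr_ge0 ?(ltW M0)// ler_wpM2l ?invr_ge0 ?exprn_ge0//.
    rewrite indicE; have [xG|//] := boolP (_ \in _).
    move/set_mem: xG => [_ /=]; rewrite /r !exprS => h.
    rewrite ltr_pdivlMr// (_ : _ < _ = true)//.
    rewrite -(ltr_pM2l (x := 4^-1)) ?invr_gt0//.
    by move: h; rewrite !invfM; set X := 2 ^- i; set Y := enorm _; lra.
  apply: (@le_trans _ _ (2 * M * (2 * (4 * enorm (th x) / M)))).
    by rewrite ler_wpM2l ?mulr_ge0 ?(ltW M0)// dyadic_sum_le.
  by rewrite le_eqVlt; apply/orP; left; apply/eqP; field; rewrite gt_eqF.
apply/ler_addgt0Pr => e e0.
have [N HN] : exists N : nat, 2 * r N * fine (var O) < e.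
  pose c := 2 * M * fine (var O) / e.
  exists (Num.trunc c).+1.
  have h : c < 2 ^+ (Num.trunc c).+1.
    apply: lt_trans (truncnS_gt c) _.
    by rewrite -natrX ltr_nat ltn_expl.
  rewrite /r [ltLHS](_ : _ = 2 * M * fine (var O) / 2 ^+ (Num.trunc c).+1); last by ring.
  by rewrite ltr_pdivrMr ?exprn_gt0// [ltRHS]mulrC -ltr_pdivrMr.
rewrite (Sdec N) (le_trans (ler_normD _ _))// lerD//.
  apply: le_trans (layer_sum N); apply: (le_trans (ler_norm_sum _ _ _)).
  by apply: ler_sum => i _; exact: om_le.
apply: le_trans (ltW HN); apply: functional_le_sup => //; first by rewrite mulr_gt0.
  by apply: subset_trans KO; apply: fun_spt_sub => x h; rewrite /rem h scaler0.
move=> x; rewrite /rem enormZ.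
have [h|h] := leP (2 * r N) (enorm (th x)).
  by rewrite tau1// subrr normr0 mul0r mulr_ge0// ltW.
rewrite -[leRHS]mul1r ler_pM ?enorm_ge0 ?(ltW h)//.
have /andP[b0 b1] := tau01 N x.
by rewrite ler_norml; apply/andP; split; lra.
Qed.

End functional_bound.

(** * Extension to integrable fields *)

Section indicator_approximation.
Context {R : realType} {n : nat}.
Variables (U : set 'rV[R]_n) (mu : {outer_measure set 'rV[R]_n -> \bar R}).
Hypotheses (oU : open U) (rmu : radon U mu).
Local Notation I := (Rintegral (cara_measure mu) setT).

Lemma excess_le A B (d : R) : mu.-caratheodory A -> A `<=` B -> (mu A < +oo)%E ->
  (mu B <= mu A + d%:E)%E -> (mu (B `\` A) <= d%:E)%E.
Proof.
move=> cA AB Aoo; rewrite (cA B) setIC (setIidl AB) -setDE.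
have fA : mu A \is a fin_num by rewrite ge0_fin_numE ?outer_measure_ge0.
by rewrite leeD2lE.
Qed.

(** Smooth functions approximate a measurable indicator in the mean, by Urysohn's lemma
    between a compact subset and an open neighbourhood. *)
Lemma indic_approx A th (e : R) : mu.-caratheodory A -> test_fun U th -> 0 < e ->
  exists psi : 'rV[R]_n -> R, [/\ smooth psi, forall x, 0 <= psi x <= 1 &
    I (fun x => enorm (patch (fun=> 0) A th x - psi x *: th x)) <= e].
Proof.
move=> cA t e0; have [sth cth thU] := t; have [M M0 HM] := test_fun_bounded t.
set K := fun_spt th in cth thU.
have cK : mu.-caratheodory K := compact_cara rmu cth.
have Koo : (mu K < +oo)%E := radon_compact rmu cth thU.
pose d := e / (2 * M); have d0 : 0 < d by rewrite divr_gt0// mulr_gt0.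
have cAK : mu.-caratheodory (A `&` K) by exact: caratheodory_measurable_setI.
have cKA : mu.-caratheodory (K `\` A) by exact: caratheodory_measurable_setD.
have AKoo : (mu (A `&` K) < +oo)%E.
  by apply: le_lt_trans Koo; apply: le_outer_measure => x [].
have KAoo : (mu (K `\` A) < +oo)%E.
  by apply: le_lt_trans Koo; apply: le_outer_measure => x [].
have [ O [oO AO Oe]] := radon_outer rmu d0 AKoo.
have [P [oP KP Pe]] := radon_outer rmu d0 KAoo.
have AO' : A `&` K `<=` O by move=> x [Ax Kx]; apply: AO; split => //; exact: thU.
have KP' : K `\` A `<=` P by move=> x [Kx Ax]; apply: KP; split => //; exact: thU.
have cK1 : compact (K `\` P).
  by rewrite setDE; apply: compact_closedI => //; exact: open_closedC.
have K1A : K `\` P `<=` A.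
  by move=> x [Kx nP]; apply: contrapT => nA; apply: nP; exact: KP'.
have K1O : K `\` P `<=` O by move=> x Kx; apply: AO'; split; [exact: K1A|case: Kx].
have [psi [spsi psi01 [N [oN KN N1]] cpsi psiO]] := smooth_urysohn cK1 oO K1O.
exists psi; split => //.
pose B := (O `\` (A `&` K)) `|` (P `\` (K `\` A)).
have cB : mu.-caratheodory B.
  by apply: caratheodory_measurable_setU; apply: caratheodory_measurable_setD => //;
    exact: (radon_open rmu).
have Be : (mu B <= (2 * d)%:E)%E.
  apply: (le_trans (outer_measureU2 _ _ _)).
  have -> : 2 * d = d + d by ring.
  by rewrite EFinD leeD//; exact: excess_le.
have Boo : (mu B < +oo)%E by rewrite (le_lt_trans Be)// ltry.
have fB : mu B \is a fin_num by rewrite ge0_fin_numE ?outer_measure_ge0.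
apply: (@le_trans _ _ (I (fun x => M * \1_B x))); last first.
  rewrite RintZ; last exact: indic_bfin.
  rewrite Rintegral_indicM// -ler_pdivlMl// -lee_fin fineK//.
  by apply: (le_trans Be); rewrite lee_fin /d le_eqVlt; apply/orP; left; apply/eqP; field; rewrite gt_eqF.
have tpsi := test_fun_mul spsi t.
apply: le_Rintegral => //.
- by apply: L1B_integrable; [exact: (patch_L1 rmu cA t)|exact: (test_L1 rmu)].
- by apply: bfin_integrable; [exact: caratheodory_setT|apply: bfinZ; exact: indic_bfin].
move=> x _; have /andP[p0 p1] := psi01 x.
have [Kx|nKx] := pselect (K x); last first.
  have thx : th x = 0 by exact: fun_spt0.
  rewrite /patch thx scaler0 subr0; case: ifP => _; rewrite enorm0 mulr_ge0 ?(ltW M0)//;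
    by rewrite indicE.
have le1 (a : R) : 0 <= a <= 1 -> enorm (a *: th x) <= M.
  move=> /andP[a0 a1]; rewrite enormZ ger0_norm//.
  by rewrite (le_trans _ (HM x))// ler_piMl ?enorm_ge0.
rewrite /patch; have [/set_mem xA|/negP xA] := boolP (x \in A).
  have [xP|xP] := pselect (P x).
    rewrite indicE mem_set; last by right; split => // -[].
    rewrite mulr1 -{1}(scale1r (th x)) -scalerBl; apply: le1.
    by rewrite subr_ge0 p1 gerBl.
  rewrite N1; last by apply: KN; split.
  by rewrite scale1r subrr enorm0 mulr_ge0 ?(ltW M0)// indicE.
rewrite sub0r enormN.
have [->|p_neq0] := eqVneq (psi x) 0.
  by rewrite scale0r enorm0 mulr_ge0 ?(ltW M0)// indicE.
rewrite indicE mem_set ?mulr1; first by apply: le1; rewrite p0.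
left; split; first by apply: psiO; exact: subset_closure.
by move=> [Ax _]; apply: xA; rewrite mem_set.
Qed.

End indicator_approximation.

Section extension.
Context {R : realType} {n : nat}.
Variables (U : set 'rV[R]_n) (S : ('rV[R]_n -> 'rV[R]_n) -> R).
Hypothesis oU : open U.
Hypothesis SD : forall th th', test_fun U th -> test_fun U th' ->
  S (fun x => th x + th' x) = S th + S th'.
Hypothesis SZ : forall a th, test_fun U th -> S (fun x => a *: th x) = a * S th.
Local Notation var := (Defs.variation U S).
Hypothesis rvar : radon U var.
Local Notation I f := (Rintegral (cara_measure var) setT (fun x => enorm (f x))).
Local Notation T := (L1_extension U S).

Let SB th th' : test_fun U th -> test_fun U th' ->
  S (fun x => th x - th' x) = S th - S th'.
Proof.
move=> t t'; have <- : S (fun x => th x + -1 *: th' x) = S th - S th'.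
  by rewrite SD ?SZ ?mulN1r//; exact: test_fun_scale.
by congr S; apply/funext => x; rewrite scaleN1r.
Qed.

Definition mcshane (f : 'rV[R]_n -> 'rV[R]_n) : R :=
  inf [set S th + 16 * I (fun x => f x - th x) | th in test_fun U].

(** The functional is Lipschitz for the integral seminorm on test fields, and
    McShane's formula extends it to a Lipschitz function. *)
Lemma mcshane_extension : is_L1_extension U S mcshane.
Proof.
have I0 f : (forall x, f x = 0 :> 'rV[R]_n) -> I f = 0.
  move=> f0; rewrite /Rintegral (eq_integral (cst 0%E)) ?integral0//.
  by move=> x _; rewrite f0 enorm0.
have tL1 th : test_fun U th -> L1 var th by exact: test_L1.
have lbS f th : L1 var f -> test_fun U th ->
    - (16 * I (fun x => f x - 0)) <= S th + 16 * I (fun x => f x - th x).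
  move=> Lf t; have t0 := test_fun0 U.
  have := functional_le_integral oU SD SZ rvar t => /ler_normlP[h _].
  have := enormI_le (tL1 _ t) Lf (tL1 _ t0).
  have -> : I (fun x => th x - cst 0 x) = I th by apply: eq_Rintegral => x _; rewrite subr0.
  have -> : I (fun x => th x - f x) = I (fun x => f x - th x).
    by apply: eq_Rintegral => x _; rewrite enormB.
  have aux (s a b c : R) : a <= b + c -> - s <= 16 * a -> - (16 * c) <= s + 16 * b by lra.
  by move/aux; apply.
have hlb f : L1 var f -> has_lbound [set S th + 16 * I (fun x => f x - th x) | th in test_fun U].
  move=> Lf; exists (- (16 * I (fun x => f x - 0))) => _ [th t <-]; exact: lbS.
have le_mc f th : L1 var f -> test_fun U th -> mcshane f <= S th + 16 * I (fun x => f x - th x).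
  by move=> Lf t; apply: ge_inf; [exact: hlb|exists th].
have mc_le f a : (forall th, test_fun U th -> a <= S th + 16 * I (fun x => f x - th x)) ->
    a <= mcshane f.
  move=> H; apply: lb_le_inf; last by move=> _ [th t <-]; exact: H.
  by exists (S (cst 0) + 16 * I (fun x => f x - cst 0 x)); exists (cst 0) => //; exact: test_fun0.
have lip f g : L1 var f -> L1 var g -> mcshane g <= mcshane f + 16 * I (fun x => f x - g x).
  move=> Lf Lg; rewrite -lerBlDr; apply: mc_le => th t.
  have := le_mc _ _ Lg t; have := enormI_le Lg Lf (tL1 _ t).
  have -> : I (fun x => g x - f x) = I (fun x => f x - g x).
    by apply: eq_Rintegral => x _; rewrite enormB.
  have aux (k s a b c : R) : a <= b + c -> k <= s + 16 * a -> k - 16 * b <= s + 16 * c by lra.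
  by move/aux; apply.
split.
  move=> th t; apply/eqP; rewrite eq_le; apply/andP; split.
    have := le_mc _ _ (tL1 _ t) t; rewrite I0 ?mulr0 ?addr0// => x; exact: subrr.
  apply: mc_le => th' t'; rewrite -lerBlDl -SB//.
  have tm : test_fun U (fun x => th x - th' x).
    by apply: test_fun_add => //; exact: test_fun_opp.
  by apply: le_trans (functional_le_integral oU SD SZ rvar tm); exact: ler_norm.
move=> f Lf e e0; exists (e / 16); first by rewrite divr_gt0.
move=> g Lg h.
have h' : 16 * I (fun x => f x - g x) < e.
  rewrite -ltr_pdivlMl// mulrC -lte_fin /Rintegral fineK//.
  have /integrableP[_ fin] := L1B_integrable Lf Lg.
  by apply: integrable_fin_num => //; exact: L1B_integrable.
apply: le_lt_trans h'; rewrite ler_norml; apply/andP; split.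
  by rewrite lerNl opprB lerBlDl; exact: lip.
have := lip _ _ Lg Lf; have -> : I (fun x => g x - f x) = I (fun x => f x - g x).
  by apply: eq_Rintegral => x _; rewrite enormB.
by rewrite lerBlDl.
Qed.

Lemma L1_extensionP : is_L1_extension U S T.
Proof. exact: (xgetPex _ (ex_intro _ _ mcshane_extension)). Qed.

Lemma ext_test th : test_fun U th -> T th = S th.
Proof. by have [H _] := L1_extensionP; exact: H. Qed.

Lemma ext_continuous f : L1 var f -> forall e : R, 0 < e -> exists2 d : R, 0 < d &
  forall g, L1 var g -> I (fun x => f x - g x) < d -> `|T f - T g| < e.
Proof.
move=> Lf e e0; have [_ /(_ f Lf e e0)[d d0 H]] := L1_extensionP.
exists d => // g Lg h; apply: H => //.
rewrite -lte_fin /Rintegral fineK in h => //.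
by apply: integrable_fin_num => //; exact: L1B_integrable.
Qed.

Lemma ext_null f g : L1 var f -> L1 var g -> I (fun x => f x - g x) = 0 -> T f = T g.
Proof.
move=> Lf Lg h; apply/eqP; rewrite -subr_eq0 -normr_eq0.
rewrite eq_le normr_ge0 andbT; apply/ler_addgt0Pr => e e0; rewrite add0r.
have [d d0 H] := ext_continuous Lf e0.
by apply/ltW/H => //; rewrite h.
Qed.

(** The extension at a restricted test field is a limit of values of the
    functional at smooth truncations of that field. *)
Lemma ext_patch_approx A th (e : R) : var.-caratheodory A -> test_fun U th -> 0 < e ->
  exists psi : 'rV[R]_n -> R, [/\ smooth psi, forall x, 0 <= psi x <= 1,
    I (fun x => patch (fun=> 0) A th x - psi x *: th x) <= e &
    `|T (patch (fun=> 0) A th) - S (fun x => psi x *: th x)| < e].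
Proof.
move=> cA t e0; have LA := patch_L1 rvar cA t.
have [d d0 H] := ext_continuous LA e0.
have d1 : 0 < Num.min (d / 2) e by rewrite lt_min divr_gt0.
have [psi [sp p01 pe]] := indic_approx rvar cA t d1.
have tpsi := test_fun_mul sp t.
exists psi; split => //; first by rewrite (le_trans pe)// ge_min lexx orbT.
rewrite -ext_test//; apply: H; first exact: (test_L1 rvar).
rewrite (le_lt_trans pe)// gt_min ltr_pdivrMr// mulr_natr mulr2n ltrDl d0.
by [].
Qed.

Lemma ext_patch_le A th : var.-caratheodory A -> test_fun U th ->
  `|T (patch (fun=> 0) A th)| <= 16 * I (patch (fun=> 0) A th).
Proof.
have aux (e a b c i j k : R) : a <= b + c -> b < e / 17 -> c <= 16 * i -> i <= k + j ->
    k <= e / 17 -> a <= 16 * j + e by lra.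
move=> cA t; have LA := patch_L1 rvar cA t.
apply/ler_addgt0Pr => e e0; have e1 : 0 < e / 17 by rewrite divr_gt0.
have [psi [sp p01 pe Te]] := ext_patch_approx cA t e1.
have tpsi := test_fun_mul sp t.
have h1 := functional_le_integral oU SD SZ rvar tpsi.
have L0 := test_L1 rvar (test_fun0 U).
have h2 := enormI_le (test_L1 rvar tpsi) LA L0.
have E1 : I (fun x => psi x *: th x - cst 0 x) = I (fun x => psi x *: th x).
  by apply: eq_Rintegral => x _; rewrite subr0.
have E2 : I (fun x => patch (fun=> 0) A th x - cst 0 x) = I (patch (fun=> 0) A th).
  by apply: eq_Rintegral => x _; rewrite subr0.
have E3 : I (fun x => psi x *: th x - patch (fun=> 0) A th x) =
    I (fun x => patch (fun=> 0) A th x - psi x *: th x).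
  by apply: eq_Rintegral => x _; rewrite enormB.
rewrite E1 E2 E3 in h2.
have h3 : `|T (patch (fun=> 0) A th)| <= `|T (patch (fun=> 0) A th) - S (fun x => psi x *: th x)|
   + `|S (fun x => psi x *: th x)|.
  by rewrite (le_trans _ (ler_normD _ _))// subrK.
exact: aux h3 Te h1 h2 pe.
Qed.

End extension.

(** * Parts without boundary *)

Section null_differences.
Context {R : realType} {T : pointedType}.
Variable mu : {outer_measure set T -> \bar R}.

Lemma Rintegral_ae (f g : T -> R) N : cmeas mu f -> cmeas mu g -> mu N = 0%E ->
  (forall x, ~ N x -> f x = g x) ->
  Rintegral (cara_measure mu) setT f = Rintegral (cara_measure mu) setT g.
Proof.
move=> mf mg N0 H; congr fine; apply: ae_eq_integral => //.
- exact/measurable_EFinP.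
- exact/measurable_EFinP.
exists N; split => //; first exact: null_caratheodory.
by move=> x /= nx; apply: contrapT => Nx; apply: nx => _; rewrite H.
Qed.

Lemma cmeas_indicM A (f : T -> R) : mu.-caratheodory A -> cmeas mu f ->
  cmeas mu (fun x => \1_A x * f x).
Proof.
move=> cA mf; apply: (@measurable_funM _ (caratheodory_type mu)) => //.
Qed.

Lemma Rintegral_indic_mul A (f : T -> R) :
  Rintegral (cara_measure mu) A f = Rintegral (cara_measure mu) setT (fun x => \1_A x * f x).
Proof.
rewrite Rintegral_mkcond; congr Rintegral; apply/funext => x.
by rewrite patchE indicE; case: (x \in A); rewrite ?mul1r ?mul0r.
Qed.

End null_differences.

Section no_boundary_facts.
Context {R : realType} {n : nat} (m : nat).
Variable U : set 'rV[R]_n.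
Variable V : {outer_measure set ('rV[R]_n * 'M[R]_n)%type -> \bar R}.
Local Notation G := (@Grass R n m).
Hypotheses (oU : open U) (vV : varifold U m V).
Local Notation var := (var_measure U V).
Local Notation wt := (weight m V).
Hypothesis rvar : radon U var.
Local Notation I f := (Rintegral (cara_measure var) setT (fun x => enorm (f x))).
Local Notation T := (L1_extension U (first_var V)).

Let rwt : radon U wt := radon_weight oU vV.
Let SD := first_varD oU vV.
Let SZ := first_varZ oU vV.

Lemma vmeasurable_cara E : vmeasurable U m V E -> wt.-caratheodory E /\ var.-caratheodory E.
Proof.
move=> [EU cE]; have [K [KP UK]] := compact_exhaustion oU.
have wK k : (wt (K k) < +oo)%E by have [cK KU] := KP k; exact: (radon_compact rwt).
have vK k : (var (K k) < +oo)%E by have [cK KU] := KP k; exact: (radon_compact rvar).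
split.
  apply: (caratheodory_addl (radon_null rwt) UK _ wK vK cE) => k.
  by have [cK _] := KP k; exact: (compact_cara rwt).
apply: (caratheodory_addl (radon_null rvar) UK _ vK wK) => [k|X].
  by have [cK _] := KP k; exact: (compact_cara rvar).
by have := cE X; rewrite /= [LHS]addeC => ->; congr (_ + _)%E; exact: addeC.
Qed.

Lemma vboundaryE E th : wt.-caratheodory E -> test_fun U th ->
  vboundary U m V E th = T (patch (fun=> 0) E th) -
    Rintegral (cara_measure V) (E `*` G) (tangential_div th).
Proof. by move=> cE t; rewrite /vboundary (first_var_vrestr oU vV). Qed.

(** Absence of boundary means that the first variation of the part is the extended
    first variation of the varifold at the restricted field. *)
Lemma no_boundary_le E th : wt.-caratheodory E -> var.-caratheodory E ->
  no_boundary U m V E -> test_fun U th ->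
  `|Rintegral (cara_measure V) (E `*` G) (tangential_div th)| <=
  16 * I (patch (fun=> 0) E th).
Proof.
move=> cE cvE nE t; have := nE th t; rewrite vboundaryE// => /subr0_eq <-.
exact: (ext_patch_le oU SD SZ rvar).
Qed.

Lemma Rintegral_cyl_null E E' th : wt.-caratheodory E -> wt.-caratheodory E' ->
  wt (E `\` E') = 0%E -> wt (E' `\` E) = 0%E -> test_fun U th ->
  Rintegral (cara_measure V) (E `*` G) (tangential_div th) =
  Rintegral (cara_measure V) (E' `*` G) (tangential_div th).
Proof.
move=> cE cE' N1 N2 t; have [mt _] := tangential_div_bfin oU vV t.
have cEG := cyl_grass_cara oU vV cE; have cEG' := cyl_grass_cara oU vV cE'.
rewrite [LHS]Rintegral_indic_mul [RHS]Rintegral_indic_mul.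
apply: (@Rintegral_ae _ _ _ _ _ (fst @^-1` ((E `\` E') `|` (E' `\` E)))).
- exact: cmeas_indicM.
- exact: cmeas_indicM.
- by rewrite -(weight_cyl vV) outer_measureU0.
move=> [x P] /= /not_orP[h1 h2]; congr (_ * _); rewrite !indicE; congr (_%:R).
congr nat_of_bool; apply/idP/idP => /set_mem[/= Ex GP]; apply/mem_set; split => //=;
  by apply: contrapT => nx; solve [by apply: h1|by apply: h2].
Qed.

(** For a smooth [psi] close to the indicator of [E'], the restrictions of [psi *: th] to
    [E] and to [E'] have the same first variation, and are close to the restrictions of
    [th] to [E `&` E'] and to [E']. *)
Lemma no_boundaryI E E' : wt.-caratheodory E -> wt.-caratheodory E' ->
  var.-caratheodory E -> var.-caratheodory E' ->
  wt (E `\` E') = 0%E -> wt (E' `\` E) = 0%E ->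
  no_boundary U m V E -> no_boundary U m V E' -> no_boundary U m V (E `&` E').
Proof.
move=> cE cE' vE vE' N1 N2 nE nE' th t.
have cEE : wt.-caratheodory (E `&` E') by exact: caratheodory_measurable_setI.
have vEE : var.-caratheodory (E `&` E') by exact: caratheodory_measurable_setI.
rewrite vboundaryE// (@Rintegral_cyl_null _ E' th)//; last 2 first.
- by rewrite (_ : _ `\` _ = set0) ?outer_measure0//; apply/seteqP; split => // x [[]].
- by apply: (outer_measure_null_sub _ N2) => x [E'x nx]; split => // Ex; apply: nx.
have := nE' th t; rewrite vboundaryE// => /subr0_eq <-; apply/eqP; rewrite subr_eq0.
rewrite -subr_eq0 -normr_eq0 eq_le normr_ge0 andbT; apply/ler_addgt0Pr => e e0.
rewrite add0r.
have L1p A ph : var.-caratheodory A -> test_fun U ph -> L1 var (patch (fun=> 0) A ph).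
  by move=> cA tp; exact: (patch_L1 rvar cA tp).
have e2 : 0 < e / 2 by rewrite divr_gt0.
have [d1 d10 H1] := ext_continuous oU SD SZ rvar (L1p _ _ vEE t) e2.
have [d2 d20 H2] := ext_continuous oU SD SZ rvar (L1p _ _ vE' t) e2.
have d0 : 0 < Num.min d1 d2 / 2 by rewrite divr_gt0// lt_min d10.
have dlt : Num.min d1 d2 / 2 < Num.min d1 d2.
  by rewrite ltr_pdivrMr// mulr_natr mulr2n ltrDl lt_min d10.
have [psi [sp p01 pe]] := indic_approx rvar vE' t d0.
have tp := test_fun_mul sp t; set ps := fun x => _ in tp.
have key : T (patch (fun=> 0) E ps) = T (patch (fun=> 0) E' ps).
  have := nE ps tp; rewrite vboundaryE// => /subr0_eq ->.
  have := nE' ps tp; rewrite vboundaryE// => /subr0_eq ->.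
  exact: Rintegral_cyl_null.
have cmp A : var.-caratheodory A ->
    I (fun x => patch (fun=> 0) (A `&` E') th x - patch (fun=> 0) A ps x) <= Num.min d1 d2 / 2.
  move=> cA; apply: le_trans pe; apply: le_Rintegral => //.
  - by apply: L1B_integrable; apply: L1p => //; exact: caratheodory_measurable_setI.
  - by apply: L1B_integrable; [exact: L1p|exact: (test_L1 rvar)].
  move=> x _; rewrite /patch in_setI; case: (x \in A) => //=.
  by rewrite subr0 enorm0 enorm_ge0.
have h1 := H1 _ (L1p _ _ vE tp) _.
have h2 := H2 _ (L1p _ _ vE' tp) _.
have {}h1 : `|T (patch (fun=> 0) (E `&` E') th) - T (patch (fun=> 0) E ps)| < e / 2.
  apply: h1; apply: (le_lt_trans (cmp _ vE)); apply: (lt_le_trans dlt).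
  by rewrite ge_min lexx.
have {}h2 : `|T (patch (fun=> 0) E' th) - T (patch (fun=> 0) E' ps)| < e / 2.
  apply: h2; have := cmp _ vE'; rewrite setIid => h; apply: (le_lt_trans h).
  by apply: (lt_le_trans dlt); rewrite ge_min lexx orbT.
rewrite key in h1.
set a := T _ in h1 h2 *; set b := T _ in h2 *; set c := T _ in h1 h2.
rewrite (_ : a - b = (a - c) - (b - c)); last by ring.
by rewrite (le_trans (ler_normB _ _))// (splitr e) ltW// ltrD.
Qed.

Definition clopen_in (S E : set 'rV[R]_n) := relopen S E /\ relopen S (S `\` E).

Local Notation Sp := (spt U wt).

Lemma open_off_spt : open (U `\` Sp).
Proof.
rewrite openE => x [Ux nS]; rewrite /interior.
have [ O [oO Ox O0]] : exists O, [/\ open O, O x & wt O = 0%E].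
  apply: contrapT => H; apply: nS; apply/(sptP rwt); split => // O.
  rewrite nbhsE => -[P [oP Px] PO] O0; apply: H; exists P; split => //.
  exact: outer_measure_null_sub O0.
have oUO : open (U `&` O) by exact: openI.
apply: filterS (open_nbhs_nbhs (conj oUO (conj Ux Ox))) => y [Uy Oy]; split => //.
move=> /(sptP rwt)[_ H]; apply: (H O) => //; exact: open_nbhs_nbhs.
Qed.

Lemma spt_cara (mu : {outer_measure set 'rV[R]_n -> \bar R}) : radon U mu ->
  mu.-caratheodory Sp.
Proof.
move=> rmu; have -> : Sp = U `\` (U `\` Sp).
  by rewrite setDD; apply/seteqP; split=> x; [move=> h; split => //; case: h|case].
apply: caratheodory_measurable_setD; first exact: (radon_open rmu).
exact: (radon_open rmu open_off_spt).
Qed.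

Lemma clopen_cara (mu : {outer_measure set 'rV[R]_n -> \bar R}) E : radon U mu ->
  clopen_in Sp E -> mu.-caratheodory E.
Proof.
move=> rmu [[ O oO ->] _]; apply: caratheodory_measurable_setI; first exact: spt_cara.
exact: (radon_open rmu).
Qed.

(** Test fields supported off the support of the weight have zero first variation. *)
Lemma var_off_spt : var (~` Sp) = 0%E.
Proof.
have -> : ~` Sp = (U `\` Sp) `|` ~` U.
  apply/seteqP; split=> x; last by move=> [[]//|nU /spt_sub].
  by move=> nS; have [|] := pselect (U x); [left|right].
rewrite outer_measureU0 ?(radon_null rvar)//.
rewrite (variation_open oU SD SZ open_off_spt); last by move=> x [].
apply/eqP; rewrite eq_le; apply/andP; split; last exact: (var_open_ge0 SZ).
apply: ge_ereal_sup => _ [th [t s _] <-]; rewrite lee_fin le_eqVlt; apply/orP; left; apply/eqP.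
have [sth cth thU] := t; have [mt _] := tangential_div_bfin oU vV t.
rewrite first_varE (@Rintegral_ae _ _ _ _ (cst 0) (fst @^-1` (~` Sp))) ?Rintegral_cst ?mul0r//.
- exact: (@measurable_cst _ _ (caratheodory_type V)).
- by rewrite -(weight_cyl vV) (spt_complement_null rwt).
move=> [x P] /= /contrapT Sx; apply: tangential_div_off_spt => //= xs.
by have [_] := s _ xs.
Qed.

(** On the support of a given test field, a relatively clopen piece is cut out by a smooth
    function [psi] which is locally constant on the support of the weight: no boundary
    is created. *)
Lemma clopen_no_boundary E : clopen_in Sp E -> no_boundary U m V E.
Proof.
move=> cE th t; have cwE := clopen_cara rwt cE; have cvE := clopen_cara rvar cE.
rewrite vboundaryE//; apply/eqP; rewrite subr_eq0; apply/eqP.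
have [sth cth thU] := t.
have [[Oa oO1 E1] [Ob oO2 E2]] := cE.
have ES : E `<=` Sp by rewrite E1 => x [].
set K := fun_spt th in cth thU.
have cKO A O : open O -> A = Sp `&` ~` O -> compact (K `&` A).
  move=> oO ->; rewrite (_ : K `&` _ = K `&` (~` (U `\` Sp) `&` ~` O)).
    apply: compact_closedI => //; apply: closedI; apply: open_closedC => //.
    exact: open_off_spt.
  apply/seteqP; split=> x [Kx [Sx nO]]; split => //; split => //; first by case.
  by apply: contrapT => nS; apply: Sx; split => //; exact: thU.
have cKE : compact (K `&` E).
  apply: (cKO _ Ob) => //; rewrite E1; apply/seteqP; split=> x [Sx Ox]; split => //.
    move=> O2x; have : (Sp `\` E) x by rewrite E2.
    by move=> [_]; apply; rewrite E1.
  by apply: contrapT => nO1; apply: Ox; have : (Sp `\` E) x; [split => //; rewrite E1 => -[]|rewrite E2 => -[]].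
have cKD : compact (K `&` (Sp `\` E)).
  apply: (cKO _ Oa) => //; apply/seteqP; split=> x [Sx nE]; split => //.
    by move=> O1x; apply: nE; rewrite E1.
  by rewrite E1 => -[].
have oW : open (~` (K `&` (Sp `\` E))).
  by apply: closed_openC; exact: (compact_closed (@norm_hausdorff _ _) cKD).
have KW : K `&` E `<=` ~` (K `&` (Sp `\` E)) by move=> x [Kx Ex] [_ [_ nEx]]; exact: nEx.
have [psi [sp p01 [N [oN KN N1]] cpsi psiW]] := smooth_urysohn cKE oW KW.
have tp := test_fun_mul sp t; set ps := fun x => _ in tp.
have psi0 x : K x -> Sp x -> ~ E x -> ~ closure [set z | psi z != 0] x.
  by move=> Kx Sx nEx /psiW; apply.
have eqx x : Sp x -> patch (fun=> 0) E th x = ps x.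
  move=> Sx; rewrite /patch /ps.
  have [Kx|nKx] := pselect (K x); last first.
    by rewrite (fun_spt0 nKx) scaler0; case: ifP.
  have [/set_mem Ex|/negP nEx] := boolP (x \in E).
    by rewrite N1 ?scale1r//; exact: KN.
  rewrite (_ : psi x = 0) ?scale0r//; apply/eqP; apply: contrapT => /negP h.
  apply: (psi0 x) => //; first by move=> Ex; apply: nEx; rewrite mem_set.
  exact: subset_closure.
have Lp : L1 var ps by exact: (test_L1 rvar).
have LE : L1 var (patch (fun=> 0) E th) by exact: (patch_L1 rvar cvE t).
rewrite (ext_null oU SD SZ rvar LE Lp); last first.
  rewrite (@Rintegral_ae _ _ _ _ (cst 0) (~` Sp)) ?Rintegral_cst ?mul0r//.
  - by apply: cmeas_enormB; [case: LE|case: Lp].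
  - exact: (@measurable_cst _ _ (caratheodory_type var)).
  - exact: var_off_spt.
  by move=> x /contrapT Sx; rewrite eqx// subrr enorm0.
rewrite (ext_test oU SD SZ rvar tp).
rewrite (first_varE _ _).
rewrite [RHS]Rintegral_indic_mul.
have [mt _] := tangential_div_bfin oU vV t.
have [mp _] := tangential_div_bfin oU vV tp.
have cEG := cyl_grass_cara oU vV cwE.
apply: (@Rintegral_ae _ _ _ _ _ (fst @^-1` (~` Sp) `|` ~` (U `*` G))) => //.
- exact: cmeas_indicM.
- by rewrite outer_measureU0 ?(varifold_null vV)// -(weight_cyl vV) (spt_complement_null rwt).
move=> [x P] /= /not_orP[/contrapT Sx /contrapT[Ux GP]].
have [sps _ _] := tp.
have [Kx|nKx] := pselect (K x); last first.
  rewrite !tangential_div_off_spt ?mulr0//= => h; apply: nKx.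
  by apply: (fun_spt_sub _ h) => y hy; rewrite /ps hy scaler0.
rewrite indicE; have [Ex|nEx] := pselect (E x).
  rewrite mem_set// mul1r; apply: tangential_div_local => //=.
  apply: filterS (open_nbhs_nbhs (conj oN (KN _ (conj Kx Ex)))) => y Ny.
  by rewrite /ps N1// scale1r.
rewrite memNset ?mul0r; last by move=> [].
apply: tangential_div_off_spt => //= h; apply: (psi0 x) => //.
by move: h; apply: closure_subset => y /=; apply: contraNN => /eqP hy; rewrite /ps hy scale0r.
Qed.

End no_boundary_facts.

(** * Good scales and coverings *)

Section discrete_calculus.
Context {R : realType}.

Lemma exists_argmax (J : nat) (a : nat -> R) : (0 < J)%N ->
  exists2 i, (i < J)%N & forall k, (k < J)%N -> a k <= a i.
Proof.
elim: J => // -[_ _|J /(_ isT)[i iJ H] _].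
  by exists 0%N => // -[|].
have [h|h] := leP (a J.+1) (a i).
  exists i; first exact: ltnW.
  by move=> k; rewrite ltnS leq_eqVlt => /predU1P[->//|]; exact: H.
exists J.+1 => // k; rewrite ltnS leq_eqVlt => /predU1P[->//|kJ].
exact: le_trans (H _ kJ) (ltW h).
Qed.

Lemma geometric_sum_le i J : \sum_(i <= j < J.+1) 2 ^+ j <= 2 * 2 ^+ J :> R.
Proof.
suff H k : \sum_(0 <= j < k) 2 ^+ j <= 2 ^+ k :> R.
  rewrite -exprS; apply: le_trans (H _).
  have [iJ|iJ] := leqP i J.+1; last by rewrite big_geq ?(ltnW iJ)// sumr_ge0// => *; rewrite exprn_ge0.
  by rewrite [leRHS](@big_cat_nat _ _ _ i)//= lerDr sumr_ge0// => *; rewrite exprn_ge0.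
elim: k => [|k IH]; first by rewrite big_geq// expr0.
by rewrite big_nat_recr//= exprS mulr_natl mulr2n lerD.
Qed.

(** A discrete form of the calculus lemma behind the isoperimetric inequality:
    if the density ratio is bounded below at the smallest scale and tiny at the
    largest one, then at some scale the mass of a fourfold ball is controlled by
    the boundary and curvature terms [N] of the ball. *)
Lemma good_scale p (sg c0 c1 C1 delta : R) (J : nat) (F N : nat -> R) :
  0 < sg -> 0 < c0 -> 0 < c1 -> 0 <= C1 -> 0 <= delta -> (0 < J)%N ->
  let s j := 2 ^+ j * sg in
  (forall j, F j <= delta * s J ^+ p.+1) ->
  c0 * sg ^+ p.+1 <= F 0%N -> delta <= c0 -> 4 * C1 * delta <= c1 * c0 ->
  (forall i, (i < J)%N -> c1 * s i ^- p.+1 * F i - C1 * s J ^- p.+1 * F J <=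
     \sum_(i <= j < J.+1) s j ^- p * N j) ->
  exists2 j, (j <= J)%N & F j.+2 <= 4 * 4 ^+ p.+1 / c1 * s J * N j.
Proof.
move=> sg0 c00 c10 C10 d0 J0 s Fle F0 dc0 dc1 mono; apply: contrapT => H.
have s0 j : 0 < s j by rewrite mulr_gt0 ?exprn_gt0.
have sm0 j q : 0 < s j ^- q by rewrite invr_gt0 exprn_gt0.
have s2 j : s j.+2 = 4 * s j by rewrite /s !exprS; ring.
set C' := 4 * 4 ^+ p.+1 / c1 in H.
have C'0 : 0 < C' by rewrite divr_gt0// mulr_gt0// exprn_gt0.
have HN j : (j <= J)%N -> C' * s J * N j < F j.+2.
  by move=> jJ; rewrite ltNge; apply/negP => h; apply: H; exists j.
have [i iJ imax] := exists_argmax (fun k => s k ^- p.+1 * F k) J0.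
set M := s i ^- p.+1 * F i in imax.
have M0 : c0 <= M.
  apply: le_trans (imax 0%N J0); rewrite -ler_pdivrMl// invrK mulrC.
  by rewrite /s expr0 mul1r.
have Mp : 0 < M by exact: lt_le_trans M0.
have F2 j : (j <= J)%N -> F j.+2 <= M * (4 * s j) ^+ p.+1.
  move=> jJ; rewrite -s2; have [h|h] := ltnP j.+2 J.
    by rewrite mulrC -ler_pdivrMl ?exprn_gt0//; exact: imax.
  apply: (le_trans (Fle _)); apply: ler_pM => //.
  - by rewrite exprn_ge0// ltW.
  - exact: le_trans M0.
  - rewrite lerXn2r ?nnegrE ?(ltW (s0 _))// ler_pM2r// ler_eXn2l// ltr1n.
    done.
have Nle j : (j <= J)%N -> s j ^- p * N j <= 4 ^+ p.+1 * M / (C' * s J) * s j.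
  move=> jJ.
  have h : C' * s J * N j <= M * (4 * s j) ^+ p.+1 by apply: le_trans (F2 _ jJ); exact/ltW/HN.
  rewrite -ler_pdivlMl in h; last exact: mulr_gt0.
  apply: (le_trans (ler_wpM2l (ltW (sm0 j p)) h)).
  rewrite le_eqVlt; apply/orP; left; apply/eqP; rewrite [(4 * s j) ^+ _]exprMn [s j ^+ p.+1]exprS.
  set X := s j ^+ p; set Y := 4 ^+ p.+1; field.
  by rewrite /X expf_neq0 !gt_eqF.
have := mono i iJ; rewrite -!mulrA -/M.
have FJ : s J ^- p.+1 * F J <= delta by rewrite ler_pdivrMl ?exprn_gt0// mulrC.
have S1 : \sum_(i <= j < J.+1) s j ^- p * N j <= 4 ^+ p.+1 * M / (C' * s J) * (2 * s J).
  apply: (@le_trans _ _ (\sum_(i <= j < J.+1) 4 ^+ p.+1 * M / (C' * s J) * s j)).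
    rewrite [leLHS]big_nat_cond [leRHS]big_nat_cond; apply: ler_sum => k /andP[/andP[_ kJ] _].
    exact: Nle.
  rewrite -mulr_sumr ler_wpM2l//.
    by apply: divr_ge0; [apply: mulr_ge0; [exact: exprn_ge0|exact: ltW]|apply: mulr_ge0; exact: ltW].
  by rewrite -mulr_suml mulrA ler_wpM2r ?(ltW sg0)// geometric_sum_le.
have S2 : 4 ^+ p.+1 * M / (C' * s J) * (2 * s J) = c1 * M / 2.
  rewrite /C'; set Y := 4 ^+ p.+1; have Y0 : Y != 0 by rewrite expf_neq0.
  by field; rewrite Y0 !gt_eqF.
have h1 : C1 * (s J ^- p.+1 * F J) <= C1 * delta by rewrite ler_wpM2l.
have h2 : c1 * c0 <= c1 * M by rewrite ler_wpM2l// ltW.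
have h3 : 0 < c1 * M by rewrite mulr_gt0.
by rewrite S2 in S1; move=> h4; lra.
Qed.

End discrete_calculus.

Section vitali.
Context {R : realType} {n : nat}.
Local Notation ballpair := ('rV[R]_n * R)%type.
Implicit Types (b c : ballpair) (L : seq ballpair).

Definition Bl b := eball b.1 b.2.

Fixpoint disjoint_balls L : Prop :=
  if L is b :: L' then (forall c, c \in L' -> Bl b `&` Bl c = set0) /\ disjoint_balls L'
  else True.

(** Greedy choice of a ball of largest radius. The factor [4], in place of the usual
    [3], is the one that the dyadic scales can use: [4 * s j = s j.+2]. *)
Lemma vitali_finite L : (forall b, b \in L -> 0 < b.2) -> exists L',
  [/\ {subset L' <= L}, disjoint_balls L' &
    forall b, b \in L -> exists2 c, c \in L' & Bl b `<=` eball c.1 (4 * c.2)].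
Proof.
have [k] := ubnP (size L); elim: k L => // k IH [|b0 L0] sz pos.
  by exists [::].
pose L := b0 :: L0.
have [b bL bmax] : exists2 b, b \in L & forall c, c \in L -> c.2 <= b.2.
  have [i iJ H] := exists_argmax (fun k => (nth b0 L k).2) (ltn0Sn (size L0)).
  exists (nth b0 L i); first exact: mem_nth.
  by move=> c /(nthP b0)[j jL <-]; exact: H.
pose P c := `[< Bl b `&` Bl c = set0 >].
have bP : ~~ P b.
  apply/negP => /asboolP; rewrite setIid => h.
  have : Bl b b.1 by rewrite /Bl /eball /= subrr enorm0 ltW// pos.
  by rewrite h.
have szP : (size (seq.filter P L) < k)%N.
  have szL : (size L <= k)%N by rewrite -ltnS.
  rewrite size_filter; apply: (leq_trans _ szL); rewrite -(count_predC P L) -[X in (X <= _)%N]addn1.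
  by rewrite leq_add2l -has_count; apply/hasP; exists b.
have [c|L' [sub dis cov]] := IH (seq.filter P L) szP.
  by rewrite mem_filter => /andP[_]; exact: pos.
exists (b :: L'); split.
- move=> c; rewrite inE => /predU1P[->//|/sub]; rewrite mem_filter => /andP[_].
  by [].
- split => // c /sub; rewrite mem_filter => /andP[/asboolP].
  by [].
move=> c cL; have [Pc|] := boolP (P c).
  have [|d dL' h] := cov c; first by rewrite mem_filter Pc.
  by exists d => //; rewrite inE dL' orbT.
move=> /asboolP/eqP/set0P[z [bz cz]]; exists b; first exact: mem_head.
move=> w cw; rewrite /eball /=.
have h1 := bmax _ cL.
have := le_trans (edist_tri w c.1 b.1) (lerD (cw : enorm _ <= _) (edist_tri c.1 z b.1)).
rewrite (enormB c.1 z); move: (bz : enorm (z - b.1) <= b.2) (cz : enorm (z - c.1) <= c.2).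
have := pos _ bL.
by move=> h2 h3 h4 /le_trans; apply; lra.
Qed.

Section measure.
Variables (U : set 'rV[R]_n) (mu : {outer_measure set 'rV[R]_n -> \bar R}).
Hypothesis rmu : radon U mu.

Lemma disjoint_balls_sum L (A : set 'rV[R]_n) : disjoint_balls L ->
  (\sum_(b <- L) mu (A `&` Bl b) <= mu (A `&` \bigcup_(b in [set b | b \in L]) Bl b))%E.
Proof.
elim: L => [_|b L IH [dis /IH h]]; first by rewrite big_nil outer_measure_ge0.
rewrite big_cons.
have cb : mu.-caratheodory (Bl b) by apply: (radon_closed rmu); exact: eball_closed.
rewrite [leRHS]cb; apply: leeD.
  apply: le_outer_measure => x [Ax bx]; split => //; split => //.
  by exists b => //=; exact: mem_head.
apply: (le_trans h); apply: le_outer_measure => x [Ax [c /= cL cx]]; split.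
  by split => //; exists c => //=; rewrite inE cL orbT.
by move=> bx; have : (Bl b `&` Bl c) x by []; rewrite dis.
Qed.

(** All but a small part of the set is covered by the enlargements of finitely many balls, by inner
    regularity of the open set that the balls fill. *)
Lemma vitali_cover (W A : set 'rV[R]_n) (s : 'rV[R]_n -> R) (e : R) :
  open W -> (mu W < +oo)%E -> (forall y, A y -> U y /\ 0 < s y) -> A `<=` W -> 0 < e ->
  exists L, [/\ forall b, b \in L -> A b.1 /\ b.2 = s b.1, disjoint_balls L &
    (mu (A `\` \bigcup_(b in [set b | b \in L]) eball b.1 (4 * b.2)) <= e%:E)%E].
Proof.
move=> oW Woo As AW e0; pose G := W `&` \bigcup_(y in A) oball y (s y).
have oG : open G by apply: openI => //; apply: bigcup_open => y _; exact: oball_open.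
have Goo : (mu G < +oo)%E by apply: le_lt_trans Woo; apply: le_outer_measure => x [].
have [K [cK KG GK]] := radon_inner rmu e0 oG Goo.
have [L0 [L0A KL0]] : exists L, (forall b, b \in L -> A b.1 /\ b.2 = s b.1) /\
    K `<=` \bigcup_(b in [set b | b \in L]) Bl b.
  apply: (@compact_ind _ K (fun K => exists L, (forall b, b \in L -> A b.1 /\ b.2 = s b.1) /\
    K `<=` \bigcup_(b in [set b | b \in L]) Bl b) cK).
  - by exists [::]; split => // ? [].
  - by move=> B C BC [L [LA CL]]; exists L; split => //; exact: subset_trans CL.
  - move=> B C [L [LA BL]] [L1 [L1A CL]]; exists (L ++ L1); split.
      by move=> b; rewrite mem_cat => /orP[/LA|/L1A].
    move=> z [/BL[b /= bL bz]|/CL[b /= bL bz]]; exists b => //=;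
      by rewrite mem_cat bL ?orbT.
  - move=> z /KG[_ [_ [y Ay yz]]]; exists (oball y (s y)).
      by apply: open_nbhs_nbhs; split => //; exact: oball_open.
    exists [:: (y, s y)]; split; first by move=> b; rewrite inE => /eqP ->.
    by move=> w /oball_sub_eball yw; exists (y, s y) => //=; rewrite inE.
have [|L [LL0 dis cov]] := @vitali_finite L0.
  by move=> b /L0A[/As[_ h] ->].
exists L; split => //; first by move=> b /LL0/L0A.
have KGW : K `<=` G by move=> x /KG[].
have Koo : (mu K < +oo)%E by apply: le_lt_trans Goo; exact: le_outer_measure.
apply: le_trans (excess_le (compact_cara rmu cK) KGW Koo GK).
apply: le_outer_measure => y [Ay ny]; split.
  split; first exact: AW.
  by exists y => //; rewrite /oball /= subrr enorm0; have [] := As _ Ay.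
move=> Ky; apply: ny; have [b /= bL0 by_] := KL0 _ Ky.
by have [c cL h] := cov _ bL0; exists c => //; exact: h.
Qed.

End measure.
End vitali.

(** * Density points *)

Lemma null_bigcup {R : realType} (T : Type) (mu : {outer_measure set T -> \bar R})
    (F : nat -> set T) : (forall k, mu (F k) = 0)%E -> mu (\bigcup_k F k) = 0%E.
Proof.
move=> H; apply/eqP; rewrite eq_le outer_measure_ge0 andbT.
apply: (le_trans (outer_measure_sigma_subadditive mu F)).
by rewrite eseries0.
Qed.

Section covering.
Context {R : realType} {n : nat}.
Variables (U : set 'rV[R]_n) (mu : {outer_measure set 'rV[R]_n -> \bar R}).
Hypotheses (oU : open U) (rmu : radon U mu).

Lemma bigcup_balls_le (L : seq ('rV[R]_n * R)) (A : set 'rV[R]_n) :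
  (mu (A `&` \bigcup_(b in [set b | b \in L]) eball b.1 (4 * b.2)) <=
   \sum_(b <- L) mu (A `&` eball b.1 (4 * b.2)))%E.
Proof.
elim: L => [|b L IH].
  rewrite big_nil (_ : _ `&` _ = set0) ?outer_measure0//.
  by apply/seteqP; split=> // x [_ [b]].
rewrite big_cons; apply: le_trans (leeD (le_refl _) IH).
apply: le_trans (outer_measureU2 _ _ _); apply: le_outer_measure => x [Ax [c /= cL cx]].
move: cL cx; rewrite inE => /predU1P[->|cL] cx; [left|right]; split => //.
by exists c.
Qed.

(** Vitali's covering argument, in the form of a comparison principle. *)
Lemma vitali_le (nu : {outer_measure set 'rV[R]_n -> \bar R}) (W A B : set 'rV[R]_n)
    (s : 'rV[R]_n -> R) (c d : R) : radon U nu -> 0 <= c -> 0 <= d ->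
  open W -> (mu W < +oo)%E -> A `<=` W -> (forall y, A y -> U y /\ 0 < s y) ->
  (forall y, A y -> (mu (A `&` eball y (4 * s y)) <=
     c%:E * mu (B `&` eball y (s y)) + d%:E * nu (B `&` eball y (s y)))%E) ->
  (mu A <= c%:E * mu B + d%:E * nu B)%E.
Proof.
move=> rnu c0 d0 oW Woo AW As H; apply/lee_addgt0Pr => e e0.
have [L [LA dis Le]] := vitali_cover rmu oW Woo As AW e0.
set C := \bigcup_(b in _) _ in Le.
apply: (@le_trans _ _ (mu (A `&` C) + mu (A `\` C))%E).
  apply: le_trans (outer_measureU2 _ _ _); apply: le_outer_measure => x Ax.
  by have [Cx|nCx] := pselect (C x); [left|right].
apply: leeD => //; apply: (le_trans (bigcup_balls_le _ _)).
apply: (@le_trans _ _ (c%:E * (\sum_(b <- L) mu (B `&` Bl b)) +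
    d%:E * (\sum_(b <- L) nu (B `&` Bl b)))%E).
  rewrite !ge0_sume_distrr -?big_split; try by move=> *; exact: outer_measure_ge0.
  rewrite big_seq [leRHS]big_seq; apply: lee_sum => b /LA[Ab bs].
  by rewrite /Bl bs; exact: H.
apply: leeD; apply: lee_wpmul2l; rewrite ?lee_fin//.
  by apply: (le_trans (disjoint_balls_sum rmu B dis)); apply: le_outer_measure; exact: subIsetl.
by apply: (le_trans (disjoint_balls_sum rnu B dis)); apply: le_outer_measure; exact: subIsetl.
Qed.

(** Almost every point of [E] at which the density of [mu] is bounded below is a
    density point of [E] in a weak sense. *)
Lemma weak_density p (a : R) E : 0 < a -> mu.-caratheodory E ->
  mu [set y | [/\ E y, U y,
    exists2 t, 0 < t & forall s, 0 < s < t -> ((a * s ^+ p)%:E <= mu (eball y s))%E &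
    exists2 t, 0 < t & forall s, 0 < s < t ->
       (mu (E `&` eball y s) <= (a / 2 * s ^+ p)%:E)%E]] = 0%E.
Proof.
move=> a0 cE; have [K [KP UK]] := compact_exhaustion oU.
pose N j k := [set y | [/\ E y, K k y &
  forall s, 0 < s < j.+1%:R^-1 -> ((a * s ^+ p)%:E <= mu (eball y s))%E /\
       (mu (E `&` eball y s) <= (a / 2 * s ^+ p)%:E)%E]].
apply: (@outer_measure_null_sub _ _ _ _ (\bigcup_j \bigcup_k N j k)).
  move=> y [Ey Uy [t t0 Ht] [t' t'0 Ht']].
  have mt : 0 < Num.min t t' by rewrite lt_min t0.
  have [j _ /(_ _ (leqnn j)) /= jP] := near_infty_natSinv_lt (PosNum mt).
  have [k _ Kk] := UK _ Uy; exists j => //; exists k => //; split => // s /andP[s0 sj].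
  move: (lt_trans sj jP) => /=; rewrite lt_min => /andP[st st'].
  by split; [apply: Ht|apply: Ht']; rewrite s0.
apply: null_bigcup => j; apply: null_bigcup => k.
have [cK KU] := KP k.
apply/eqP; rewrite eq_le outer_measure_ge0 andbT; apply/lee_addgt0Pr => e e0; rewrite add0e.
(* the covering multiplies the excess [e1] by [4 ^+ p] *)
pose e1 := e / 4 ^+ p.
have e10 : 0 < e1 by rewrite divr_gt0 ?exprn_gt0.
have cEK : mu.-caratheodory (E `&` K k).
  by apply: caratheodory_measurable_setI => //; exact: (compact_cara rmu).
have EKoo : (mu (E `&` K k) < +oo)%E.
  by apply: le_lt_trans (radon_compact rmu cK KU); apply: le_outer_measure => x [].
have [W [oW EW Wle]] := radon_outer rmu e10 EKoo.
have EKW : E `&` K k `<=` W by move=> x [Ex Kx]; apply: EW; split => //; exact: KU.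
have Woo : (mu W < +oo)%E by apply: (le_lt_trans Wle); rewrite lte_add_pinfty ?ltry.
have WE : (mu (W `\` E) <= e1%:E)%E.
  apply: le_trans (excess_le cEK EKW EKoo Wle).
  by apply: le_outer_measure => x [Wx nE]; split => // -[].
have /choice[s sP] : forall y, exists s, N j k y ->
    [/\ 0 < s, 4 * s < j.+1%:R^-1 & eball y s `<=` W].
  move=> y; have [Ny|nN] := pselect (N j k y); last by exists 0.
  have [|r r0 rW] := @nbhs_eball _ _ y W.
    by apply: open_nbhs_nbhs; split => //; apply: EKW; case: Ny.
  pose t : R := j.+1%:R^-1; have t0 : 0 < t by rewrite invr_gt0.
  exists (Num.min r (t / 5)) => _; split.
  - by rewrite lt_min r0 divr_gt0.
  - rewrite -/t; have : Num.min r (t / 5) <= t / 5 by rewrite ge_min lexx orbT.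
    lra.
  - by move=> z yz; apply: rW; apply: (le_trans (yz : enorm _ <= _)); rewrite ge_min lexx.
apply: (@le_trans _ _ ((4 ^+ p)%:E * mu (W `\` E) + 0%:E * mu (W `\` E))%E); last first.
  rewrite mul0e adde0; apply: (@le_trans _ _ ((4 ^+ p)%:E * e1%:E)%E).
    by apply: lee_wpmul2l => //; rewrite lee_fin exprn_ge0.
  by rewrite -EFinM lee_fin /e1 mulrC divfK// expf_neq0.
apply: (@vitali_le _ W _ _ s) => //.
- by move=> y [Ey Ky _]; apply: EKW.
- by move=> y Ny; have [s0 _ _] := sP y Ny; split => //; apply: KU; case: Ny.
move=> y Ny; have [s0 s4 sW] := sP y Ny; have [Ey Ky H] := Ny.
rewrite mul0e adde0.
have [|_ h4] := H (4 * s y); first by rewrite mulr_gt0.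
have [|h1 h2] := H (s y); first by rewrite s0 /=; apply: lt_trans s4; lra.
apply: (@le_trans _ _ (mu (E `&` eball y (4 * s y)))).
  by apply: le_outer_measure => x [[Ex _ _] bx].
apply: (le_trans h4).
have -> : (W `\` E) `&` eball y (s y) = eball y (s y) `&` ~` E.
  by apply/seteqP; split=> x; [move=> [[_ nE] bx]|move=> [bx nE]; split => //; split => //; exact: sW].
rewrite exprMn mulrCA EFinM; apply: lee_wpmul2l; first by rewrite lee_fin exprn_ge0.
have := h1; rewrite (cE (eball _ _)) (setIC (eball _ _) E) => h3.
have : ((a * s y ^+ p)%:E <= (a / 2 * s y ^+ p)%:E + mu (eball y (s y) `&` ~` E))%E.
  by apply: (le_trans h3); apply: leeD.
rewrite -leeBlDl// -EFinB; apply: le_trans; rewrite lee_fin le_eqVlt; apply/orP; left.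
by apply/eqP; field.
Qed.

End covering.

(** * The monotonicity inequality *)

Section mass_decay.
Context {R : realType} {n : nat} (p : nat).
Local Notation m := p.+1.
Variable U : set 'rV[R]_n.
Variable V : {outer_measure set ('rV[R]_n * 'M[R]_n)%type -> \bar R}.
Local Notation G := (@Grass R n m).
Hypotheses (oU : open U) (vV : varifold U m V).
Local Notation var := (var_measure U V).
Local Notation wt := (weight m V).
Hypothesis rvar : radon U var.
Local Notation IV f := (Rintegral (cara_measure V) setT f).
Let rwt : radon U wt := radon_weight oU vV.

Section one_part.
Variable E : set 'rV[R]_n.
Hypotheses (cwE : wt.-caratheodory E) (cvE : var.-caratheodory E).
Hypothesis nE : no_boundary U m V E.
Variables (x : 'rV[R]_n) (r : R).
Hypothesis BU : eball x r `<=` U.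

Definition part_ball y t := E `&` eball x r `&` eball y t.
Local Notation A := part_ball.
Definition part_indic y t (z : 'rV[R]_n * 'M[R]_n) : R := \1_(A y t `*` G) z.
Local Notation q := part_indic.

Section cutoff.
Variables (D : R) (phi : 'rV[R]_n -> R).
Hypotheses (D0 : 0 <= D) (sphi : smooth phi) (phi01 : forall z, 0 <= phi z <= 1).
Hypothesis phi0 : forall z, ~ eball x r z -> phi z = 0.
Hypothesis dphi : forall z w, `|'D_w phi z| <= D * enorm w * \1_(eball x r) z.

(** [cut_mass] is the localized mass of the monotonicity inequality, [layer] the error
    made by the cutoff and by the first variation in one dyadic ball. *)
Definition cut_mass y t := IV (fun z => phi z.1 * q y t z).
Local Notation F := cut_mass.
Definition layer y t := 2 ^+ p * (D * fine (wt (A y t)) + 16 * fine (var (A y t))).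
Local Notation N := layer.

Lemma localA_cara (mu : {outer_measure set 'rV[R]_n -> \bar R}) y t : radon U mu ->
  mu.-caratheodory E -> mu.-caratheodory (A y t).
Proof.
move=> rmu cE; apply: caratheodory_measurable_setI; last first.
  by apply: (radon_closed rmu); exact: eball_closed.
apply: caratheodory_measurable_setI => //; apply: (radon_closed rmu); exact: eball_closed.
Qed.

Lemma localA_fin (mu : {outer_measure set 'rV[R]_n -> \bar R}) B : radon U mu ->
  B `<=` eball x r -> (mu B < +oo)%E.
Proof.
move=> rmu BB; apply: (@le_lt_trans _ _ (mu (eball x r))); first exact: le_outer_measure.
by apply: (radon_compact rmu) => //; exact: eball_compact.
Qed.

Let A_sub y t : A y t `<=` eball x r. Proof. by move=> z [[]]. Qed.

Let q_bfin y t : bfin V (q y t).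
Proof.
apply: indic_bfin; first by apply: (cyl_grass_cara oU vV); exact: localA_cara.
exact: (localA_fin rwt (@A_sub y t)).
Qed.

Let phiq_bfin y t : bfin V (fun z => phi z.1 * q y t z).
Proof.
apply: (@bfinM _ _ _ _ _ 1) => //.
- apply: (radon_cmeas vV) => z; apply: continuous_comp; first exact: cvg_fst.
  exact: smooth_continuous.
- by move=> z; have /andP[h0 h1] := phi01 z.1; rewrite ger0_norm.
Qed.

Let Iq y t : IV (q y t) = fine (wt (A y t)).
Proof.
by rewrite Rintegral_indicM//; apply: (cyl_grass_cara oU vV); exact: localA_cara.
Qed.

Let q01 y t z : 0 <= q y t z <= 1.
Proof. by rewrite /part_indic indicE; case: (z \in _); rewrite /= ?lexx ?ler01. Qed.

Lemma localized_mass_le y t : F y t <= fine (wt (E `&` eball x r)).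
Proof.
apply: (@le_trans _ _ (IV (q y t))).
  apply: Rint_le => // z; have /andP[h0 h1] := phi01 z.1; have /andP[q0 q1] := q01 y t z.
  by rewrite ler_piMl.
rewrite Iq fine_le ?ge0_fin_numE ?outer_measure_ge0//.
- exact: (localA_fin rwt (@A_sub y t)).
- by apply: (localA_fin rwt) => z [].
- by apply: le_outer_measure => z [].
Qed.

Lemma localized_mass_ge B y t : wt.-caratheodory B -> B `<=` A y t ->
  (forall z, B z -> phi z = 1) -> fine (wt B) <= F y t.
Proof.
move=> cB BA phi1.
have cBG := cyl_grass_cara oU vV cB.
rewrite (_ : fine (wt B) = IV (\1_(B `*` G))); last by rewrite Rintegral_indicM.
apply: Rint_le => //.
  apply: indic_bfin => //; apply: (localA_fin rwt).
  by apply: subset_trans BA _; exact: A_sub.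
move=> [z P]; rewrite indicE; have [[Bz GP]|nB] := pselect ((B `*` G) (z, P)).
  rewrite mem_set//= phi1// mul1r /part_indic indicE mem_set//; split => //; exact: BA.
rewrite memNset//=; have /andP[h0 _] := phi01 z; have /andP[q0 _] := q01 y t (z, P).
exact: mulr_ge0.
Qed.

(** Monotonicity inequality for the part [E], obtained by testing the first variation
    of [E] with the radial field. *)
Lemma localized_monotonicity y (sg : R) i J : 0 < sg -> (i < J)%N ->
  let s := (fun j : nat => 2 ^+ j * sg) in
  expR (- 2) / 2 ^+ m.+1 * s i ^- m * F y (s i) - 4 * m%:R * s J ^- m * F y (s J) <=
  \sum_(i <= j < J.+1) s j ^- p * N y (s j).
Proof.
move=> sg0 iJ; set s := (fun j : nat => _) => /=.
pose th := radial_field p sg y phi i J.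
have t : test_fun U th by exact: (radial_field_test p y sg0 sphi phi0 i J BU).
have [mt _] := tangential_div_bfin oU vV t.
have lower : expR (- 2) / 2 ^+ m.+1 * s i ^- m * F y (s i) -
    4 * m%:R * s J ^- m * F y (s J) - D * 2 ^+ p *
     \sum_(i <= j < J.+1) s j ^- p * fine (wt (A y (s j))) <=
    Rintegral (cara_measure V) (E `*` G) (tangential_div th).
  pose c1 : R := expR (- 2) / 2 ^+ m.+1 * s i ^- m.
  pose c2 : R := - (4 * m%:R * s J ^- m).
  pose c3 : R := - (D * 2 ^+ p).
  have b1 : bfin V (fun z => c1 * (phi z.1 * q y (s i) z)) by exact: bfinZ.
  have b2 : bfin V (fun z => c2 * (phi z.1 * q y (s J) z)) by exact: bfinZ.
  have b3 j : bfin V (fun z => s j ^- p * q y (s j) z) by exact: bfinZ.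
  have b4 : bfin V (fun z => c3 * \sum_(i <= j < J.+1) s j ^- p * q y (s j) z).
    by apply: bfinZ; apply: bfin_sum.
  rewrite [leRHS]Rintegral_indic_mul.
  apply: (@le_trans _ _ (IV (fun z => c1 * (phi z.1 * q y (s i) z) +
    c2 * (phi z.1 * q y (s J) z) + c3 * \sum_(i <= j < J.+1) s j ^- p * q y (s j) z))).
    rewrite RintD//; last exact: bfinD.
    rewrite RintD// !RintZ//; last exact: bfin_sum.
    rewrite Rint_sum// /c2 /c3 !mulNr lerD2l lerN2 ler_wpM2l ?mulr_ge0 ?exprn_ge0//.
    by rewrite le_eqVlt; apply/orP; left; apply/eqP; apply: eq_bigr => j _; rewrite RintZ// Iq.
  apply: Rint_le.
  - by apply: bfinD => //; apply: bfinD.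
  - by apply: bfin_indicM; [exact: (cyl_grass_cara oU vV)|exact: (tangential_div_bfin oU vV)].
  move=> [z P]; rewrite indicE; have [[Ez GP]|nz] := pselect ((E `*` G) (z, P)); last first.
    have q0 t' : q y t' (z, P) = 0.
      by rewrite /part_indic indicE memNset// => -[[[Ez _] _] GP]; apply: nz.
    by rewrite memNset// mul0r !q0 !mulr0 !add0r big1 ?mulr0// => j _; rewrite q0 mulr0.
  rewrite mem_set// mul1r.
  have qE t' : q y t' (z, P) = \1_(eball y t') z * \1_(eball x r) z.
    rewrite /part_indic !indicE -natrM; congr (_%:R); rewrite -[RHS]/(nat_of_bool _ * nat_of_bool _)%N mulnb; congr nat_of_bool.
    apply/idP/andP => [/set_mem[[[_ h1] h2] _]|[/set_mem h1 /set_mem h2]]; first by split; exact: mem_set.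
    by apply: mem_set; split.
  have phq t' : phi z * q y t' (z, P) = phi z * \1_(eball y t') z.
    rewrite qE; have [h|/phi0 ->] := pselect (eball x r z); last by rewrite !mul0r.
    by rewrite [\1_(eball x r) z]indicE mem_set// mulr1.
  rewrite /= !phq /c1 /c2 /c3 !mulNr.
  apply: le_trans (radial_field_div y sg0 D0 sphi phi01 dphi iJ z (GP : Grass m P)).
  rewrite lerD2l lerN2 le_eqVlt; apply/orP; left; apply/eqP; congr (_ * _).
  by apply: eq_bigr => j _; rewrite qE.
have upper : Rintegral (cara_measure var) setT (fun z => enorm (patch (fun=> 0) E th z)) <=
    2 ^+ p * \sum_(i <= j < J.+1) s j ^- p * fine (var (A y (s j))).
  have ind t' : bfin var (\1_(A y t')).
    by apply: indic_bfin; [exact: localA_cara|exact: (localA_fin rvar (@A_sub y t'))].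
  apply: (@le_trans _ _ (Rintegral (cara_measure var) setT (fun z =>
      2 ^+ p * \sum_(i <= j < J.+1) s j ^- p * \1_(A y (s j)) z))); last first.
    rewrite RintZ; last by apply: bfin_sum => j; exact: bfinZ.
    rewrite Rint_sum; last by move=> j; exact: bfinZ.
    rewrite le_eqVlt; apply/orP; left; apply/eqP; congr (_ * _); apply: eq_bigr => j _.
    by rewrite RintZ// Rintegral_indicM//; exact: localA_cara.
  apply: Rint_le.
  - have -> : (fun z => enorm (patch (fun=> 0) E th z)) = (fun z => \1_E z * enorm (th z)).
      apply/funext => z; rewrite /patch indicE; case: (z \in E); rewrite ?mul1r ?mul0r//.
      exact: enorm0.
    by apply: bfin_indicM => //; exact: (test_bfin rvar).
  - by apply: bfinZ; apply: bfin_sum => j; exact: bfinZ.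
  move=> z; rewrite /patch; case: ifPn => [/set_mem Ez|_]; last first.
    rewrite enorm0 mulr_ge0 ?exprn_ge0// sumr_ge0// => j _.
    by rewrite mulr_ge0 ?invr_ge0 ?exprn_ge0 ?mulr_ge0 ?exprn_ge0 ?(ltW sg0)// indicE ler0n.
  apply: (le_trans (radial_field_norm p y sg0 phi01 phi0 iJ z)).
  rewrite le_eqVlt; apply/orP; left; apply/eqP; congr (_ * _); apply: eq_bigr => j _.
  congr (_ * _); rewrite !indicE -natrM; congr (_%:R).
  rewrite -[LHS]/(nat_of_bool _ * nat_of_bool _)%N mulnb; congr nat_of_bool.
  apply/andP/idP => [[/set_mem h1 /set_mem h2]|/set_mem[[_ h1] h2]].
    by apply: mem_set; split.
  by split; exact: mem_set.
have := no_boundary_le oU vV rvar cwE cvE nE t => /(le_trans (ler_norm _)).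
move=> /(le_trans lower) /le_trans h.
have {}h := h _ (ler_wpM2l (ler0n _ 16) upper).
rewrite lerBlDr in h.
apply: (le_trans h); rewrite le_eqVlt; apply/orP; left; apply/eqP.
rewrite !mulr_sumr -big_split; apply: eq_bigr => j _; rewrite /layer /=; ring.
Qed.
End cutoff.
End one_part.
End mass_decay.

(** * The local isoperimetric inequality *)

Lemma dyadic_scale {R : realType} (t rho : R) : 0 < t -> 2 * t <= rho ->
  exists J, [/\ (0 < J)%N, 2 ^+ J * t <= rho & rho < 2 * (2 ^+ J * t)].
Proof.
move=> t0 tr.
have ex : exists k, rho < 2 ^+ k * t.
  exists (Num.truncn (rho / t)).+1; rewrite -ltr_pdivrMr//.
  apply: (lt_trans (truncnS_gt _)); rewrite -natrX ltr_nat; exact: ltn_expl.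
have [k Hk kmin] := ex_minnP ex.
have k2 : (1 < k)%N.
  rewrite ltnNge; apply/negP; case: k Hk {kmin} => [|[|//]] Hk _; move: Hk; rewrite ?expr0 ?expr1; lra.
exists k.-1; split.
- by rewrite -ltnS prednK// ltnW.
- rewrite leNgt; apply/negP => /kmin; rewrite leqNgt ltn_predL.
  by rewrite (ltnW k2).
- by rewrite mulrA -exprS prednK// ltnW.
Qed.

Section mass_decay.
Context {R : realType} {n : nat} (p : nat).
Local Notation m := p.+1.
Variable U : set 'rV[R]_n.
Variable V : {outer_measure set ('rV[R]_n * 'M[R]_n)%type -> \bar R}.
Hypotheses (oU : open U) (vV : varifold U m V).
Local Notation var := (var_measure U V).
Local Notation wt := (weight m V).
Hypothesis rvar : radon U var.
Let rwt : radon U wt := radon_weight oU vV.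

Definition mono_const : R := expR (- 2) / 2 ^+ m.+1.
Definition step_const : R := 4 * 4 ^+ m / mono_const * 2 ^+ p.

Lemma mono_const_gt0 : 0 < mono_const.
Proof. by rewrite divr_gt0 ?expR_gt0 ?exprn_gt0. Qed.

Lemma step_const_gt0 : 0 < step_const.
Proof.
apply: mulr_gt0; last exact: exprn_gt0.
apply: divr_gt0 mono_const_gt0; apply: mulr_gt0 => //; exact: exprn_gt0.
Qed.

Variable a : R.
Hypothesis a0 : 0 < a.

Section one_part.
Variable E : set 'rV[R]_n.
Hypotheses (cwE : wt.-caratheodory E) (cvE : var.-caratheodory E).
Hypothesis nE : no_boundary U m V E.
Variables (x : 'rV[R]_n) (r : R).
Hypothesis BU : eball x r `<=` U.

(** At a point of density of [E] the mass ratio is bounded below at small scales; it is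
    tiny at scale [rho], so that at some scale in between the mass is controlled by the
    cutoff and the first variation. The cutoff is [1] on a ball of radius [r1] slightly
    larger than [r'], hence near every point of the smaller ball. *)
Lemma good_radius (D : R) (phi : 'rV[R]_n -> R) (r' r1 delta rho : R) (y : 'rV[R]_n) :
  0 <= D -> smooth phi -> (forall z, 0 <= phi z <= 1) ->
  (forall z, ~ eball x r z -> phi z = 0) ->
  (forall z w, `|'D_w phi z| <= D * enorm w * \1_(eball x r) z) ->
  r' < r1 -> r1 <= r -> (forall z, eball x r1 z -> phi z = 1) ->
  0 <= delta -> delta <= a / 2 -> 4 * (4 * m%:R) * delta <= mono_const * (a / 2) ->
  0 < rho -> (wt (E `&` eball x r) <= (delta * (rho / 2) ^+ m)%:E)%E ->
  eball x r' y ->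
  (forall t, 0 < t -> exists s, 0 < s < t /\ ((a / 2 * s ^+ m)%:E < wt (E `&` eball y s))%E) ->
  exists2 s, 0 < s &
    (wt (E `&` eball x r' `&` eball y (4 * s)) <=
      (step_const * rho * D)%:E * wt (part_ball E x r y s) +
      (step_const * rho * 16)%:E * var (part_ball E x r y s))%E.
Proof.
move=> D0 sphi phi01 phi0 dphi r'r1 r1r phi1 d0 da dm rho0 small yr' dens.
have c10 := mono_const_gt0.
have [|sg [/andP[sg0 sgt] big]] := dens (Num.min (r1 - r') (rho / 2)).
  by rewrite lt_min subr_gt0 r'r1 divr_gt0.
move: sgt; rewrite lt_min => /andP[sgr sgrho].
have [|J [J0 sJ rJ]] := @dyadic_scale _ sg rho sg0; first by lra.
have r'r : r' <= r by apply: le_trans r1r; exact: ltW.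
have sub' t : E `&` eball x r' `&` eball y t `<=` part_ball E x r y t.
  by move=> z [[Ez xz] yz]; split => //; split => //; exact: le_trans r'r.
have cE' (mu : {outer_measure set 'rV[R]_n -> \bar R}) b t : radon U mu -> mu.-caratheodory E ->
    mu.-caratheodory (E `&` eball x b `&` eball y t).
  by move=> rmu cE; exact: (localA_cara x b y t rmu cE).
have fA (mu : {outer_measure set 'rV[R]_n -> \bar R}) b t : radon U mu -> b <= r ->
    mu (E `&` eball x b `&` eball y t) \is a fin_num.
  move=> rmu br; rewrite ge0_fin_numE ?outer_measure_ge0//.
  by apply: (localA_fin BU rmu) => z [[_ xz] _]; exact: le_trans br.
have fwA : wt (E `&` eball x r) \is a fin_num.
  by rewrite ge0_fin_numE ?outer_measure_ge0//; apply: (localA_fin BU rwt) => z [].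
have yr1 : eball y sg `<=` eball x r1.
  move=> z yz; have := edist_tri z y x; move: (yz : enorm _ <= _) (yr' : enorm _ <= _).
  by rewrite /eball /=; lra.
have [|||||j jJ] := @good_scale R p sg (a / 2) mono_const (4 * m%:R) delta J
  (fun j => cut_mass p V E x r phi y (2 ^+ j * sg))
  (fun j => layer p U V E x r D y (2 ^+ j * sg)) sg0 _ c10 _ d0 J0 _ _ da dm.
- by rewrite divr_gt0.
- by rewrite mulr_ge0.
- move=> j; apply: (le_trans (localized_mass_le oU vV cwE BU sphi phi01 _ _)).
  rewrite -(fineK fwA) lee_fin in small; apply: (le_trans small).
  apply: ler_wpM2l => //; rewrite lerXn2r ?nnegrE ?mulr_ge0 ?exprn_ge0 ?invr_ge0 ?(ltW sg0) ?(ltW rho0)//.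
  lra.
- rewrite expr0 mul1r; apply: (@le_trans _ _ (fine (wt (E `&` eball y sg)))).
    have fb : wt (E `&` eball y sg) \is a fin_num.
      rewrite ge0_fin_numE ?outer_measure_ge0//; apply: (localA_fin BU rwt) => z [_ /yr1 xz].
      exact: le_trans r1r.
    by rewrite -lee_fin fineK// ltW.
  apply: (localized_mass_ge oU vV cwE BU sphi phi01).
  + by apply: caratheodory_measurable_setI => //; apply: (radon_closed rwt); exact: eball_closed.
  + by move=> z [Ez yz]; split => //; split => //; apply: le_trans r1r; exact: yr1.
  + by move=> z [_ /yr1]; exact: phi1.
- by move=> i iJ; exact: (localized_monotonicity oU vV rvar cwE cvE nE BU D0 sphi phi01 phi0 dphi y sg0 iJ).
move=> jle; set s := 2 ^+ j * sg in jle *.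
have s0 : 0 < s by rewrite mulr_gt0 ?exprn_gt0.
exists s => //.
have -> : 4 * s = 2 ^+ j.+2 * sg by rewrite /s !exprS; ring.
have h1 : fine (wt (E `&` eball x r' `&` eball y (2 ^+ j.+2 * sg))) <=
    cut_mass p V E x r phi y (2 ^+ j.+2 * sg).
  apply: (localized_mass_ge oU vV cwE BU sphi phi01) => //; first exact: cE'.
  by move=> z [[_ xz] _]; apply: phi1; apply: le_trans (ltW r'r1).
rewrite -(fineK (fA wt r' _ rwt r'r)) -(fineK (fA wt r s rwt (lexx _))) -(fineK (fA var r s rvar (lexx _))).
rewrite -!EFinM -EFinD lee_fin; apply: (le_trans h1); apply: (le_trans jle).
have N0 : 0 <= layer p U V E x r D y s.
  by rewrite mulr_ge0 ?exprn_ge0// addr_ge0// mulr_ge0// fine_ge0// outer_measure_ge0.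
apply: (@le_trans _ _ (4 * 4 ^+ m / mono_const * rho * layer p U V E x r D y s)).
  apply: ler_wpM2r => //; apply: ler_wpM2l => //.
  by rewrite divr_ge0 ?mulr_ge0 ?exprn_ge0// ltW.
rewrite le_eqVlt; apply/orP; left; apply/eqP.
by rewrite /layer /step_const /part_ball; ring.
Qed.

End one_part.
Hypothesis lower_density : wt [set y | U y /\
  ~ exists2 t, 0 < t & forall s, 0 < s < t -> ((a * s ^+ m)%:E <= wt (eball y s))%E] = 0%E.

(** The local isoperimetric inequality, for a part without boundary which occupies
    only a small portion of a ball. *)
Lemma mass_step : exists2 dl, 0 < dl & exists2 C, 0 < C & forall E,
  wt.-caratheodory E -> var.-caratheodory E -> no_boundary U m V E ->
  forall x r' r rho, eball x r `<=` U -> 0 <= r' < r -> 0 < rho ->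
  (wt (E `&` eball x r) <= (dl * rho ^+ m)%:E)%E ->
  (wt (E `&` eball x r') <= (C * rho / (r - r'))%:E * wt (E `&` eball x r) +
    (C * rho)%:E * var (E `&` eball x r))%E.
Proof.
have [Cc Cc0 cutb] := @cutoff_derive_bound R n.
have c10 := mono_const_gt0; have S0 := step_const_gt0.
(* the two smallness conditions of [good_scale] *)
pose delta := Num.min (a / 2) (mono_const * (a / 2) / (4 * (4 * m%:R))).
have m0 : 0 < 4 * (4 * m%:R) :> R by rewrite !mulr_gt0.
have d0 : 0 < delta by rewrite lt_min !divr_gt0// mulr_gt0// divr_gt0.
have da : delta <= a / 2 by rewrite ge_min lexx.
have dm : 4 * (4 * m%:R) * delta <= mono_const * (a / 2).
  by rewrite mulrC -ler_pdivlMr// ge_min lexx orbT.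
exists (delta / 2 ^+ m); first by rewrite divr_gt0 ?exprn_gt0.
exists (step_const * (2 * Cc + 16)).
  by rewrite mulr_gt0// addr_gt0// mulr_gt0.
move=> E cwE cvE nE x r' r rho BU /andP[r'0 r'r] rho0 small.
pose r1 := (r' + r) / 2.
have r'r1 : r' < r1 by rewrite /r1; lra.
have r1r : r1 < r by rewrite /r1; lra.
have r1b : 0 <= r1 < r by rewrite (le_trans r'0 (ltW r'r1)).
pose phi := cutoff x r1 r.
pose D := Cc / (r - r1).
have D0 : 0 <= D by rewrite divr_ge0 ?(ltW Cc0)// subr_ge0 ltW.
pose N1 := [set y | U y /\ ~ exists2 t, 0 < t &
  forall s, 0 < s < t -> ((a * s ^+ m)%:E <= wt (eball y s))%E].
pose N2 := [set y | [/\ E y, U y,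
    exists2 t, 0 < t & forall s, 0 < s < t -> ((a * s ^+ m)%:E <= wt (eball y s))%E &
    exists2 t, 0 < t & forall s, 0 < s < t ->
       (wt (E `&` eball y s) <= (a / 2 * s ^+ m)%:E)%E]].
have N20 : wt N2 = 0%E by exact: (weak_density oU rwt m a0 cwE).
pose A := (E `&` eball x r') `\` (N1 `|` N2).
have small' : (wt (E `&` eball x r) <= (delta * (rho / 2) ^+ m)%:E)%E.
  by apply: (le_trans small); rewrite lee_fin expr_div_n le_eqVlt; apply/orP; left; apply/eqP; ring.
have /choice[s sP] : forall y, exists s, A y -> 0 < s /\
    (wt (E `&` eball x r' `&` eball y (4 * s)) <=
      (step_const * rho * D)%:E * wt (part_ball E x r y s) +
      (step_const * rho * 16)%:E * var (part_ball E x r y s))%E.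
  move=> y; have [Ay|nA] := pselect (A y); last by exists 0.
  have [[Ey xy] nN] := Ay.
  have Uy : U y by apply: BU; exact: le_trans (ltW r'r).
  have [t t0 dt] : exists2 t, 0 < t & forall s, 0 < s < t ->
      ((a * s ^+ m)%:E <= wt (eball y s))%E.
    by apply: contrapT => h; apply: nN; left.
  have [||||||s s0 H] := @good_radius E cwE cvE nE x r BU D phi r' r1 delta rho y
      D0 _ _ _ _ r'r1 (ltW r1r) _ (ltW d0) da dm rho0 small' xy.
  - exact: cutoff_smooth.
  - exact: cutoff_itv.
  - by move=> z nz; apply: cutoff0 => //; rewrite leNgt; apply/negP => h; apply: nz; exact: ltW.
  - by move=> z w; exact: cutb.
  - by move=> z; exact: cutoff1.
  - move=> t' t'0; apply: contrapT => h; apply: nN; right; split => //.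
      by exists t.
    exists t' => // s' ss; rewrite leNgt; apply/negP => h'; apply: h.
    by exists s'.
  by exists s.
have A0 : wt (E `&` eball x r') = wt A.
  rewrite -[RHS](@outer_measureU0 _ _ _ A (N1 `|` N2)).
    apply/eqP; rewrite eq_le; apply/andP; split.
      apply: le_outer_measure => z Ez; have [|] := pselect ((N1 `|` N2) z); first by right.
      by left.
    rewrite [leLHS]outer_measureU0; first by apply: le_outer_measure => z [].
    by rewrite outer_measureU0.
  by rewrite outer_measureU0.
rewrite A0.
have wfin : (wt (oball x r) < +oo)%E.
  by apply: (localA_fin BU rwt); exact: oball_sub_eball.
apply: (@le_trans _ _ ((step_const * rho * D)%:E * wt (E `&` eball x r) +
      (step_const * rho * 16)%:E * var (E `&` eball x r))%E).
  apply: (@vitali_le _ _ _ _ rwt _ (oball x r) _ _ s) => //.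
  - by apply: mulr_ge0 => //; apply: mulr_ge0; exact: ltW.
  - by apply: mulr_ge0 => //; apply: mulr_ge0; exact: ltW.
  - exact: oball_open.
  - by move=> z [[_ xz] _]; exact: (eball_subo r'r).
  - move=> y Ay; have [s0 _] := sP y Ay; split => //; apply: BU; have [[_ xy] _] := Ay.
    exact: le_trans (ltW r'r).
  move=> y Ay; have [_ H] := sP y Ay; apply: le_trans H.
  by apply: le_outer_measure => z [[]].
apply: leeD; apply: lee_wpmul2r; rewrite ?outer_measure_ge0// lee_fin.
  rewrite /D (_ : r - r1 = (r - r') / 2); last by rewrite /r1; field.
  rewrite (_ : step_const * rho * _ = step_const * rho / (r - r') * (2 * Cc)); last first.
    by field; rewrite subr_eq0 gt_eqF.
  rewrite (_ : step_const * _ * rho / _ = step_const * rho / (r - r') * (2 * Cc + 16)); last by ring.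
  rewrite ler_wpM2l ?lerDl// divr_ge0 ?subr_ge0 ?(ltW r'r)// mulr_ge0// ltW//.
rewrite [leRHS]mulrAC; apply: ler_wpM2l; last by rewrite lerDr mulr_ge0 ?(ltW Cc0).
by apply: mulr_ge0; exact: ltW.
Qed.

End mass_decay.

(** * Small parts vanish *)

Lemma compact_thickening {R : realType} {n : nat} (U K : set 'rV[R]_n) : open U ->
  compact K -> K `<=` U -> exists r K', [/\ 0 < r, compact K', K' `<=` U &
    forall x, K x -> eball x r `<=` K'].
Proof.
move=> oU cK KU.
apply: (@compact_ind _ K (fun K => exists r K', [/\ 0 < r, compact K', K' `<=` U &
    forall x, K x -> eball x r `<=` K']) cK).
- by exists 1, set0; split => //; exact: compact0.
- move=> B C BC [r [K' [r0 cK' K'U H]]]; exists r, K'; split => // x /BC; exact: H.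
- move=> B C [r [B' [r0 cB B'U HB]]] [s [C' [s0 cC C'U HC]]].
  exists (Num.min r s), (B' `|` C'); split.
  + by rewrite lt_min r0.
  + exact: compactU.
  + by move=> x [/B'U|/C'U].
  + move=> x [/HB h|/HC h] y yx; [left; apply: h|right; apply: h];
    by apply: (le_trans (yx : enorm _ <= _)); rewrite ge_min lexx ?orbT.
move=> z /KU Uz; have [|r r0 rU] := @nbhs_eball _ _ z U.
  by apply: open_nbhs_nbhs; split.
have r20 : 0 < r / 2 by rewrite divr_gt0.
exists (oball z (r / 2)); first exact: nbhs_oball.
exists (r / 2), (eball z r); split => //; first exact: eball_compact.
move=> x xz y yx; have := edist_tri y x z; move: (xz : enorm _ < _) (yx : enorm _ <= _).
by rewrite /eball /=; lra.
Qed.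

Section parts.
Context {R : realType} {n : nat} (p : nat).
Local Notation m := p.+1.
Variable U : set 'rV[R]_n.
Variable V : {outer_measure set ('rV[R]_n * 'M[R]_n)%type -> \bar R}.
Hypotheses (oU : open U) (vV : varifold U m V).
Local Notation var := (var_measure U V).
Local Notation wt := (weight m V).
Hypothesis rvar : radon U var.
Let rwt : radon U wt := radon_weight oU vV.

Definition cara2 E := wt.-caratheodory E /\ var.-caratheodory E.

Variable a : R.
Hypothesis a0 : 0 < a.
Hypothesis lower_density : wt [set y | U y /\
  ~ exists2 t, 0 < t & forall s, 0 < s < t -> ((a * s ^+ m)%:E <= wt (eball y s))%E] = 0%E.

(* [nu] measures the curvature in a scale invariant way: the variation measure itself
   for curves, the integral of the power [m] of the mean curvature otherwise. *)
Variable nu : set 'rV[R]_n -> \bar R.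
Hypothesis nu_ge0 : forall A, (0 <= nu A)%E.
Hypothesis nu_fin : forall K, compact K -> K `<=` U -> (nu K < +oo)%E.
Hypothesis nu_le : forall A B, cara2 A -> cara2 B -> A `<=` B -> (nu A <= nu B)%E.
Hypothesis nuU : forall A B, cara2 A -> cara2 B -> A `&` B = set0 ->
  (nu A + nu B <= nu (A `|` B))%E.
Hypothesis nu_var : forall d eta : R, 0 < d -> 0 < eta -> exists2 c, 0 < c &
  forall A K rho, cara2 A -> compact K -> K `<=` U -> A `<=` K -> 0 < rho ->
    (wt A <= (d * rho ^+ m)%:E)%E -> (nu A <= c%:E)%E ->
    (rho%:E * var A <= (eta * rho ^+ m)%:E)%E.

Lemma cara2_eball E x r : cara2 E -> cara2 (E `&` eball x r).
Proof.
have cb := @eball_closed _ _ x r.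
move=> [cE cE']; split; apply: caratheodory_measurable_setI => //.
  exact: (radon_closed rwt).
exact: (radon_closed rvar).
Qed.

(** De Giorgi iteration: along radii decreasing from [r] to [r / 2] the mass is at most
    [dl * rhok k ^+ m] with [rhok k] of order [4 ^- k], each instance of the inequality
    [mass_step] giving the next bound. *)
Lemma small_part_vanishes r : 0 < r -> exists2 c, 0 < c & forall E x,
  cara2 E -> no_boundary U m V E -> eball x r `<=` U ->
  (wt (E `&` eball x r) <= c%:E)%E -> (nu (E `&` eball x r) <= c%:E)%E ->
  wt (E `&` eball x (r / 2)) = 0%E.
Proof.
move=> r0; have [dl dl0 [C C0 step]] := mass_step oU vV rvar a0 lower_density.
pose q : R := 4 ^+ m; have q0 : 0 < q by rewrite exprn_gt0.
(* [rho0] makes the mass term, and [eta] the curvature term, at most half of the next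
   bound *)
pose rho0 := r / (8 * C * q).
have rho00 : 0 < rho0 by rewrite divr_gt0// !mulr_gt0.
pose eta := dl / (2 * C * q).
have eta0 : 0 < eta by rewrite divr_gt0// !mulr_gt0.
have [c c0 Hc] := nu_var dl0 eta0.
pose rk k : R := r / 2 + r / 2 ^+ k.+1.
pose rhok k : R := rho0 / 4 ^+ k.
have rhok0 k : 0 < rhok k by rewrite divr_gt0 ?exprn_gt0.
exists (Num.min c (dl * rho0 ^+ m)).
  by rewrite lt_min c0 mulr_gt0// exprn_gt0.
move=> E x cE nE BU wsmall nsmall.
have rk_gt k : r / 2 < rk k by rewrite ltrDl divr_gt0 ?exprn_gt0.
have rk_le k : rk k <= r.
  have h : r / 2 ^+ k.+1 <= r / 2.
    by rewrite ler_pM2l// lef_pV2 ?posrE ?exprn_gt0// ler_eXnr// ler1n.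
  by rewrite /rk; lra.
have sub k : eball x (rk k) `<=` eball x r by move=> z xz; exact: le_trans (rk_le k).
have decay k : (wt (E `&` eball x (rk k)) <= (dl * rhok k ^+ m)%:E)%E.
  elim: k => [|k IH].
    rewrite /rhok expr0 divr1; apply: (@le_trans _ _ (wt (E `&` eball x r))).
      by apply: le_outer_measure; apply: setIS.
    by apply: (le_trans wsmall); rewrite lee_fin ge_min lexx orbT.
  have BUk : eball x (rk k) `<=` U by apply: subset_trans BU.
  have rr : 0 <= rk k.+1 < rk k.
    rewrite (le_trans _ (ltW (rk_gt _))) ?divr_ge0 ?(ltW r0)//=.
    by rewrite ltrD2l ltr_pM2l// ltf_pV2 ?posrE ?exprn_gt0// ltr_eXn2l// ltr1n.
  have [cE1 cE2] := cE.
  apply: (le_trans (step _ cE1 cE2 nE _ _ _ _ BUk rr (rhok0 k) IH)).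
  have vk : ((rhok k)%:E * var (E `&` eball x (rk k)) <= (eta * rhok k ^+ m)%:E)%E.
    apply: (Hc _ (eball x r)) => //.
    - exact: cara2_eball.
    - exact: eball_compact.
    - by move=> z [_ /sub].
    - apply: (@le_trans _ _ (nu (E `&` eball x r))).
        by apply: nu_le; [exact: cara2_eball|exact: cara2_eball|exact: setIS].
      by apply: (le_trans nsmall); rewrite lee_fin ge_min lexx.
  have -> : dl * rhok k.+1 ^+ m = dl * rhok k ^+ m / (2 * q) + dl * rhok k ^+ m / (2 * q).
    rewrite (_ : rhok k.+1 = rhok k / 4); last first.
      by rewrite /rhok exprS; field; rewrite expf_neq0.
    by rewrite expr_div_n -/q; field; rewrite gt_eqF.
  rewrite EFinD; apply: leeD; last first.
    rewrite EFinM -muleA; apply: (@le_trans _ _ (C%:E * (eta * rhok k ^+ m)%:E)%E).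
      by apply: lee_wpmul2l => //; rewrite lee_fin ltW.
    rewrite -EFinM lee_fin le_eqVlt; apply/orP; left; apply/eqP; rewrite /eta.
    by field; rewrite !gt_eqF.
  apply: (@le_trans _ _ ((C * rhok k / (rk k - rk k.+1))%:E * (dl * rhok k ^+ m)%:E)%E).
    apply: lee_wpmul2l => //; rewrite lee_fin; apply: divr_ge0.
      by apply: mulr_ge0; exact: ltW.
    by rewrite subr_ge0 ltW//; case/andP: rr.
  rewrite -EFinM lee_fin mulrC; apply: ler_wpM2l.
    by apply: mulr_ge0; [exact: ltW|apply: exprn_ge0; exact: ltW].
  have -> : rk k - rk k.+1 = r / (4 * 2 ^+ k).
    by rewrite /rk !exprS; field; rewrite expf_neq0.
  have -> : C * rhok k / (r / (4 * 2 ^+ k)) = (2 * q)^-1 * (2 ^+ k / 4 ^+ k).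
    by rewrite /rhok /rho0; field; rewrite !expf_neq0 ?gt_eqF.
  rewrite ger_pMr ?invr_gt0 ?mulr_gt0// ler_pdivrMr ?exprn_gt0// mul1r.
  by rewrite lerXn2r ?nnegrE//; lra.
apply/eqP; rewrite eq_le outer_measure_ge0 andbT; apply/lee_addgt0Pr => e e0; rewrite add0e.
pose M := dl * rho0 ^+ m.
have M0 : 0 < M by rewrite mulr_gt0// exprn_gt0.
have [k Hk] : exists k, M / e < 2 ^+ k.
  exists (Num.truncn (M / e)).+1; apply: (lt_trans (truncnS_gt _)).
  by rewrite -natrX ltr_nat; exact: ltn_expl.
apply: (@le_trans _ _ (wt (E `&` eball x (rk k)))).
  by apply: le_outer_measure; apply: setIS => z xz; exact: le_trans (ltW (rk_gt k)).
apply: (le_trans (decay k)); rewrite lee_fin /rhok expr_div_n mulrA -/M.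
rewrite ler_pdivrMr ?exprn_gt0 ?exprn_gt0// mulrC -ler_pdivrMr//.
apply: (le_trans (ltW Hk)); rewrite -exprM -[leLHS]mul1r.
apply: (@le_trans _ _ (4 ^+ k)).
  by rewrite mul1r lerXn2r ?nnegrE//; lra.
by rewrite ler_weXn2l ?leq_pmulr//; lra.
Qed.

Lemma disjoint_sum_le (mu : set 'rV[R]_n -> \bar R) (E : nat -> set 'rV[R]_n) K q :
  (forall A, (0 <= mu A)%E) ->
  (forall A B, cara2 A -> cara2 B -> A `<=` B -> (mu A <= mu B)%E) ->
  (forall A B, cara2 A -> cara2 B -> A `&` B = set0 -> (mu A + mu B <= mu (A `|` B))%E) ->
  cara2 K -> (forall i, (i < q)%N -> cara2 (E i)) ->
  (forall i j, (i < j < q)%N -> E i `&` E j = set0) ->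
  (\sum_(i < q) mu (E i `&` K) <= mu K)%E.
Proof.
move=> mu0 mule muU [cK cK'] cE dis.
have cI A : cara2 A -> cara2 (A `&` K).
  by move=> [h1 h2]; split; apply: caratheodory_measurable_setI.
have cF k : (k <= q)%N -> cara2 (\big[setU/set0]_(i < k) E i).
  elim: k => [_|k IH kq].
    by rewrite big_ord0; split; exact: caratheodory_measurable_set0.
  have [h1 h2] := IH (ltnW kq); have [h3 h4] := cE k kq.
  by rewrite big_ord_recr; split; apply: caratheodory_measurable_setU.
apply: (@le_trans _ _ (mu (\big[setU/set0]_(i < q) E i `&` K))); last first.
  by apply: mule; [apply: cI; exact: cF|split|move=> x []].
suff H k : (k <= q)%N -> (\sum_(i < k) mu (E i `&` K) <=
    mu (\big[setU/set0]_(i < k) E i `&` K))%E by exact: H.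
elim: k => [_|k IH kq]; first by rewrite [X in (X <= _)%E]big_ord0 mu0.
rewrite !big_ord_recr /= setIUl.
have cFk := cI _ (cF k (ltnW kq)); have cEk := cI _ (cE k kq).
apply: le_trans (muU _ _ cFk cEk _).
  by apply: leeD => //; apply: IH; exact: ltnW.
apply/seteqP; split=> // x [[]]; rewrite -bigcup_mkord => -[i /= ik Ei] _ [Ek _].
by have : (E i `&` E k) x by []; rewrite dis ?ik.
Qed.

(** The finiteness principle: a compact set meets the supports of boundedly many
    disjoint parts without boundary. *)
Lemma finite_parts K : compact K -> K `<=` U -> exists N, forall q (E : nat -> set 'rV[R]_n),
  (forall i, (i < q)%N -> cara2 (E i) /\ no_boundary U m V (E i)) ->
  (forall i j, (i < j < q)%N -> E i `&` E j = set0) ->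
  (forall i, (i < q)%N -> exists2 x, K x & forall r, 0 < r -> wt (E i `&` eball x r) <> 0%E) ->
  (q <= N)%N.
Proof.
move=> cK KU; have [r [K' [r0 cK' K'U KK']]] := compact_thickening oU cK KU.
have [c c0 vanish] := small_part_vanishes r0.
have wK' : wt K' \is a fin_num.
  by rewrite ge0_fin_numE ?outer_measure_ge0//; exact: (radon_compact rwt).
have nK' : nu K' \is a fin_num by rewrite ge0_fin_numE//; exact: nu_fin.
have c2K' : cara2 K' by split; [exact: (compact_cara rwt)|exact: (compact_cara rvar)].
exists (Num.truncn ((fine (wt K') + fine (nu K')) / c)).+1 => q E PE dis spE.
have cE i : (i < q)%N -> cara2 (E i) by move=> /PE[].
have sw : (\sum_(i < q) wt (E i `&` K') <= wt K')%E.
  apply: disjoint_sum_le => //.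
  - by move=> A B _ _; exact: le_outer_measure.
  - move=> A B [cA _] [cB _] AB; rewrite [leRHS]cA setUK setIUl setICr set0U.
    rewrite leeD2l//; apply: le_outer_measure => x Bx; split => // Ax.
    by have : (A `&` B) x by []; rewrite AB.
have sn : (\sum_(i < q) nu (E i `&` K') <= nu K')%E by exact: (disjoint_sum_le nu_ge0 nu_le nuU c2K' cE dis).
have big i : (i < q)%N -> (c%:E <= wt (E i `&` K') + nu (E i `&` K'))%E.
  move=> iq; have [x Kx Ex] := spE i iq; have [ci nEi] := PE i iq.
  rewrite leNgt; apply/negP => h.
  apply: (Ex (r / 2)); first by rewrite divr_gt0.
  have sub : E i `&` eball x r `<=` E i `&` K' by apply: setIS; exact: KK'.
  have c2 : cara2 (E i `&` K').
    by have [[h1 h2] [h3 h4]] := (ci, c2K'); split; apply: caratheodory_measurable_setI.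
  apply: vanish => //.
  - by apply: subset_trans K'U; exact: KK'.
  - apply: (le_trans (le_outer_measure _ _ _ sub)); apply: ltW; apply: le_lt_trans h.
    by rewrite leeDl.
  - apply: (le_trans (nu_le (cara2_eball _ _ ci) c2 sub)); apply: ltW; apply: le_lt_trans h.
    by rewrite leeDr// outer_measure_ge0.
rewrite -(ler_nat R); apply: ltW; apply: le_lt_trans (truncnS_gt _).
rewrite ler_pdivlMr// -lee_fin EFinD !fineK//.
apply: le_trans (leeD sw sn); rewrite -big_split /=.
apply: (@le_trans _ _ (\sum_(i < q) c%:E)%E); last by apply: lee_sum => i _; exact: big.
by rewrite sumEFin lee_fin big_const_ord iter_addr_0 mulr_natl.
Qed.

End parts.

(** * Curvature hypotheses *)

(** The case of a nonpositive [alpha m] is vacuous: no density could reach [1], and the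
    measure would vanish. *)
Lemma density_lower_bound {R : realType} {n : nat} (m : nat) (U : set 'rV[R]_n)
    (mu : {outer_measure set 'rV[R]_n -> \bar R}) :
  mu [set x | ~ exists2 l : \bar R, density_is m mu x l & (1 <= l)%E] = 0%E ->
  exists2 a : R, 0 < a & mu [set y | U y /\
    ~ exists2 t, 0 < t & forall s, 0 < s < t -> ((a * s ^+ m)%:E <= mu (eball y s))%E] = 0%E.
Proof.
move=> H0; set al : R := alpha m.
have ev x l : density_is m mu x l -> (1 <= l)%E -> exists2 t : R, 0 < t &
    forall s, 0 < s < t -> (2^-1%:E < mu (eball x s) * ((al * s ^+ m)^-1)%:E)%E.
  move=> dx l1; have h : (2^-1%:E < l)%E.
    by apply: lt_le_trans l1; rewrite lte_fin invf_lt1// ltr1n.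
  have := dx _ (open_ereal_gt' h) => -[t /= t0 Ht]; exists t => // s /andP[s0 st].
  by apply: (Ht s) => //=; rewrite sub0r normrN gtr0_norm.
have [al0|al0] := ltP 0 al.
  exists (al / 2); first by rewrite divr_gt0.
  apply: (outer_measure_null_sub _ H0) => y [Uy nt] [l dy l1]; apply: nt.
  have [t t0 Ht] := ev y l dy l1; exists t => // s /[dup] st /andP[s0 _].
  have b0 : 0 < al * s ^+ m by rewrite mulr_gt0// exprn_gt0.
  have := Ht s st; rewrite -lte_pdivrMr ?invr_gt0// => /ltW.
  by congr (_ <= _)%E; rewrite -EFinM invrK mulrC mulrAC.
exists 1 => //; apply: (outer_measure_null_sub _ H0) => y _ [l dy l1].
have [t t0 Ht] := ev y l dy l1.
have c : 0 < t / 2 < t by rewrite divr_gt0//=; lra.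
have := Ht _ c; rewrite ltNge => /negP[]; apply: (@le_trans _ _ 0%E); last by rewrite lee_fin invr_ge0.
rewrite mule_ge0_le0 ?outer_measure_ge0// lee_fin invr_le0 mulr_le0_ge0//.
by rewrite exprn_ge0// divr_ge0// ltW.
Qed.

Section first_variation_as_integral.
Context {R : realType} {n : nat} (p : nat).
Local Notation m := p.+1.
Variable U : set 'rV[R]_n.
Variable V : {outer_measure set ('rV[R]_n * 'M[R]_n)%type -> \bar R}.
Hypotheses (oU : open U) (vV : varifold U m V).
Local Notation var := (var_measure U V).
Local Notation wt := (weight m V).
Hypothesis rvar : radon U var.
Let rwt : radon U wt := radon_weight oU vV.
Let SD := first_varD oU vV.
Let SZ := first_varZ oU vV.

Variable h : 'rV[R]_n -> 'rV[R]_n.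
Hypothesis Lh : Lploc U m wt h.
Hypothesis hV : forall th, test_fun U th ->
  first_var V th = - ointR wt (fun x => dot (h x) (th x)).

Let mw := cara_measure wt.
Let mh : cmeas wt (fun x => enorm (h x)). Proof. by case: Lh => o _; exact: cmeas_enorm. Qed.

Let mh1 D : measurable_fun (D : set (caratheodory_type wt)) (fun x => (enorm (h x))%:E).
Proof. by apply: measurable_funTS; apply/measurable_EFinP. Qed.

Let mhk k D : measurable_fun (D : set (caratheodory_type wt)) (fun x => (enorm (h x) ^+ k)%:E).
Proof. by apply: measurable_funTS; apply/measurable_EFinP; exact: measurable_funX. Qed.

Definition curv_mass (A : set 'rV[R]_n) : \bar R := oint wt A (fun x => (enorm (h x) ^+ m)%:E).
Definition curv_integral (A : set 'rV[R]_n) : \bar R := oint wt A (fun x => (enorm (h x))%:E).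

Lemma curv_mass_ge0 A : (0 <= curv_mass A)%E.
Proof. by apply: integral_ge0 => x _; rewrite lee_fin exprn_ge0// enorm_ge0. Qed.

Lemma curv_mass_le A B : wt.-caratheodory A -> wt.-caratheodory B -> A `<=` B ->
  (curv_mass A <= curv_mass B)%E.
Proof.
move=> cA cB AB; apply: (@ge0_subset_integral _ _ _ mw) => // x _.
by rewrite lee_fin exprn_ge0// enorm_ge0.
Qed.

Lemma curv_massU A B : wt.-caratheodory A -> wt.-caratheodory B -> A `&` B = set0 ->
  (curv_mass A + curv_mass B <= curv_mass (A `|` B))%E.
Proof.
move=> cA cB AB; rewrite /curv_mass /oint (@ge0_integral_setU _ _ _ mw)//.
- by move=> x _; rewrite lee_fin exprn_ge0// enorm_ge0.
- by apply/disj_set2P.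
Qed.

Let var_open_le G : open G -> G `<=` U -> (var G <= curv_integral G)%E.
Proof.
move=> oG GU; rewrite (variation_open oU SD SZ)//; apply: ub_ereal_sup => _ [th [t tG t1] <-].
rewrite hV//; pose f x := dot (h x) (th x).
have mf : cmeas wt f.
  apply: (@measurable_sum _ (caratheodory_type wt)) => i.
  apply: (@measurable_funM _ (caratheodory_type wt)).
    by apply: omeasurable_coord; case: Lh.
  apply: (radon_cmeas rwt) => z; apply: (@continuous_comp _ _ _ th (fun u : 'rV[R]_n => u ord0 i)); last exact: coord_continuous.
  by have [s _ _] := t; exact: smooth_continuous.
have cG := radon_open rwt oG.
apply: (@le_trans _ _ (`|oint wt setT (EFin \o f)|)%E).
  rewrite /ointR; case: (oint _ _ _) => [y||] //=; rewrite ?oppr0 ?lee_fin ?leey//.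
  by rewrite (le_trans (ler_norm _))// normrN.
apply: (le_trans (@le_abse_integral _ _ _ mw setT _ measurableT _)).
  exact/measurable_EFinP.
rewrite /curv_integral /oint [leRHS](@integral_mkcond _ _ _ mw).
apply: (@ge0_le_integral _ _ _ mw) => //.
- by apply: measurableT_comp => //; exact/measurable_EFinP.
- exact/(measurable_restrictT _ _).1.
move=> x _ /=; rewrite patchE; case: ifPn => [_|/negP nG].
  rewrite lee_fin; apply: (le_trans (dot_le _ _)).
  by rewrite ler_piMr ?enorm_ge0.
have th0 : th x = 0 by apply: fun_spt0 => /tG Gx; apply: nG; rewrite mem_set.
by rewrite /f th0 -(scale0r 0) dotZr mul0r normr0.
Qed.

(** When the first variation is the integral of a vector field, so is the variation
    measure controlled on measurable sets, by outer regularity and the absolute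
    continuity of the integral. *)
Lemma var_le_integral A K : wt.-caratheodory A -> compact K -> K `<=` U -> A `<=` K ->
  (var A <= curv_integral A)%E.
Proof.
move=> cA cK KU AK; apply/lee_addgt0Pr => e e0.
have [r [K' [r0 cK' K'U KK']]] := compact_thickening oU cK KU.
have cwK' : wt.-caratheodory K' := compact_cara rwt cK'.
pose W := \bigcup_(y in K) oball y r.
have oW : open W by apply: bigcup_open => y _; exact: oball_open.
have WK' : W `<=` K' by move=> z [y Ky /oball_sub_eball yz]; exact: KK' Ky _ yz.
have AW : A `<=` W by move=> z /AK Kz; exists z => //; rewrite /oball /= subrr enorm0.
have Aoo : (wt A < +oo)%E.
  by apply: le_lt_trans (radon_compact rwt cK KU); exact: le_outer_measure.
pose f x : R := \1_K' x * enorm (h x).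
have intf : mw.-integrable setT (EFin \o f).
  apply: (@le_integrable _ _ _ mw setT measurableT _
    (EFin \o (fun x => \1_K' x + \1_K' x * enorm (h x) ^+ m))).
  - apply/measurable_EFinP; exact: cmeas_indicM.
  - move=> x _ /=; rewrite lee_fin /f indicE; case: (x \in K'); rewrite ?mul0r ?addr0 ?normr0// !mul1r.
    have t0 := enorm_ge0 (h x); have tm := exprn_ge0 p t0.
    rewrite !ger0_norm ?addr_ge0 ?exprn_ge0//.
    have [t1|t1] := leP (enorm (h x)) 1; first by apply: (le_trans t1); rewrite lerDl exprn_ge0.
    apply: (@le_trans _ _ (enorm (h x) ^+ m)); last by rewrite lerDr.
    by rewrite ler_eXnr// ltW.
  have e1 : mw.-integrable setT (EFin \o (\1_K' : 'rV[R]_n -> R)).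
    apply: bfin_integrable; first exact: caratheodory_setT.
    by apply: indic_bfin => //; exact: (radon_compact rwt).
  have e2 : mw.-integrable setT (EFin \o (fun x => \1_K' x * enorm (h x) ^+ m)).
    apply/integrableP; split.
      by apply/measurable_EFinP; apply: cmeas_indicM => //; exact: measurable_funX.
    have [_ /(_ K' cK' K'U)] := Lh; apply: le_lt_trans.
    rewrite /oint [leRHS](@integral_mkcond _ _ _ mw) le_eqVlt; apply/orP; left; apply/eqP.
    apply: eq_integral => x _ /=; rewrite patchE indicE; case: (x \in K').
      by rewrite mul1r ger0_norm// exprn_ge0// enorm_ge0.
    by rewrite mul0r normr0.
  exact: (integrableD measurableT e1 e2).
have [d [d0 Hd]] := integral_normr_continuous intf e0.
have d20 : 0 < d / 2 by rewrite divr_gt0.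
have [ O [oO AO Ole]] := radon_outer rwt d20 Aoo.
pose G := O `&` W.
have oG : open G by exact: openI.
have AG : A `<=` G.
  by move=> x Ax; split; [apply: AO; split => //; apply: KU; exact: AK|exact: AW].
have GK' : G `<=` K' by move=> x [_ /WK'].
have cG := radon_open rwt oG.
have cGA : wt.-caratheodory (G `\` A) by exact: caratheodory_measurable_setD.
have Gle : (wt G <= wt A + (d / 2)%:E)%E.
  by apply: le_trans Ole; apply: le_outer_measure => x [].
have small : (wt (G `\` A) < d%:E)%E.
  apply: le_lt_trans (excess_le cA AG Aoo Gle) _; rewrite lte_fin; lra.
apply: (@le_trans _ _ (var G)); first exact: le_outer_measure.
apply: (le_trans (var_open_le oG _)); first by apply: subset_trans K'U.
rewrite -(setDUK AG) /curv_integral /oint (@ge0_integral_setU _ _ _ mw)//; last 2 first.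
- by move=> x _; rewrite lee_fin enorm_ge0.
- by apply/disj_set2P; apply/seteqP; split=> // x [Ax []].
apply: leeD => //.
have := Hd _ cGA small; rewrite -lte_fin => /ltW; apply: le_trans.
rewrite /Rintegral fineK.
  apply: (@ge0_le_integral _ _ _ mw) => //.
  - by move=> x _; rewrite lee_fin enorm_ge0.
  - apply: measurable_funTS; apply/measurable_EFinP; apply: measurableT_comp => //.
    exact: cmeas_indicM.
  move=> x [Gx _]; rewrite lee_fin /f indicE mem_set ?mul1r ?ger0_norm ?enorm_ge0//.
  exact: GK'.
apply: (@integral_fune_fin_num _ _ _ mw) => //.
have ia := integrable_abse intf.
by apply: (@integrableS _ _ _ mw setT).
Qed.

(** Young's inequality turns local integrability of the power [m] of the mean
    curvature into a scale invariant smallness of the variation measure. *)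
Lemma curvature_young (d eta : R) : 0 < d -> 0 < eta -> exists2 c, 0 < c &
  forall A K rho, wt.-caratheodory A -> compact K -> K `<=` U -> A `<=` K -> 0 < rho ->
    (wt A <= (d * rho ^+ m)%:E)%E -> (curv_mass A <= c%:E)%E ->
    (rho%:E * var A <= (eta * rho ^+ m)%:E)%E.
Proof.
move=> d0 eta0; pose b := eta / (2 * d).
have b0 : 0 < b by rewrite divr_gt0// mulr_gt0.
exists (eta / 2 * b ^+ p); first by rewrite mulr_gt0 ?divr_gt0 ?exprn_gt0.
move=> A K rho cA cK KU AK rho0 wA nA.
apply: (@le_trans _ _ (rho%:E * curv_integral A)%E).
  apply: lee_wpmul2l; first by rewrite lee_fin ltW.
  exact: (var_le_integral cA cK KU AK).
pose k := rho ^+ m / b ^+ p.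
have k0 : 0 <= k by rewrite divr_ge0 ?exprn_ge0 ?(ltW b0) ?(ltW rho0).
have bm : measurable_fun (A : set (caratheodory_type wt)) (fun=> b%:E) by exact: measurable_cst.
apply: (@le_trans _ _ (b%:E * wt A + k%:E * curv_mass A)%E).
  have f1 x : A x -> (0 <= (enorm (h x))%:E)%E by move=> _; rewrite lee_fin enorm_ge0.
  have fm x : A x -> (0 <= (enorm (h x) ^+ m)%:E)%E.
    by move=> _; rewrite lee_fin exprn_ge0// enorm_ge0.
  have kfm x : A x -> (0 <= k%:E * (enorm (h x) ^+ m)%:E)%E.
    by move=> Ax; apply: mule_ge0; [rewrite lee_fin|exact: fm].
  have bA x : A x -> (0 <= b%:E)%E by move=> _; rewrite lee_fin ltW.
  have mk : measurable_fun (A : set (caratheodory_type wt))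
      (fun x => k%:E * (enorm (h x) ^+ m)%:E)%E by apply: measurable_funeM; exact: mhk.
  have I1 := @ge0_integralZl_EFin _ _ _ mw A cA _ f1 (@mh1 A) rho (ltW rho0).
  have I2 := @ge0_integralZl_EFin _ _ _ mw A cA _ fm (@mhk m A) k k0.
  have I3 := @ge0_integralD _ _ _ mw A cA _ _ bA bm kfm mk.
  have I4 := @integral_cst _ _ _ mw A cA b%:E.
  rewrite /curv_integral /curv_mass /oint -I1 -I2 -[X in (_ <= X + _)%E]I4 -I3.
  apply: (@ge0_le_integral _ _ _ mw) => //.
  - by move=> x _; rewrite -EFinM lee_fin mulr_ge0 ?enorm_ge0 ?(ltW rho0).
  - by apply: measurable_funeM; exact: mh1.
  - by apply: emeasurable_funD => //; apply: measurable_funeM; exact: mhk.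
  move=> x _; rewrite -!EFinM -EFinD lee_fin.
  have u0 : 0 <= rho * enorm (h x) by rewrite mulr_ge0 ?enorm_ge0 ?(ltW rho0).
  rewrite /k mulrAC -exprMn; move: u0; set u := rho * _ => u0.
  have [ub|bu] := leP u b; first by apply: (le_trans ub); rewrite lerDl divr_ge0 ?exprn_ge0 ?(ltW b0).
  apply: (@le_trans _ _ (u ^+ m / b ^+ p)); last by rewrite lerDr ltW.
  rewrite ler_pdivlMr ?exprn_gt0// exprS ler_wpM2l// lerXn2r ?nnegrE ?(ltW bu) ?(ltW b0)//.
apply: (@le_trans _ _ (b%:E * (d * rho ^+ m)%:E + k%:E * (eta / 2 * b ^+ p)%:E)%E).
  by apply: leeD; apply: lee_wpmul2l => //; rewrite lee_fin ltW.
rewrite -!EFinM -EFinD lee_fin le_eqVlt; apply/orP; left; apply/eqP.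
have bd : b * d = eta / 2 by rewrite /b; field; rewrite gt_eqF.
have kb : k * (eta / 2 * b ^+ p) = eta / 2 * rho ^+ m.
  by rewrite /k; field; rewrite expf_neq0// gt_eqF.
by rewrite kb mulrA bd; field.
Qed.

End first_variation_as_integral.

(** * Clopen subsets of the support *)

Section finitely_many_parts.
Context {R : realType} {n : nat} (m : nat).
Variable U : set 'rV[R]_n.
Variable V : {outer_measure set ('rV[R]_n * 'M[R]_n)%type -> \bar R}.
Local Notation var := (var_measure U V).
Local Notation wt := (weight m V).

Definition closed_part E := [/\ wt.-caratheodory E, var.-caratheodory E & no_boundary U m V E].

(** The only consequence of the density and curvature hypotheses that concerns the
    topology of the support. *)
Definition finite_parts_property := forall K, compact K -> K `<=` U ->
  exists N, forall q (E : nat -> set 'rV[R]_n),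
  (forall i, (i < q)%N -> closed_part (E i)) ->
  (forall i j, (i < j < q)%N -> E i `&` E j = set0) ->
  (forall i, (i < q)%N -> exists2 x, K x & forall r, 0 < r -> wt (E i `&` eball x r) <> 0%E) ->
  (q <= N)%N.

Lemma finite_parts_property_holds : (0 < m)%N -> open U -> varifold U m V -> radon U var ->
  wt [set x | ~ exists2 l : \bar R, density_is m wt x l & (1 <= l)%E] = 0%E ->
  ((1 < m)%N -> Lploc U m wt (mean_curv U m V) /\
     forall theta, test_fun U theta ->
       first_var V theta = - ointR wt (fun x => dot (mean_curv U m V x) (theta x))) ->
  finite_parts_property.
Proof.
rewrite /finite_parts_property /closed_part.
case: m => // p _ oU vV rvar dens curv K cK KU.
have [a a0 low] := density_lower_bound U dens.
have rwt := radon_weight oU vV.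
have [N HN] : exists N, forall q (E : nat -> set 'rV[R]_n),
  (forall i, (i < q)%N -> cara2 p U V (E i) /\ no_boundary U p.+1 V (E i)) ->
  (forall i j, (i < j < q)%N -> E i `&` E j = set0) ->
  (forall i, (i < q)%N -> exists2 x, K x &
     forall r, 0 < r -> weight p.+1 V (E i `&` eball x r) <> 0%E) -> (q <= N)%N.
  case: p vV dens curv low rwt => [|p] vV dens curv low rwt.
    apply: (@finite_parts _ _ 0 U V oU vV rvar a a0 low (var_measure U V)) => //.
    - by move=> K' cK' K'U; exact: (radon_compact rvar).
    - by move=> A B _ _; exact: le_outer_measure.
    - move=> A B [_ cA] [_ cB] AB; rewrite [leRHS]cA setUK setIUl setICr set0U.
      apply: leeD => //; apply: le_outer_measure => x Bx; split => // Ax.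
      by have : (A `&` B) x by []; rewrite AB.
    move=> d eta d0 eta0; exists eta => // A K' rho _ _ _ _ rho0 _ vA.
    rewrite expr1 mulrC EFinM; apply: lee_wpmul2l => //.
    by rewrite lee_fin ltW.
  have [Lh hV] := curv isT.
  apply: (@finite_parts _ _ p.+1 U V oU vV rvar a a0 low (curv_mass p.+1 V (mean_curv U p.+2 V))) => //.
  - by move=> A; exact: curv_mass_ge0.
  - by move=> K' cK' K'U; have [_ ] := Lh; apply.
  - by move=> A B [cA _] [cB _]; exact: (curv_mass_le Lh cA cB).
  - by move=> A B [cA _] [cB _]; exact: (curv_massU Lh cA cB).
  move=> d eta d0 eta0.
  have [c c0 H] := curvature_young oU vV Lh hV d0 eta0.
  by exists c => // A K' rho [cA _]; exact: H.
exists N => q E PE dis spE; apply: (HN q E) => // i /PE[] //.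
Qed.

End finitely_many_parts.

Section support.
Context {R : realType} {n : nat}.
Variables (U : set 'rV[R]_n) (mu : {outer_measure set 'rV[R]_n -> \bar R}).
Hypotheses (oU : open U) (rmu : radon U mu).
Local Notation S := (spt U mu).

Lemma spt_relopen_pos B x r : relopen S B -> B x -> 0 < r -> mu (B `&` eball x r) <> 0%E.
Proof.
move=> [ O oO ->] [Sx Ox] r0 H.
have [_ /(_ (O `&` eball x r))] := (sptP rmu x).1 Sx; apply.
  by apply: filterI; [exact: open_nbhs_nbhs|exact: filterS (@oball_sub_eball _ _ x r) (nbhs_oball x r0)].
apply: (outer_measure_null_sub (B := (S `&` O `&` eball x r) `|` ~` S)).
  by move=> z [Oz xz]; have [Sz|nS] := pselect (S z); [left|right].
by rewrite outer_measureU0//; exact: spt_complement_null rmu.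
Qed.

End support.

Section clopen.
Context {R : realType} {n : nat}.
Variable S : set 'rV[R]_n.
Local Notation clopen := (clopen_in S).

Lemma relopen_sub (E : set 'rV[R]_n) : relopen S E -> E `<=` S.
Proof. by move=> [ O _ ->] x []. Qed.

Lemma clopenS : clopen S.
Proof.
split; first by exists setT; [exact: openT|rewrite setIT].
by exists set0; [exact: open0|rewrite setDv setI0].
Qed.

Lemma clopenD E : clopen E -> clopen (S `\` E).
Proof.
move=> [h1 h2]; split => //; rewrite setDD (_ : S `&` E = E)//.
by apply/setIidPr; exact: relopen_sub.
Qed.

Lemma relopenI E F : relopen S E -> relopen S F -> relopen S (E `&` F).
Proof.
move=> [ O oO ->] [P oP ->]; exists (O `&` P); first exact: openI.
by rewrite setIACA setIid.
Qed.

Lemma relopenU E F : relopen S E -> relopen S F -> relopen S (E `|` F).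
Proof.
move=> [ O oO ->] [P oP ->]; exists (O `|` P); first exact: openU.
by rewrite setIUr.
Qed.

Lemma clopenI E F : clopen E -> clopen F -> clopen (E `&` F).
Proof.
move=> [h1 h2] [h3 h4]; split; first exact: relopenI.
rewrite setDIr; exact: relopenU.
Qed.

Lemma relopen_bigcup (I : Type) (P : set I) (F : I -> set 'rV[R]_n) :
  (forall i, P i -> relopen S (F i)) -> relopen S (\bigcup_(i in P) F i).
Proof.
move=> H; exists (\bigcup_(O in [set O | open O /\ exists2 i, P i & S `&` O = F i]) O).
  by apply: bigcup_open => O [].
apply/seteqP; split=> x.
  move=> [i Pi Fx]; have [ O oO E] := H i Pi.
  have : (S `&` O) x by rewrite -E.
  by move=> [Sx Ox]; split => //; exists O => //; split => //; exists i.
by move=> [Sx [ O [oO [i Pi E]] Ox]]; exists i => //; rewrite -E.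
Qed.

(** Quasi-components; they coincide with the connected components as soon as they are
    relatively open. *)
Definition quasi_component x := \bigcap_(E in [set E | clopen E /\ E x]) E.

Lemma quasi_component_refl x : quasi_component x x.
Proof. by move=> E []. Qed.

Lemma quasi_component_eq x y : S x -> quasi_component x y -> quasi_component y = quasi_component x.
Proof.
move=> Sx xy; suff H E : clopen E -> (E x <-> E y).
  by apply/seteqP; split=> z h E [cE Ez]; apply: h; split => //; apply/(H _ cE).
move=> cE; split=> [Ex|Ey]; first exact: xy.
apply: contrapT => nE; have [] : (S `\` E) y by apply: xy; split => //; exact: clopenD.
by [].
Qed.

Hypothesis quasi_open : forall x, S x -> exists2 B, nbhs x B & S `&` B `<=` quasi_component x.

Lemma quasi_component_clopen x : S x -> clopen (quasi_component x).
Proof.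
move=> Sx; have QS : quasi_component x `<=` S.
  by move=> y; apply; split => //; exact: clopenS.
split.
  exists (quasi_component x `|` ~` S)^°; first exact: open_interior.
  apply/seteqP; split=> y; last by move=> [Sy /interior_subset[]].
  move=> xy; have Sy := QS _ xy; split => //.
  have [B By BQ] := quasi_open Sy; apply: filterS By => z Bz.
  have [Sz|nS] := pselect (S z); last by right.
  by left; rewrite -(quasi_component_eq Sx xy); exact: BQ.
rewrite (_ : S `\` _ = \bigcup_(E in [set E | clopen E /\ E x]) (S `\` E)).
  by apply: relopen_bigcup => E [[]].
apply/seteqP; split=> y.
  by move=> [Sy nQ]; apply: contrapT => h; apply: nQ => E [cE Ex]; apply: contrapT => nE; apply: h; exists E.
by move=> [E [cE Ex] [Sy nE]]; split => // /(_ E (conj cE Ex)).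
Qed.

Lemma quasi_component_connected x : S x -> connected (quasi_component x).
Proof.
move=> Sx; have [[Oa oO1 E1] [Ob oO2 E2]] := quasi_component_clopen Sx.
set Q := quasi_component x in E1 E2 *.
move=> B [y By] [ O oO EB] [D cD EB'].
have Qy : Q y by rewrite EB in By; case: By.
suff cB : clopen B.
  apply/seteqP; split=> z; first by rewrite EB => -[].
  by rewrite /Q -(quasi_component_eq Sx Qy); apply.
split.
  by exists (Oa `&` O); [exact: openI|rewrite EB E1 setIA].
rewrite (_ : S `\` B = (S `\` Q) `|` (Q `&` ~` D)).
  apply: relopenU; first by exists Ob.
  by exists (Oa `&` ~` D); [apply: openI => //; exact: closed_openC|rewrite setIA -E1].
apply/seteqP; split=> z.
  move=> [Sz nB]; have [Qz|nQ] := pselect (Q z); last by left.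
  by right; split => // Dz; apply: nB; rewrite EB'.
move=> [[Sz nQ]|[Qz nD]]; first by split => //; rewrite EB => -[].
by split; [move: Qz; rewrite E1 => -[]|rewrite EB' => -[]].
Qed.

Lemma connected_component_quasi x : S x -> connected_component S x = quasi_component x.
Proof.
move=> Sx; apply/seteqP; split.
  apply: bigcup_sub => A [Ax AS cA] y Ay E [[[Oa oO1 E1] [Ob oO2 E2]] Ex].
  have : A `&` Oa = A.
    apply: cA.
    - by exists x; split => //; move: Ex; rewrite E1 => -[].
    - by exists Oa.
    exists (~` Ob); first exact: open_closedC.
    apply/seteqP; split=> z [Az h]; split => //.
      move=> O2z; have : (S `\` E) z by rewrite E2; split => //; exact: AS.
      by move=> [_]; rewrite E1; apply; split => //; exact: AS.
    apply: contrapT => nO; apply: h; have : (S `\` E) z.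
      by split; [exact: AS|rewrite E1 => -[]].
    by rewrite E2 => -[].
  by move=> AO; rewrite E1; split; [exact: AS|rewrite -AO in Ay; case: Ay].
apply: connected_component_max.
- exact: quasi_component_refl.
- by move=> y; apply; split => //; exact: clopenS.
- exact: quasi_component_connected.
Qed.

End clopen.

(** * Connected components of the support *)

Section components_of_support.
Context {R : realType} {n : nat} (m : nat).
Variable U : set 'rV[R]_n.
Variable V : {outer_measure set ('rV[R]_n * 'M[R]_n)%type -> \bar R}.
Local Notation var := (var_measure U V).
Local Notation wt := (weight m V).
Hypotheses (oU : open U) (vV : varifold U m V) (rvar : radon U var).
Hypothesis fp : finite_parts_property m U V.
Let rwt : radon U wt := radon_weight oU vV.
Local Notation S := (spt U wt).

Lemma clopen_closed_part E : clopen_in S E -> closed_part m U V E.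
Proof.
move=> cE; split; [exact: (clopen_cara oU vV rwt cE)|exact: (clopen_cara oU vV rvar cE)|].
exact: (clopen_no_boundary oU vV rvar cE).
Qed.

(** Infinitely many successive splittings near [x] would produce infinitely many
    disjoint parts without boundary meeting a compact ball. Hence some clopen set
    around [x] cannot be split any further inside the ball, and there it agrees with
    the quasi-component. *)
Lemma spt_quasi_open x : S x -> exists2 B, nbhs x B & S `&` B `<=` quasi_component S x.
Proof.
move=> Sx; have Ux : U x by case: Sx.
have [|r r0 rU] := @nbhs_eball _ _ x U; first by apply: open_nbhs_nbhs; split.
pose K := eball x r; have cK : compact K by exact: eball_compact.
have [E [cE Ex] EK] : exists2 E, clopen_in S E /\ E x & forall F, clopen_in S F -> F x ->
    F `<=` E -> (E `\` F) `&` K = set0.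
  apply: contrapT => none.
  have /choice[f fP] : forall E, exists F, clopen_in S E /\ E x ->
      [/\ clopen_in S F, F x, F `<=` E & (E `\` F) `&` K !=set0].
    move=> E; have [cE|nE] := pselect (clopen_in S E /\ E x); last by exists E.
    apply: contrapT => h; apply: none; exists E => // F cF Fx FE; apply/eqP.
    by apply/negPn/negP => /set0P ne; apply: h; exists F.
  pose E := fix E k := if k is k'.+1 then f (E k') else S.
  have PE k : clopen_in S (E k) /\ E k x.
    by elim: k => [|k /fP[]//]; split => //; exact: clopenS.
  have mono k l : (k <= l)%N -> E l `<=` E k.
    elim: l => [|l IH]; first by rewrite leqn0 => /eqP ->.
    rewrite leq_eqVlt => /predU1P[->//|/IH]; apply: subset_trans.
    by have [_ _ + _] := fP _ (PE l).
  have [N HN] := fp cK rU.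
  suff : (N.+1 <= N)%N by rewrite ltnn.
  have cD k : clopen_in S (E k `\` E k.+1).
    rewrite (_ : _ `\` _ = E k `&` (S `\` E k.+1)).
      by apply: clopenI; [exact: (PE _).1|apply: clopenD; exact: (PE _).1].
    apply/seteqP; split=> z [Ez]; last by move=> [_ nE]; split.
    by move=> nE; split => //; split => //; apply: relopen_sub Ez; case: (PE k) => -[].
  apply: (HN _ (fun k => E k `\` E k.+1)).
  - by move=> k _; exact: clopen_closed_part.
  - move=> i j /andP[ij _]; apply/seteqP; split=> // z [[_ nE] [Ez _]].
    by apply: nE; exact: mono Ez.
  - move=> k _; have [_ _ _ [z [Ez Kz]]] := fP _ (PE k).
    by exists z => // s s0; apply: (spt_relopen_pos rwt) => //; case: (cD k).
have [[ O oO EO] _] := cE.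
exists (O `&` K).
  apply: filterI; last exact: filterS (@oball_sub_eball _ _ x r) (nbhs_oball x r0).
  by apply: open_nbhs_nbhs; split => //; move: Ex; rewrite EO => -[].
move=> y [Sy [Oy Ky]] F [cF Fx]; have Ey : E y by rewrite EO.
apply: contrapT => nF; have := EK _ (clopenI cE cF) (conj Ex Fx) (@subIsetl _ _ _).
by move/seteqP => [/(_ y) + _]; apply; split => //; split => // -[].
Qed.

Lemma component_clopen C : components S C -> clopen_in S C.
Proof.
move=> [x Sx <-]; rewrite (connected_component_quasi spt_quasi_open Sx).
exact: (quasi_component_clopen spt_quasi_open Sx).
Qed.

Lemma component_sub C : components S C -> C `<=` S.
Proof. by move=> /component_clopen[h _]; exact: relopen_sub h. Qed.

Lemma component_eq C x : components S C -> C x -> C = connected_component S x.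
Proof.
move=> [y Sy <-] yx; exact: same_connected_component.
Qed.

Lemma component_spt C : components S C -> spt U (orestr wt C) = C.
Proof.
move=> PC; have [h1 h2] := component_clopen PC.
have CS := component_sub PC.
apply/seteqP; split=> x.
  move=> [Ux nx]; apply: contrapT => nC; apply: nx.
  have [[P oP EC] [ O oO EO]] := (h1, h2).
  exists (U `&` ((U `\` S) `|` O)); last first.
    split => //; have [Sx|nS] := pselect (S x); last by left.
    by right; have : (S `\` C) x by []; rewrite EO => -[].
  split; first by exists ((U `\` S) `|` O) => //; apply: openU => //; exact: (open_off_spt oU vV).
  rewrite /= /orestr (_ : C `&` _ = set0) ?outer_measure0//.
  apply/seteqP; split=> // z [Cz [Uz [[_ nS]|Oz]]]; first by apply: nS; exact: CS.
  by have : (S `&` O) z; [split => //; exact: CS|rewrite -EO => -[]].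
move=> Cx; have Sx := CS _ Cx; have [Ux _] := Sx.
split => // -[G [[ O oO EG] G0] Gx].
have Ox : O x by move: Gx; rewrite EG => -[].
have [|r r0 rO] := @nbhs_eball _ _ x (U `&` O).
  by apply: filterI; apply: open_nbhs_nbhs; split.
apply: (spt_relopen_pos rwt h1 Cx r0).
have {}G0 : wt (C `&` (U `&` O)) = 0%E by rewrite -EG.
by apply: (outer_measure_null_sub _ G0); exact: setIS.
Qed.

Lemma finite_components K : compact K -> K `<=` U ->
  finite_set (components S `&` [set C | C `&` K !=set0]).
Proof.
move=> cK KU; apply: contrapT => inf; have [N HN] := fp cK KU.
have [B BP NB] := infinite_set_fset N.+1 inf.
pose E i := nth set0 (finmap.enum_fset B) i.
have EB i : (i < N.+1)%N -> components S (E i) /\ E i `&` K !=set0.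
  by move=> iN; apply: BP; apply: mem_nth; exact: leq_trans NB.
suff : (N.+1 <= N)%N by rewrite ltnn.
apply: (HN _ E).
- by move=> i /EB[h _]; apply: clopen_closed_part; exact: component_clopen.
- move=> i j /andP[ij jN]; apply/seteqP; split=> // x [Ei Ej].
  have [Ci _] := EB i (ltn_trans ij jN); have [Cj _] := EB j jN.
  have /eqP := etrans (component_eq Ci Ei) (esym (component_eq Cj Ej)).
  rewrite nth_uniq ?finmap.fset_uniq//; try exact: leq_trans NB.
    by rewrite ltn_eqF.
  by apply: leq_trans NB; exact: ltn_trans jN.
- move=> i iN; have [Ci [x [Ex Kx]]] := EB i iN; exists x => // r r0.
  by apply: (spt_relopen_pos rwt) => //; case: (component_clopen Ci).
Qed.

End components_of_support.

(** * Members of a decomposition *)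

Section decompositions.
Context {R : realType} {n : nat} (m : nat).
Variable U : set 'rV[R]_n.
Local Notation vmeas := {outer_measure set ('rV[R]_n * 'M[R]_n)%type -> \bar R}.
Local Notation G := (@Grass R n m).
Implicit Types W X : vmeas.
Local Notation sptw W := (spt U (weight m W)).

(** A proper relatively clopen piece of the support would decompose the varifold. *)
Lemma indecomposable_connected_spt W : open U -> indecomposable U m W -> connected (sptw W).
Proof.
move=> oU [vW rvarW indec]; have rwW := radon_weight oU vW.
move=> B Bne [ O oO EB] [D cD EB']; apply: contrapT => BS.
have cB : clopen_in (sptw W) B.
  split; first by exists O.
  exists (~` D); first exact: closed_openC.
  apply/seteqP; split=> z [Sz h]; split => //; first by move=> Dz; apply: h; rewrite EB'.
  by rewrite EB' => -[].
have BsubS : B `<=` sptw W by rewrite EB => z [].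
have pos C z : relopen (sptw W) C -> C z -> (0 < weight m W C)%E.
  move=> rC Cz; rewrite lt0e outer_measure_ge0 andbT; apply/eqP => C0.
  by apply: (spt_relopen_pos rwW rC Cz ltr01); apply: (outer_measure_null_sub _ C0) => ? [].
apply: indec; exists B; split.
- split; first by move=> z /BsubS[].
  move=> X; rewrite {1}(clopen_cara oU vW rwW cB X) {1}(clopen_cara oU vW rvarW cB X).
  by rewrite addeACA.
- by have [z Bz] := Bne; apply: (pos B z) => //; case: cB.
- have [z [Sz nB]] : sptw W `\` B !=set0.
    apply/set0P/negP => /eqP; rewrite setD_eq0 => SB; apply: BS; apply/seteqP; split => //.
  apply: lt_le_trans (pos _ z cB.2 (conj Sz nB)) _; apply: le_outer_measure => y [[Uy _] nBy].
  by split.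
- exact: (clopen_no_boundary oU vW rvarW cB).
Qed.

Variable V : vmeas.
Local Notation var := (var_measure U V).
Local Notation wt := (weight m V).
Hypotheses (oU : open U) (vV : varifold U m V) (rvar : radon U var).
Let rwt : radon U wt := radon_weight oU vV.
Local Notation S := (spt U wt).

(** [E] represents the subvarifold [W]. Comparing weights only, instead of requiring
    [W = vrestr m V E], makes the notion stable under intersection of representatives. *)
Definition is_part W E := closed_part m U V E /\ forall A, weight m W A = wt (E `&` A).

Lemma vrestr_is_part W E : vmeasurable U m V E -> no_boundary U m V E ->
  W = vrestr m V E -> is_part W E.
Proof.
move=> vE nE ->; have [c1 c2] := vmeasurable_cara oU vV rvar vE; split => // A.
rewrite /weight /= /ocyl /= /orestr; congr (V _).
by apply/seteqP; split=> -[z P] /= => [[[Ez _] [Az GP]]|[[Ez Az] GP]].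
Qed.

Lemma is_part_null W E F : is_part W E -> is_part W F -> wt (E `\` F) = 0%E.
Proof.
move=> [_ hE] [_ hF]; have := hF (E `\` F); rewrite hE.
rewrite (_ : F `&` _ = set0) ?outer_measure0; last by apply/seteqP; split=> // z [? []].
by move=> <-; congr (wt _); apply/seteqP; split=> z; [move=> h; split => //; case: h|case].
Qed.

Lemma is_partI W E F : is_part W E -> is_part W F -> is_part W (E `&` F).
Proof.
move=> pE pF; have N1 := is_part_null pE pF; have N2 := is_part_null pF pE.
have [[cE vE nE] hE] := pE; have [[cF vF nF] hF] := pF; split.
  split; [exact: caratheodory_measurable_setI|exact: caratheodory_measurable_setI|].
  exact: (no_boundaryI oU vV rvar).
move=> A; rewrite hE -[RHS](outer_measureU0 _ N1); apply/eqP; rewrite eq_le; apply/andP; split.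
  apply: le_outer_measure => z [Ez Az]; have [Fz|nFz] := pselect (F z); [left|right] => //.
rewrite [leLHS]outer_measureU0//; apply: le_outer_measure => z [[Ez _] Az].
by split.
Qed.

Lemma part_spt_sub W E : is_part W E -> sptw W `<=` S.
Proof.
move=> [_ hE] z [Uz nz]; apply/(sptP rwt); split => // O.
rewrite nbhsE => -[P [oP Pz] PO] O0; apply: nz; exists (U `&` P) => //; split; first by exists P.
by rewrite hE; apply: (outer_measure_null_sub _ O0) => y [_ [_ /PO]].
Qed.

Lemma part_spt_pos W E z r : is_part W E -> sptw W z -> 0 < r -> wt (E `&` eball z r) <> 0%E.
Proof.
move=> [_ hE] [Uz nz] r0 H; apply: nz; exists (U `&` oball z r); last first.
  by split => //; rewrite /oball /= subrr enorm0.
split; first by exists (oball z r) => //; exact: oball_open.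
by rewrite hE; apply: (outer_measure_null_sub _ H) => y [Ey [_ /oball_sub_eball]].
Qed.

Hypothesis fp : finite_parts_property m U V.
Variable Xi : set vmeas.
Hypothesis dXi : decomposition U m V Xi.

Lemma decomposition_part W : Xi W -> exists E, is_part W E.
Proof.
have [h _ _] := dXi; move=> /h[_ _ _ [E [vE nE WE]]].
by exists E; exact: vrestr_is_part.
Qed.

Lemma decomposition_disjoint W X : Xi W -> Xi X -> W <> X ->
  exists E F, [/\ is_part W E, is_part X F & E `&` F = set0].
Proof.
have [_ h _] := dXi; move=> XW XX WX; have [E [F [[vE vF] EF [nE nF] WE XF]]] := h W X XW XX WX.
by exists E, F; split => //; exact: vrestr_is_part.
Qed.

(** The sets representing two members of a decomposition depend on the pair; for
    finitely many members one intersects them to get disjoint representatives. *)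
Lemma decomposition_locally_finite K : compact K -> K `<=` U ->
  finite_set (Xi `&` [set W | sptw W `&` K !=set0]).
Proof.
move=> cK KU; apply: contrapT => inf; have [N HN] := fp cK KU.
have [B BP NB] := infinite_set_fset N.+1 inf.
pose W i := nth (V : vmeas) (finmap.enum_fset B) i.
have WB i : (i < N.+1)%N -> Xi (W i) /\ sptw (W i) `&` K !=set0.
  by move=> iN; apply: BP; apply: mem_nth; exact: leq_trans NB.
have Wne i j : (i < j < N.+1)%N -> W i <> W j.
  move=> /andP[ij jN] /eqP; rewrite nth_uniq ?finmap.fset_uniq//; try exact: leq_trans NB.
    by rewrite ltn_eqF.
  by apply: leq_trans NB; exact: ltn_trans jN.
have /choice[A0 A0P] : forall i, exists E, (i < N.+1)%N -> is_part (W i) E.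
  move=> i; have [iN|iN] := boolP (i < N.+1)%N; last by exists set0.
  by have [E PE] := decomposition_part (WB i iN).1; exists E.
have /choice[g gP] : forall ij : nat * nat, exists EF, (ij.1 < ij.2 < N.+1)%N ->
    [/\ is_part (W ij.1) EF.1, is_part (W ij.2) EF.2 & EF.1 `&` EF.2 = set0].
  move=> [i j]; have [ijN|ijN] := boolP (i < j < N.+1)%N; last first.
    by exists (set0, set0).
  have /andP[ij jN] := ijN.
  have [E [F EF]] := decomposition_disjoint (WB i (ltn_trans ij jN)).1 (WB j jN).1 (Wne _ _ ijN).
  by exists (E, F).
(* on the diagonal any representative will do *)
pose A i j := if (i < j)%N then (g (i, j)).1 else if (j < i)%N then (g (j, i)).2 else A0 i.
have AP i j : (i < N.+1)%N -> (j < N.+1)%N -> is_part (W i) (A i j).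
  move=> iN jN; rewrite /A; case: ltngtP => ij; last exact: A0P.
    by have [] := gP (i, j); rewrite /= ?ij.
  by have [] := gP (j, i); rewrite /= ?ij.
pose E i := iteri N.+1 (fun j D => D `&` A i j) (A0 i).
have EP i : (i < N.+1)%N -> is_part (W i) (E i).
  move=> iN; suff H k : (k <= N.+1)%N -> is_part (W i) (iteri k (fun j D => D `&` A i j) (A0 i)).
    exact: H.
  elim: k => [_|k IH kN]; first exact: A0P.
  by apply: is_partI; [apply: IH; exact: ltnW|exact: AP].
have EA i j : (j < N.+1)%N -> E i `<=` A i j.
  rewrite /E; elim: N.+1 => // k IH; rewrite ltnS leq_eqVlt => /predU1P[->|/IH h].
    by move=> z [].
  by move=> z [/h].
suff : (N.+1 <= N)%N by rewrite ltnn.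
apply: (HN _ E).
- by move=> i /EP[].
- move=> i j /[dup] ijN /andP[ij jN]; apply/seteqP; split=> // z [Ei Ej].
  have := EA i j jN _ Ei; have := EA j i (ltn_trans ij jN) _ Ej.
  rewrite /A ij ltnNge (ltnW ij) /= => h2 h1.
  by have [_ _ /seteqP[/(_ z) + _]] := gP (i, j) ijN; apply.
- move=> i iN; have [_ [z [Sz Kz]]] := WB i iN; exists z => // r r0.
  exact: (part_spt_pos (EP i iN)).
Qed.

End decompositions.

(** * Decompositions cover the support *)

Section decomposition_cover.
Context {R : realType} {n : nat} (m : nat).
Variable U : set 'rV[R]_n.
Local Notation vmeas := {outer_measure set ('rV[R]_n * 'M[R]_n)%type -> \bar R}.
Local Notation G := (@Grass R n m).
Implicit Types W X : vmeas.
Local Notation sptw W := (spt U (weight m W)).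
Variable V : vmeas.
Local Notation var := (var_measure U V).
Local Notation wt := (weight m V).
Hypotheses (oU : open U) (vV : varifold U m V) (rvar : radon U var).
Let rwt : radon U wt := radon_weight oU vV.
Local Notation S := (spt U wt).
Hypothesis fp : finite_parts_property m U V.
Variable Xi : set vmeas.
Hypothesis dXi : decomposition U m V Xi.

Lemma decomposition_varifold W : Xi W -> varifold U m W.
Proof. by have [h _ _] := dXi; move=> /h[]. Qed.

Definition bump (x : 'rV[R]_n) (r : R) (z : 'rV[R]_n * 'M[R]_n) : R :=
  Num.max 0 (r - enorm (z.1 - x)).

Lemma bump_continuous x r : continuous (bump x r).
Proof.
have ct : continuous (fun z : 'rV[R]_n * 'M[R]_n => r - enorm (z.1 - x)).
  move=> z; apply: cvgB; first exact: cvg_cst.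
  apply: (@continuous_comp _ _ _ (fun z : 'rV[R]_n * 'M[R]_n => z.1 - x) (@enorm R n)).
    by apply: cvgB; [exact: cvg_fst|exact: cvg_cst].
  exact: enorm_continuous.
rewrite (_ : bump x r = fun z => (r - enorm (z.1 - x) + `|r - enorm (z.1 - x)|) / 2).
  move=> z; apply: cvgM; last exact: cvg_cst.
  by apply: cvgD; [exact: ct|apply: cvg_norm; exact: ct].
by apply/funext => z; rewrite /bump maxr_absE add0r sub0r normrN.
Qed.

Lemma bump_ge0 x r z : 0 <= bump x r z.
Proof. by rewrite le_max lexx. Qed.

Lemma bump_eq0 x r z : ~ eball x r z.1 -> bump x r z = 0.
Proof.
move=> nz; apply: max_idPl; rewrite subr_le0 leNgt; apply/negP => h; apply: nz; exact: ltW.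
Qed.

Lemma bump_cc x r : eball x r `<=` U -> cc_fun (U `*` G) (bump x r).
Proof.
move=> rU; split; first by apply: continuous_subspaceT; exact: bump_continuous.
set Y := closure _.
have cK : compact (eball x r `*` G) by apply: compact_setX; [exact: eball_compact|exact: Grass_compact].
have clK : closed (eball x r `*` G) by apply: compact_closed; [exact: norm_hausdorff|].
have YK : Y `<=` eball x r `*` G.
  rewrite [X in _ `<=` X](closure_id _).1//; apply: closure_subset => z [[_ Gz] /eqP nz].
  by split => //; apply: contrapT => h; apply: nz; exact: bump_eq0.
rewrite (_ : _ `&` Y = Y); last first.
  by apply/setIidPr => z /YK[xz Gz]; split => //; exact: rU.
by apply: (subclosed_compact _ cK YK); exact: closed_closure.
Qed.

(** By local finiteness a point outside all supports has a ball disjoint from all of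
    them; a bump function on this ball then contradicts the summation formula. *)
Lemma decomposition_cover x : S x -> exists2 W, Xi W & sptw W x.
Proof.
move=> Sx; apply: contrapT => none; have Ux : U x by case: Sx.
have [|r r0 rU] := @nbhs_eball _ _ x U; first by apply: open_nbhs_nbhs; split.
have fin := decomposition_locally_finite oU vV rvar fp dXi (eball_compact x r) rU.
have [s /andP[s0 sr] sW] : exists2 s, 0 < s <= r & forall W, Xi W -> eball x s `&` sptw W = set0.
  set F := Xi `&` _ in fin.
  have near1 : \forall z \near x, forall W, F W -> (U `\` sptw W) z.
    have nF W : F W -> \forall z \near x, (U `\` sptw W) z.
      move=> [XW _]; apply: open_nbhs_nbhs; split.
        exact: (open_off_spt oU (decomposition_varifold XW)).
      by split => // xW; apply: none; exists W.
    have /finite_seqP[sF EF] := fin; rewrite EF in nF *.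
    elim: sF nF {EF} => [_|W sF IH nF]; first by apply: filterE.
    have h1 : \forall z \near x, (U `\` sptw W) z by apply: nF; exact: mem_head.
    have h2 : \forall z \near x, forall X, [set` sF] X -> (U `\` sptw X) z.
      by apply: IH => X /= hX; apply: nF; rewrite /= inE hX orbT.
    apply: filterS2 h1 h2 => z h1 h2 X /=; rewrite inE => /predU1P[->//|]; exact: h2.
  have [t t0 tF] := nbhs_eball near1.
  exists (Num.min t r); first by rewrite lt_min t0 r0 ge_min lexx orbT.
  move=> W XW; apply/seteqP; split=> // z [xz Wz].
  have zt : eball x t z by apply: (le_trans (xz : enorm _ <= _)); rewrite ge_min lexx.
  have zr : eball x r z by apply: (le_trans (xz : enorm _ <= _)); rewrite ge_min lexx orbT.
  have FW : F W by split => //; exists z.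
  by have [_] := tF _ zt W FW.
have sU : eball x s `<=` U by move=> z xz; apply: rU; exact: le_trans (xz : enorm _ <= _) sr.
have I0 W : Xi W -> ointR W (bump x s) = 0.
  move=> XW; have vW := decomposition_varifold XW.
  have -> : ointR W (bump x s) = Rintegral (cara_measure W) setT (cst 0).
    apply: (@Rintegral_ae _ _ W _ _ (fst @^-1` eball x s)).
    - by apply: (radon_cmeas vW); exact: bump_continuous.
    - exact: (@measurable_cst _ _ (caratheodory_type W)).
    - rewrite -(weight_cyl vW).
      apply: (outer_measure_null_sub _ (spt_complement_null (radon_weight oU vW))) => z xz Wz.
      by have : (eball x s `&` sptw W) z by []; rewrite sW.
    - by move=> z nz; exact: bump_eq0.
  by rewrite Rintegral_cst// mul0r.
have [_ _ /(_ _ (bump_cc sU))] := dXi.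
rewrite esum1; last by move=> W /I0 ->; rewrite maxxx.
rewrite esum1; last by move=> W /I0 ->; rewrite oppr0 maxxx.
rewrite sube0 => -[V0].
have s20 : 0 < s / 2 by rewrite divr_gt0.
have [_ /(_ (eball x (s / 2)))] := (sptP rwt x).1 Sx; apply.
  by apply: filterS (nbhs_oball x s20); exact: oball_sub_eball.
have cB : wt.-caratheodory (eball x (s / 2)) by apply: (radon_closed rwt); exact: eball_closed.
have cBs : wt.-caratheodory (eball x s) by apply: (radon_closed rwt); exact: eball_closed.
have sub2 : eball x (s / 2) `<=` eball x s by move=> z xz; apply: (le_trans (xz : enorm _ <= _)); lra.
have fB : wt (eball x (s / 2)) \is a fin_num.
  rewrite ge0_fin_numE ?outer_measure_ge0//; apply: (radon_compact rwt); first exact: eball_compact.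
  exact: subset_trans sU.
have bfB A : wt.-caratheodory A -> A `<=` eball x s -> bfin V (\1_(A `*` G)).
  move=> cA As; apply: indic_bfin; first exact: (cyl_grass_cara oU vV).
  apply: (@le_lt_trans _ _ (wt (eball x s))); first exact: (le_outer_measure wt).
  by apply: (radon_compact rwt) => //; exact: eball_compact.
have bV : bfin V (bump x s).
  apply: (@bfinI _ _ _ (U `*` G) _ (eball x s `*` G) s).
  - by apply: (radon_cmeas vV); exact: bump_continuous.
  - exact: varifold_null vV.
  - exact: (cyl_grass_cara oU vV).
  - apply: (radon_compact rwt) => //; exact: eball_compact.
  - exact: ltW.
  - move=> z [Uz Gz]; rewrite ger0_norm ?bump_ge0// indicE.
    have [xz|nx] := pselect (eball x s z.1).
      rewrite mem_set//= mulr1 ge_max (ltW s0)/= gerBl enorm_ge0//.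
    by rewrite bump_eq0// mulr_ge0// ltW.
have le1 : (s / 2) * fine (wt (eball x (s / 2))) <= 0.
  rewrite -[X in _ <= X]V0 -[X in _ <= X]/(Rintegral (cara_measure V) setT (bump x s)).
  have -> : fine (wt (eball x (s / 2))) =
      Rintegral (cara_measure V) setT (\1_(eball x (s / 2) `*` G)).
    by rewrite Rintegral_indicM//; exact: (cyl_grass_cara oU vV).
  rewrite -RintZ; last exact: bfB.
  apply: Rint_le => //; first by apply: bfinZ; exact: bfB.
  move=> z; rewrite indicE; have [[xz Gz]|nz] := pselect ((eball x (s / 2) `*` G) z).
    rewrite mem_set// mulr1 le_max; apply/orP; right.
    by move: (xz : enorm _ <= _); lra.
  by rewrite memNset// mulr0 bump_ge0.
rewrite -(fineK fB); congr (_%:E); apply/eqP; rewrite eq_le fine_ge0 ?outer_measure_ge0// andbT.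
by rewrite pmulr_rle0 in le1.
Qed.

Lemma component_decomposition C : components S C ->
  C = \bigcup_(W in [set W | Xi W /\ C `&` sptw W !=set0]) sptw W.
Proof.
move=> PC; apply/seteqP; split=> z.
  move=> Cz; have Sz := component_sub oU vV rvar fp PC Cz.
  by have [W XW Wz] := decomposition_cover Sz; exists W => //; split => //; exists z.
move=> [W [XW [y [Cy Wy]]] Wz].
rewrite (component_eq PC Cy); have [E pE] := decomposition_part oU vV rvar dXi XW.
apply: (connected_component_max Wy _ _ Wz).
  exact: (part_spt_sub oU vV pE).
have [h _ _] := dXi; have [_ _ ind _] := h W XW.
exact: (indecomposable_connected_spt oU ind).
Qed.

End decomposition_cover.

Theorem mainTheorem13 (R : realType) (m n : nat) (U : set 'rV[R]_n)
    (V : {outer_measure set ('rV[R]_n * 'M[R]_n)%type -> \bar R}) :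
  (0 < m)%N -> (0 < n)%N -> (m <= n)%N ->
  open U ->
  varifold U m V ->
  radon U (var_measure U V) ->
  weight m V [set x | ~ exists2 l : \bar R,
                density_is m (weight m V) x l & (1 <= l)%E] = 0%E ->
  ((1 < m)%N ->
     Lploc U m (weight m V) (mean_curv U m V) /\
     forall theta, test_fun U theta ->
       first_var V theta =
       - ointR (weight m V) (fun x => dot (mean_curv U m V x) (theta x))) ->
  let S := spt U (weight m V) in
  let Phi := components S in
  [/\ forall C, Phi C -> forall Xi, decomposition U m V Xi ->
        C = \bigcup_(W in [set W | Xi W /\
                C `&` spt U (weight m W) !=set0]) spt U (weight m W),
      forall K, compact K -> K `<=` U ->
        finite_set (Phi `&` [set C | C `&` K !=set0]),
      forall C, Phi C -> relopen S C
    & forall C, Phi C ->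
        spt U (orestr (weight m V) C) = C /\ no_boundary U m V C].
Proof.
move=> m0 _ _ oU vV rvar dens curv S Phi.
have fp := finite_parts_property_holds m0 oU vV rvar dens curv.
split.
- by move=> C PC Xi dXi; exact: (component_decomposition oU vV rvar fp dXi).
- by move=> K cK KU; exact: (finite_components oU vV rvar fp).
- by move=> C PC; case: (component_clopen oU vV rvar fp PC).
- move=> C PC; split; first exact: (component_spt oU vV rvar fp).
  apply: (clopen_no_boundary oU vV rvar); exact: (component_clopen oU vV rvar fp).
Qed.
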